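(* Let $\nu$ be a finite positive measure supported on $[0,1]$ such that $\int_0^1\frac{d\nu(r)}{1-r}$ diverges (i.e. equals $+\infty$). Then there exists $\omega\in\widehat{\mathcal D}$ such that $$B^\omega_z(\zeta)=\frac{1}{1-\overline{z}\zeta}\int_0^1\frac{d\nu(r)}{1-r\overline{z}\zeta},\qquad z,\zeta\in\mathbb D.$$
   Context: $\mathbb D=\{z\in\mathbb C:|z|<1\}$. $\widehat{\mathcal D}$ denotes the set of finite non-zero positive Borel measures $\omega$ on $[0,1)$ for which there is $C=C(\omega)>0$ such that $\widehat\omega(r)\le C\,\widehat\omega\left(\frac{1+r}{2}\right)$ for all $0\le r<1$, where $\widehat\omega(r)=\int_r^1 d\omega$. For such $\omega$, $\omega\otimes m$ is the measure on $\mathbb D$ given by $d(\omega\otimes m)(re^{i\theta})=r\,d\omega(r)\,d\theta$. The weighted Bergman space $A^2_\omega$ consists of the analytic functions $f$ in $\mathbb D$ with $\|f\|_{A^2_\omega}^2=\int_{\mathbb D}|f|^2\,d(\omega\otimes m)<\infty$; for $\omega\in\widehat{\mathcal D}$ it is a Hilbert space on which point evaluations are bounded, and $B^\omega_z\in A^2_\omega$ is its reproducing kernel: $f(z)=\int_{\mathbb D}f(\zeta)\overline{B^\omega_z(\zeta)}\,d(\omega\otimes m)(\zeta)$ for all $f\in A^2_\omega$, $z\in\mathbb D$. In the divergence condition, a point mass of $\nu$ at $r=1$ makes the integral infinite. *)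

(* Defs.v *)
From HB Require Import structures.
From mathcomp Require Export all_boot all_order all_algebra.
From mathcomp Require Export all_classical all_reals all_analysis.
From mathcomp.real_closed Require Export complex.
Set Implicit Arguments.
Unset Strict Implicit.
Unset Printing Implicit Defensive.
Import Order.TTheory GRing.Theory Num.Theory.
Import numFieldNormedType.Exports.
Local Open Scope classical_set_scope.
Local Open Scope ring_scope.
Local Open Scope complex_scope.

Section Bergman.
Context {R : realType}.
Implicit Types (omega : {finite_measure set (measurableTypeR R) -> \bar R}).
Implicit Types (f g : R[i] -> R[i]).

Definition unit_disc : set R[i] := [set z | `|z| < 1].

(* `R[i]^o` is `R[i]` with the topology of the norm (`complex R` itself
   carries no canonical topology). *)
Definition analytic_on_disc f : Prop :=
  forall a, unit_disc a ->
  exists (c : nat -> R[i]) (rho : R), 0 < rho /\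
    forall z, `|z - a| < rho%:C ->
      series (fun n => c n * (z - a) ^+ n : R[i]^o) @ \oo --> (f z : R[i]^o).

(* Componentwise integral of a complex-valued function. *)
Definition complex_integral d (T : measurableType d)
    (mu : {measure set T -> \bar R}) (D : set T) (h : T -> R[i]) : R[i] :=
  (\int[mu]_(x in D) complex.Re (h x)) +i* (\int[mu]_(x in D) complex.Im (h x)).

(* The tail includes the point r, which omega may charge. *)
Definition omega_hat omega (r : R) : \bar R := omega `[r, 1[%classic.

(* A measure on [0, 1[ is encoded as a Borel measure on R carried by [0, 1[. *)
Definition Dhat omega : Prop :=
  [/\ omega (~` `[0, 1[%classic) = 0%E,
      omega setT != 0%E &
      exists C : R, 0 < C /\ forall r : R, 0 <= r < 1 ->
        (omega_hat omega r <= C%:E * omega_hat omega ((1 + r) / 2))%E].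

Definition polar (r theta : R) : R[i] := (r * cos theta) +i* (r * sin theta).

Definition polar_rect : set (measurableTypeR R * measurableTypeR R) :=
  `[0, 1[%classic `*` `[0, 2 * pi[%classic.

(* Integrals over the disc are taken in polar coordinates against
   r d(omega)(r) d(theta), with no factor 1/(2 pi). *)
Definition bergman_normsq omega f : \bar R :=
  (\int[omega \x lebesgue_measure]_(p in polar_rect)
     (p.1 * Normc.normc (f (polar p.1 p.2)) ^+ 2)%:E)%E.

Definition bergman_space omega : set (R[i] -> R[i]) :=
  [set f | analytic_on_disc f /\ (bergman_normsq omega f < +oo)%E].

Definition bergman_inner omega f g : R[i] :=
  complex_integral (omega \x lebesgue_measure)%E polar_rect
    (fun p => p.1%:C * (f (polar p.1 p.2) * (g (polar p.1 p.2))^*)).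

(* Only the values on the disc are constrained, and there they determine B
   uniquely when omega is in Dhat. *)
Definition reproducing_kernel omega (B : R[i] -> R[i] -> R[i]) : Prop :=
  forall z, unit_disc z ->
    bergman_space omega (B z) /\
    forall f, bergman_space omega f -> f z = bergman_inner omega f (B z).

End Bergman.

(* Main.v *)
Require Import Defs.
From HB Require Import structures.
From mathcomp Require Import measurable_realfun ring lra zify.

(** Put [w = z^* * zeta] and let [b n] be the sum of the first [n + 1] moments
    of [nu] ([kernel_coef]). Expanding both Cauchy kernels in the claimed
    formula gives [\sum_n b n * w ^+ n]. For a radial measure the monomials are
    orthogonal, so the kernel of the Bergman space is the sum of
    [w ^+ n / N n], where [N n = 2 * pi * \int r ^ (2 n + 1) d omega] is the
    squared norm of the [n]-th monomial. The task is therefore to find a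
    doubling measure [omega] with [2 * pi * \int r ^ (2 n + 1) d omega = 1 / b n].

    The measure. Prescribing only the odd moments leaves freedom, and the
    substitution [r = s ^ 2] uses it: the numbers
    [a j = \int s ^ j / (1 + s) d nu] ([half_moment]) are completely monotone,
    and their partial sum of length [2 n + 2] is [b n] ([half_moment_sum]). The
    reciprocals of the partial sums of a completely monotone sequence are again
    completely monotone ([cm_inv_partial_sums]), so the theorem of Hausdorff
    ([hausdorff_moment]) yields a finite measure on the closed unit interval
    having all of them as moments, in particular the required odd ones. Two
    properties remain. The divergence hypothesis makes [b n] unbounded
    ([kernel_coef_unbounded]), hence the moments tend to [0] and there is no
    atom at [1] ([no_atom_at1]). The partial sums of the nonincreasing sequence
    [a] are subadditive ([half_moment_sumM]), so the [k]-th moment is at most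
    [65] times the [65 k]-th one; since multiplying the exponent by [65] almost
    annihilates the contribution of the points at distance of order [1 / k]
    from [1], this forces the tails to be doubling ([tail_scale],
    [Dhat_of_moments]).

    The reproducing property. Analyticity is given by local power series, so a
    global Taylor series has to be produced ([disc_taylor]). Contour integrals
    are replaced by means over the [N]-th roots of unity on a circle: a radial
    increment of an analytic function is nearly proportional to its increment
    along the circle, and the latter sum to zero ([circle_mean_step]), so these
    means converge to the value at the centre ([circle_mean_cvg]). Applied to a
    divided difference this gives Cauchy's formula ([cauchy_formula]), and the
    geometric expansion of its kernel gives the Taylor coefficients
    ([cauchy_coefficients]). With the Taylor series, Fubini's theorem and the
    orthogonality of the characters of the circle ([angular_coefficient],
    [inner_monomial]) give the inner product of [f] with each monomial. The
    series of the kernel converges uniformly on the disc ([kernel_series]), so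
    it may be integrated term by term ([inner_series]), and the inner product of
    [f] with the kernel is the Taylor series of [f] at [z]
    ([bergman_kernel_reproducing]). *)

Set Implicit Arguments.
Unset Strict Implicit.
Unset Printing Implicit Defensive.
Import Order.TTheory GRing.Theory Num.Theory.
Import numFieldNormedType.Exports.
Import Normc.
Local Open Scope classical_set_scope.
Local Open Scope ring_scope.

(** * Completely monotone sequences *)

Lemma le_of_eq d (T : porderType d) (x y : T) : x = y -> (x <= y)%O.
Proof. by move=> ->. Qed.

Section CompletelyMonotone.
Context {R : realType}.
Implicit Types (c d : nat -> R).

Definition drop1 c : nat -> R := fun k => c k - c k.+1.

(** Nonnegativity of the differences up to order [n]. Keeping the order finite
    lets an argument feed the property at order [n] into itself to reach order
    [n + 1]. *)
Fixpoint cm_upto n c : Prop :=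
  (forall k, 0 <= c k) /\ (if n is m.+1 then cm_upto m (drop1 c) else True).

Definition completely_monotone c := forall n, cm_upto n c.

Lemma cm_upto_ge0 n c k : cm_upto n c -> 0 <= c k.
Proof. by case: n => [|n] [+ _]; apply. Qed.

Lemma cm_upto_eq n c d : c =1 d -> cm_upto n c -> cm_upto n d.
Proof. by move=> /funext ->. Qed.

Lemma cm_uptoW n c : cm_upto n.+1 c -> cm_upto n c.
Proof.
by elim: n c => [|n IH] c [c0 cm]; split => //; exact: IH.
Qed.

Lemma cm_upto_shift n c : cm_upto n c -> cm_upto n (fun k => c k.+1).
Proof.
elim: n c => [|n IH] c [c0 cm]; split => //.
exact: (IH _ cm).
Qed.

Lemma cm_uptoD n c d : cm_upto n c -> cm_upto n d ->
  cm_upto n (fun k => c k + d k).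
Proof.
elim: n c d => [|n IH] c d [c0 cmc] [d0 cmd]; split => //.
- by move=> k; rewrite addr_ge0.
- by move=> k; rewrite addr_ge0.
- by apply: cm_upto_eq (IH _ _ cmc cmd) => k; rewrite /drop1; ring.
Qed.

(** Leibniz rule: the drop of [c * d] is [c] times the drop of [d] plus the
    drop of [c] times the shift of [d]. *)
Lemma cm_uptoM n c d : cm_upto n c -> cm_upto n d ->
  cm_upto n (fun k => c k * d k).
Proof.
elim: n c d => [|n IH] c d.
  by move=> [c0 _] [d0 _]; split => // k; rewrite mulr_ge0.
move=> cc dd; have [[c0 cmc] [d0 cmd]] := (cc, dd).
split => [k|]; first by rewrite mulr_ge0.
have := cm_uptoD (IH _ _ cmc (cm_uptoW dd))
  (IH _ _ (cm_upto_shift (cm_uptoW cc)) cmd).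
by apply: cm_upto_eq => k; rewrite /drop1; ring.
Qed.

Lemma cm_uptoZ n (a : R) c : 0 <= a -> cm_upto n c -> cm_upto n (fun k => a * c k).
Proof.
move=> a0; apply: cm_uptoM; elim: n => [|n IH] //; split => //.
apply: (@cm_upto_eq _ (fun=> 0)) => [k|]; first by rewrite /drop1 subrr.
by elim: n {IH} => [|n IH] //; split => //; apply: cm_upto_eq IH => k;
  rewrite /drop1 subrr.
Qed.

(** The reciprocals [v k] of the partial sums of a completely monotone
    sequence satisfy [v k - v k.+1 = a k * v k * v k.+1], so each order of
    positivity of [v] yields the next one. *)
Lemma cm_inv_partial_sums c : completely_monotone c -> 0 < c 0%N ->
  completely_monotone (fun k => (\sum_(j < k.+1) c j)^-1).
Proof.
move=> cm c0.
have S0 k : 0 < \sum_(j < k.+1) c j.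
  by rewrite big_ord_recl ltr_pwDl// sumr_ge0// => i _; exact: (cm_upto_ge0 _ (cm 0%N)).
elim => [|n IH]; first by split => // k; rewrite invr_ge0 ltW.
split => [k|]; first by rewrite invr_ge0 ltW.
apply: cm_upto_eq (cm_uptoM (cm_upto_shift (cm n)) (cm_uptoM IH (cm_upto_shift IH))).
move=> k; rewrite /drop1 ![\sum_(j < k.+2) _]big_ord_recr/=.
have := S0 k; have := S0 k.+1; rewrite big_ord_recr/=.
set s := \sum_(j < k.+1) _ => h1 h2.
by field; rewrite (gt_eqF h1) (gt_eqF h2).
Qed.

(** * Bernstein weights and the moment functional *)

(** For the moments [c] of a measure on the unit interval, these are its
    integrals against the Bernstein basis polynomials
    [C(n, k) t ^ k (1 - t) ^ (n - k)]. When [c] is completely monotone they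
    are nonnegative, and they serve as masses at the points [k / n]. *)
Definition bern_weight c (n k : nat) : R := 'C(n, k)%:R * iter (n - k) drop1 c k.

Definition bern_mean c (n : nat) (g : R -> R) : R :=
  \sum_(k < n.+1) bern_weight c n k * g (k%:R / n%:R).

Lemma iter_drop1_ge0 c m k : completely_monotone c -> 0 <= iter m drop1 c k.
Proof.
move=> cm; suff : completely_monotone (iter m drop1 c) by move/(_ 0%N)/cm_upto_ge0.
by elim: m => [//|m IH] j; have [] := IH j.+1.
Qed.

Lemma bern_weight_ge0 c n k : completely_monotone c -> 0 <= bern_weight c n k.
Proof. by move=> cm; rewrite mulr_ge0// iter_drop1_ge0. Qed.

Lemma iter_drop1_shift c m k :
  iter m drop1 (fun k => c k.+1) k = iter m drop1 c k.+1.
Proof. by elim: m k => [//|m IH] k /=; rewrite {1}/drop1 !IH. Qed.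

(** Pascal rule: the weights of order [n + 1] refine those of order [n]. *)
Lemma bern_weight_sum c (n : nat) : \sum_(k < n.+1) bern_weight c n k = c 0%N.
Proof.
elim: n => [|n IH]; first by rewrite big_ord1 /bern_weight/= bin0 mul1r.
rewrite -[RHS]IH /bern_weight big_ord_recl/= bin0 mul1r.
transitivity (iter n.+1 drop1 c 0%N +
    \sum_(i < n.+1) 'C(n, i.+1)%:R * iter (n - i)%N drop1 c i.+1 +
    \sum_(i < n.+1) 'C(n, i)%:R * iter (n - i)%N drop1 c i.+1).
  rewrite -[RHS]addrA; congr (_ + _); rewrite -big_split/=; apply: eq_bigr => i _.
  by rewrite /bump/= add1n subSS binS natrD mulrDl.
have -> : iter n.+1 drop1 c 0%N +
    \sum_(i < n.+1) 'C(n, i.+1)%:R * iter (n - i)%N drop1 c i.+1 =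
    \sum_(i < n.+1) 'C(n, i)%:R * iter (n.+1 - i)%N drop1 c i.
  rewrite [RHS]big_ord_recl/= bin0 mul1r; congr (_ + _).
  rewrite big_ord_recr/= bin_small// mul0r addr0; apply: eq_bigr => i _.
  by rewrite /bump/= add1n subSS.
rewrite -big_split/=; apply: eq_bigr => i _.
by rewrite subSn ?leq_ord//= /drop1; ring.
Qed.

Lemma bern_meanS c n (g : R -> R) :
  bern_mean c n.+1 (fun t => t * g t) =
  \sum_(k < n.+1) bern_weight (fun k => c k.+1) n k * g (k.+1%:R / n.+1%:R).
Proof.
rewrite /bern_mean big_ord_recl/= !mul0r mulr0 add0r.
apply: eq_bigr => i _; rewrite /bump/= add1n /bern_weight subSS iter_drop1_shift.
suff -> : 'C(n, i)%:R = 'C(n.+1, i.+1)%:R * (i.+1%:R / n.+1%:R) :> R by ring.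
by rewrite mulrA -natrM mulnC -mul_bin_diag natrM mulrC mulKf// pnatr_eq0.
Qed.

Lemma exprB_le (x y : R) n : `|x| <= 1 -> `|y| <= 1 ->
  `|x ^+ n - y ^+ n| <= n%:R * `|x - y|.
Proof.
move=> x1 y1; elim: n => [|n IH]; first by rewrite !expr0 subrr normr0 mul0r.
rewrite !exprS (_ : _ - _ = x * (x ^+ n - y ^+ n) + (x - y) * y ^+ n); last by ring.
rewrite -[n.+1%:R]natr1 [(n%:R + 1) * _]mulrDl mul1r; apply: le_trans (ler_normD _ _) _; apply: lerD.
  by rewrite normrM; apply: le_trans IH; rewrite ler_piMl.
by rewrite normrM normrX ler_piMr// exprn_ile1.
Qed.

(** Multiplying the integrand by [t] shifts the sequence, by the absorption
    identity for binomial coefficients, and moves each node [k / (n + 1)] to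
    [(k + 1) / (n + 2)], that is by at most [1 / (n + 1)]. *)
Lemma bern_mean_err c p n : completely_monotone c ->
  `|bern_mean c n.+2 (fun t => t ^+ p.+1) -
    bern_mean (fun k => c k.+1) n.+1 (fun t => t ^+ p)| <= p%:R * c 1%N / n.+1%:R.
Proof.
move=> cm.
have cmS : completely_monotone (fun k => c k.+1) by move=> m; exact: cm_upto_shift.
have -> : bern_mean c n.+2 (fun t => t ^+ p.+1) = bern_mean c n.+2 (fun t => t * t ^+ p).
  by apply: eq_bigr => i _; rewrite exprS.
rewrite bern_meanS -sumrB; apply: le_trans (ler_norm_sum _ _ _) _.
rewrite -(bern_weight_sum (fun k => c k.+1) n.+1) mulr_sumr mulr_suml.
apply: ler_sum => k _; rewrite -mulrBr normrM ger0_norm ?bern_weight_ge0//.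
rewrite -mulrA mulrCA; apply: ler_wpM2l; first exact: bern_weight_ge0.
have kn : (k%:R <= n.+1%:R :> R) by rewrite ler_nat -ltnS.
have k0 : (0 <= k%:R :> R) by [].
have n0 : (0 < n.+1%:R :> R) by [].
set a : R := k.+1%:R / n.+2%:R; set b : R := k%:R / n.+1%:R.
have a1 : `|a| <= 1.
  rewrite ger0_norm ?divr_ge0// ler_pdivrMr// mul1r ler_nat ltnS.
  by rewrite -(ler_nat R).
have b1 : `|b| <= 1 by rewrite ger0_norm ?divr_ge0// ler_pdivrMr// mul1r.
apply: le_trans (exprB_le p a1 b1) _; apply: ler_wpM2l => //.
have -> : a - b = (n.+1%:R - k%:R) / (n.+2%:R * n.+1%:R).
  rewrite /a /b -[n.+2%:R]natr1 -[k.+1%:R]natr1.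
  field; rewrite -?natr1; lra.
rewrite ger0_norm; last by rewrite divr_ge0 ?subr_ge0.
rewrite invfM mulrA ler_piMl ?invr_ge0 ?ltW//.
rewrite ltr_pdivrMr// mul1r -[n.+2%:R]natr1; lra.
Qed.

Lemma cvg_harmonicM (a : R) : (fun n => a / n.+1%:R) @ \oo --> (0 : R).
Proof.
rewrite -[X in _ --> X](mulr0 a); apply: cvgM; first exact: cvg_cst.
exact: cvg_harmonic.
Qed.

Lemma cvg_of_shift (u : nat -> R) (k : nat) (l : R) : u (n + k)%N @[n --> \oo] --> l -> u @ \oo --> l.
Proof. by rewrite cvg_shiftn. Qed.

Lemma cvg_to_shift (u : nat -> R) (k : nat) (l : R) : u @ \oo --> l -> u (n + k)%N @[n --> \oo] --> l.
Proof. by rewrite cvg_shiftn. Qed.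

(** Each power of [t] is traded for a shift of the sequence; once the power is
    exhausted the mean is exactly the first term. *)
Lemma bern_mean_cvg c p : completely_monotone c ->
  bern_mean c n (fun t => t ^+ p) @[n --> \oo] --> c p.
Proof.
elim: p c => [|p IH] c cm.
  rewrite (_ : (fun n => _) = fun=> c 0%N); first exact: cvg_cst.
  by apply/funext => n; rewrite -(bern_weight_sum c n); apply: eq_bigr => i _; rewrite mulr1.
have cmS : completely_monotone (fun k => c k.+1) by move=> m; exact: cm_upto_shift.
have h := @cvg_to_shift _ 1 _ (IH _ cmS).
apply: (@cvg_of_shift _ 2).
set f := (fun n => _) in h.
pose w := (fun n => bern_mean c n.+2 (fun t => t ^+ p.+1) -
    bern_mean (fun k => c k.+1) n.+1 (fun t => t ^+ p)).
have e0 : w @ \oo --> (0 : R).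
  apply: (@norm_cvg0 _ R^o).
  apply: (@squeeze_cvgr _ _ _ _ (fun=> 0) (fun n => p%:R * c 1%N / n.+1%:R)).
  - by near=> n; rewrite normr_ge0 bern_mean_err.
  - exact: cvg_cst.
  - exact: cvg_harmonicM.
have : (fun n => f n + w n) @ \oo --> c p.+1 + 0 by exact: cvgD.
rewrite addr0 (_ : (fun n => f n + w n) = fun n => bern_mean c (n + 2) (fun t => t ^+ p.+1))//.
by apply/funext => n; rewrite /f /w addn1 addn2 addrC subrK.
Unshelve. all: by end_near. Qed.

End CompletelyMonotone.

(** * Stieltjes measure of a monotone function *)

Section Approximation.
Context {R : realType}.

Section StieltjesOfMonotone.
Variable F : R -> R.
Hypothesis ndF : {homo F : x y / x <= y}.
Hypothesis F0 : forall x, x < 0 -> F x = 0.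
Hypothesis F1 : forall x, 1 <= x -> F x = 1.

(** A pointwise limit of distribution functions is monotone but need not be
    right continuous, which a Stieltjes measure requires. *)
Definition right_lim (x : R) : R := inf [set F y | y in [set y | x < y]].

Lemma monotone_ge0 x : 0 <= F x.
Proof.
have [x0|x0] := ltP x 0; first by rewrite F0.
by rewrite -(F0 (x := -1)) ?ndF// ?ltrN10//; lra.
Qed.

Lemma right_lim_le x y : x < y -> right_lim x <= F y.
Proof.
move=> xy; apply: ge_inf; last by exists y.
by exists 0 => _ [z _ <-]; exact: monotone_ge0.
Qed.

Lemma right_lim_ge x : F x <= right_lim x.
Proof.
apply: lb_le_inf; first by exists (F (x + 1)); exists (x + 1) => //=; rewrite ltrDl.
by move=> _ [z /= xz <-]; apply: ndF; exact: ltW.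
Qed.

Lemma right_lim_nd : {homo right_lim : x y / x <= y}.
Proof.
move=> x y xy; apply: lb_le_inf; first by exists (F (y + 1)); exists (y + 1) => //=; rewrite ltrDl.
move=> _ [z /= yz <-]; apply: right_lim_le; exact: le_lt_trans yz.
Qed.

Lemma right_lim_lt0 x : x < 0 -> right_lim x = 0.
Proof.
move=> x0; apply/eqP; rewrite eq_le; apply/andP; split; last first.
  exact: le_trans (monotone_ge0 x) (right_lim_ge x).
by rewrite -(F0 (x := x / 2)) ?right_lim_le//; lra.
Qed.

Lemma right_lim_ge1 x : 1 <= x -> right_lim x = 1.
Proof.
move=> x1; apply/eqP; rewrite eq_le; apply/andP; split; last first.
  by rewrite -(F1 x1) right_lim_ge.
by rewrite -(F1 (x := x + 1)) ?right_lim_le//; lra.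
Qed.

Lemma right_lim_rc : right_continuous right_lim.
Proof.
move=> x; apply/cvgrPdist_lt => e e0.
have [_ [y /= xy <-] Fy] : exists2 u, [set F y | y in [set y | x < y]] u & u < right_lim x + e.
  apply: inf_adherent => //; split.
    by exists (F (x + 1)); exists (x + 1) => //=; rewrite ltrDl.
  by exists 0 => _ [z _ <-]; exact: monotone_ge0.
near=> z.
have xz : x < z by near: z; exact: nbhs_right_gt.
have zy : z < y by near: z; exact: nbhs_right_lt.
rewrite distrC ger0_norm ?subr_ge0 ?right_lim_nd ?ltW//.
by have := right_lim_le zy; lra.
Unshelve. all: by end_near. Qed.

Lemma right_lim_cvgNy : right_lim @ -oo --> (0 : R).
Proof.
apply: cvg_near_cst; near=> x; apply: right_lim_lt0.
by near: x; exact: nbhs_ninfty_lt.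
Unshelve. all: by end_near. Qed.

Lemma right_lim_cvgy : right_lim @ +oo --> (1 : R).
Proof.
apply: cvg_near_cst; near=> x; apply: right_lim_ge1.
by near: x; exact: nbhs_pinfty_ge.
Unshelve. all: by end_near. Qed.

Lemma stieltjes_right_lim : exists P : probability (measurableTypeR R) R,
  P (~` `[0, 1]%classic) = 0%E /\
  forall x, 0 <= x -> P `[0, x]%classic = (right_lim x)%:E.
Proof.
pose G : cumulativeBounded (0 : R) (1 : R) := HB.pack right_lim
  (isCumulative.Build R _ R right_lim right_lim_nd right_lim_rc)
  (isCumulativeBounded.Build R 0 1 right_lim right_lim_cvgNy right_lim_cvgy).
pose P : probability (measurableTypeR R) R := lebesgue_stieltjes_measure G.
have PE a b : a <= b -> P `]a, b]%classic = (right_lim b - right_lim a)%:E.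
  move=> ab; rewrite /P/= /lebesgue_stieltjes_measure /measure_extension.
  by rewrite measurable_mu_extE/=; [rewrite wlength_itv_bnd|exact: is_ocitv].
have mI (i : interval R) : measurable ([set` i] : set (measurableTypeR R)).
  exact: measurable_itv.
(* The half-open intervals produced by the construction miss the point [0]
   when they start there, so they start at [-1] and the part left of [0] is
   shown to be null. *)
have Pneg : P `]-1, 0[%classic = 0%E.
  have : P.-negligible (\bigcup_n `](-1 : R), 0 - n.+1%:R^-1]%classic).
    apply: negligible_bigcup => n; apply/negligibleP; first exact: mI.
    have n0 : 0 < n.+1%:R^-1 :> R by [].
    have n1 : n.+1%:R^-1 <= 1 :> R by rewrite invf_le1// ler1n.
    have := PE (-1) (0 - n.+1%:R^-1); rewrite sub0r lerN2 => /(_ n1).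
    by rewrite !right_lim_lt0 ?subrr ?ltrN10// oppr_lt0.
  by rewrite -itv_bnd_open_bigcup => /negligibleP; apply; exact: mI.
have P0 (x : R) : 0 <= x -> P `[0, x]%classic = (right_lim x)%:E.
  move=> x0.
  have : P `]-1, x]%classic = (P `](-1)%R, 0%R[%classic + P `[0%R, x]%classic)%E.
    rewrite -measureU//; try exact: mI.
      congr (P _); rewrite -(@itv_bndbnd_setU _ _ _ (BLeft 0))// bnd_simp.
      exact: ltrN10.
    rewrite -subset0 => y [] /=; rewrite !in_itv/= => /andP[_ y0] /andP[y0' _].
    by move: y0; rewrite ltNge y0'.
  by rewrite Pneg add0e PE ?(right_lim_lt0 (x := -1)) ?subr0//; lra.
exists P; split => //.
by rewrite probability_setC ?P0 ?right_lim_ge1 ?subee//; exact: mI.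
Qed.

End StieltjesOfMonotone.

(** * Riemann sums of a power against the indicators of initial intervals *)

Definition pow_step p N j : R := (j.+1%:R / N%:R) ^+ p - (j%:R / N%:R) ^+ p.

Lemma pow_step_ge0 p N j : 0 <= pow_step p N j.
Proof.
by rewrite subr_ge0 lerXn2r ?nnegrE ?divr_ge0// ler_wpM2r ?invr_ge0// ler_nat.
Qed.

Lemma pow_step_le p N j : (j < N)%N -> pow_step p N j <= p%:R / N%:R.
Proof.
move=> jN; have N0 : 0 < N%:R :> R by rewrite ltr0n (leq_ltn_trans _ jN).
have le1 i : (i <= N)%N -> `|i%:R / N%:R : R| <= 1.
  by move=> iN; rewrite ger0_norm ?divr_ge0// ler_pdivrMr// mul1r ler_nat.
apply: le_trans (ler_norm _) _; apply: le_trans (exprB_le p (le1 _ jN) (le1 _ (ltnW jN))) _.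
rewrite -mulrBl -natr1 addrAC subrr add0r mul1r ger0_norm ?invr_ge0 ?ler0n//.
Qed.

(** A Riemann sum of [1 - t ^ p], the integral of the indicator of [t <= x]
    against [d (x ^ p)]. Integrating it against a measure involves only values
    of the distribution function on a grid, which is all that a pointwise
    limit of such functions controls. *)
Definition pow_sum p N (t : R) : R :=
  \sum_(j < N) pow_step p N j * (t <= j%:R / N%:R)%R%:R.

Lemma pow_telescope p N (s : R) : (0 < N)%N -> 0 <= s <= 1 ->
  \sum_(j < N) (Num.max (j.+1%:R / N%:R) s ^+ p - Num.max (j%:R / N%:R) s ^+ p) =
  1 - s ^+ p.
Proof.
move=> N0 /andP[s0 s1].
rewrite -(big_mkord xpredT (fun j => Num.max (j.+1%:R / N%:R) s ^+ p - Num.max (j%:R / N%:R) s ^+ p)).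
rewrite (telescope_sumr (fun j => Num.max (j%:R / N%:R) s ^+ p))//.
by rewrite divff ?pnatr_eq0 ?gtn_eqF// mul0r (max_idPl s1) (max_idPr s0) expr1n.
Qed.

(** With [max] in place of the nodes, the jumps telescope; comparing node by
    node, the nodes at or after [t] keep their whole jump, and replacing [t] by
    [t + 1/N] kills the single node interval that contains [t]. *)
Lemma pow_sum_approx p N (t : R) : (0 < N)%N -> 0 <= t <= 1 ->
  `|1 - t ^+ p - pow_sum p N t| <= p%:R / N%:R.
Proof.
move=> N0 /andP[t0 t1].
have Np : 0 < N%:R :> R by rewrite ltr0n.
have xS j : j.+1%:R / N%:R = j%:R / N%:R + N%:R^-1 :> R by rewrite -natr1 mulrDl mul1r.
have iN0 : 0 < N%:R^-1 :> R by rewrite invr_gt0.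
have le_pow (x y : R) : 0 <= x -> x <= y -> x ^+ p <= y ^+ p.
  by move=> x0 xy; rewrite lerXn2r ?nnegrE//; exact: le_trans xy.
have up : pow_sum p N t <= 1 - t ^+ p.
  rewrite -(pow_telescope p N0 (s := t)) ?t0//; apply: ler_sum => j _.
  have j0 : 0 <= j%:R / N%:R :> R by rewrite divr_ge0.
  have [tj|tj] := leP t (j%:R / N%:R); rewrite ?mulr1 ?mulr0.
    by rewrite /pow_step xS (max_idPl _)//; lra.
  by rewrite subr_ge0; apply: le_pow => //; rewrite le_max lexx orbT.
pose s := Num.min (t + N%:R^-1) 1.
have s01 : 0 <= s <= 1 by rewrite /s le_min ge_min lexx orbT ler01 !andbT; lra.
have ts : t <= s by rewrite /s le_min t1 andbT; lra.
have lo : 1 - s ^+ p <= pow_sum p N t.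
  rewrite -(pow_telescope p N0 s01); apply: ler_sum => j _.
  have j0 : 0 <= j%:R / N%:R :> R by rewrite divr_ge0.
  have j1 : j.+1%:R / N%:R <= 1 :> R by rewrite ler_pdivrMr// mul1r ler_nat.
  have [tj|tj] := leP t (j%:R / N%:R); rewrite ?mulr1 ?mulr0.
    have [sj|sj] := leP (j.+1%:R / N%:R) s.
      rewrite (max_idPr _) ?subrr ?pow_step_ge0//.
      by apply: le_trans sj; rewrite xS lerDl ltW.
    by rewrite /pow_step lerB// le_pow// le_max lexx.
  have sj : j.+1%:R / N%:R <= s by rewrite /s le_min j1 andbT xS; lra.
  have sj' : j%:R / N%:R <= s by apply: le_trans sj; rewrite xS lerDl ltW.
  by rewrite (max_idPr sj) (max_idPr sj') subrr.
have st : s ^+ p - t ^+ p <= p%:R / N%:R.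
  apply: le_trans (ler_norm _) _; case/andP: s01 => s0 s1.
  apply: le_trans (exprB_le p _ _) _; rewrite ?ger0_norm ?subr_ge0//.
  by apply: ler_wpM2l => //; rewrite lerBlDl /s ge_min lexx.
rewrite ger0_norm; lra.
Qed.

End Approximation.

(** * The Hausdorff moment problem *)

Section HausdorffMoment.
Context {R : realType}.

Lemma bounded_ultra_cvg (U : set_system nat) (u : nat -> R) (a b : R) :
  UltraFilter U -> (forall n, a <= u n <= b) -> exists l : R, u @ U --> l.
Proof.
move=> uU ub.
have := @segment_compact R a b; rewrite compact_ultra => /(_ (u @ U)).
case.
- apply: Build_UltraFilter => G pG sG; apply/seteqP; split; last exact: sG.
  move=> A GA; rewrite /= /nbhs/=.
  have [//|UC] := in_ultra_setVsetC (u @^-1` A) uU.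
  have : G (~` A) by apply: sG.
  by move=> GC; have [x []] := filter_ex (filterI GA GC).
- by rewrite /= /nbhs/=; apply: filterE => n /=; rewrite in_itv/= ub.
- by move=> l [_ ?]; exists l.
Qed.

Lemma Rintegral_lin_comb d (T : measurableType d) (mu : {measure set T -> \bar R})
  (D : set T) (mD : measurable D) (N : nat) (a : nat -> R) (f : nat -> T -> R) :
  (forall j, mu.-integrable D (EFin \o f j)) ->
  mu.-integrable D (EFin \o (fun t => \sum_(j < N) a j * f j t)) /\
  (\int[mu]_(t in D) \sum_(j < N) a j * f j t)%R = \sum_(j < N) a j * (\int[mu]_(t in D) f j t)%R.
Proof.
move=> fi; elim: N => [|N [iN IN]].
  have e0 : (fun t => \sum_(j < 0) a j * f j t) = cst 0 by apply/funext => t; rewrite big_ord0.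
  split; first by rewrite e0; exact: integrable0.
  by rewrite big_ord0 e0 Rintegral_cst// mul0r.
have eS : (fun t => \sum_(j < N.+1) a j * f j t) =
    (fun t => \sum_(j < N) a j * f j t) \+ (fun t => a N * f N t).
  by apply/funext => t; rewrite big_ord_recr.
have iz : mu.-integrable D (EFin \o (fun t => a N * f N t)).
  by apply: eq_integrable (integrableZl mD (a N) (fi N)).
split; first by rewrite eS; exact: (integrableD mD iN iz).
by rewrite eS RintegralD// IN big_ord_recr/= RintegralZl.
Qed.

Section Moments.
Variable c : nat -> R.
Hypothesis cm : completely_monotone c.
Hypothesis c1 : c 0%N = 1.

Definition bern_cdf n (x : R) : R := bern_mean c n (fun t => (t <= x)%R%:R).

Lemma bern_cdf_nd n : {homo bern_cdf n : x y / x <= y}.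
Proof.
move=> x y xy; apply: ler_sum => k _; apply: ler_wpM2l; first exact: bern_weight_ge0.
by have [h|h] := leP (k%:R / n%:R) x; rewrite ?(le_trans h xy).
Qed.

Lemma bern_cdf0 n x : x < 0 -> bern_cdf n x = 0.
Proof.
move=> x0; apply: big1 => k _; rewrite (_ : _ <= _ = false) ?mulr0//.
by apply/negbTE; rewrite -ltNge; apply: lt_le_trans x0 _; rewrite divr_ge0.
Qed.

Lemma bern_node01 n (k : 'I_n.+1) : 0 <= (k%:R / n%:R : R) <= 1.
Proof.
rewrite divr_ge0//=; case: n k => [k|n k]; first by rewrite invr0 mulr0 ler01.
by rewrite ler_pdivrMr ?ltr0n// mul1r ler_nat -ltnS.
Qed.

Lemma bern_cdf1 n x : 1 <= x -> bern_cdf n x = 1.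
Proof.
move=> x1; rewrite -c1 -(bern_weight_sum c n); apply: eq_bigr => k _.
by have /andP[_ k1] := bern_node01 k; rewrite (le_trans k1 x1) mulr1.
Qed.

Lemma bern_cdf01 n x : 0 <= bern_cdf n x <= 1.
Proof.
apply/andP; split; last first.
  have [x1|x1] := leP x 1; last by rewrite bern_cdf1// ltW.
  by rewrite -(bern_cdf1 n (lexx 1)) bern_cdf_nd.
by apply: sumr_ge0 => k _; rewrite mulr_ge0// bern_weight_ge0.
Qed.

Lemma bern_cdf_riemann p N n : (0 < N)%N ->
  `|1 - bern_mean c n (fun t => t ^+ p) -
    \sum_(j < N) pow_step p N j * bern_cdf n (j%:R / N%:R)| <= p%:R / N%:R.
Proof.
move=> N0.
have -> : 1 - bern_mean c n (fun t => t ^+ p) -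
    \sum_(j < N) pow_step p N j * bern_cdf n (j%:R / N%:R) =
  \sum_(k < n.+1) bern_weight c n k *
    (1 - (k%:R / n%:R) ^+ p - pow_sum p N (k%:R / n%:R)).
  under [RHS]eq_bigr do rewrite mulrBr mulrBr mulr1.
  rewrite !sumrB bern_weight_sum c1; congr (_ - _).
  rewrite /bern_cdf /bern_mean; under eq_bigr do rewrite mulr_sumr.
  rewrite exchange_big/=; apply: eq_bigr => k _.
  by rewrite /pow_sum mulr_sumr; apply: eq_bigr => j _; rewrite mulrCA.
apply: le_trans (ler_norm_sum _ _ _) _.
rewrite (_ : p%:R / N%:R = \sum_(k < n.+1) bern_weight c n k * (p%:R / N%:R)); last first.
  by rewrite -mulr_suml bern_weight_sum c1 mul1r.
apply: ler_sum => k _.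
rewrite normrM ger0_norm ?bern_weight_ge0//; apply: ler_wpM2l; first exact: bern_weight_ge0.
exact: (pow_sum_approx p N0 (bern_node01 k)).
Qed.

(** Helly's selection: along an ultrafilter the bounded values converge at every
    point simultaneously, so no subsequence has to be extracted. The last clause
    survives because it involves finitely many points. *)
Lemma bern_cdf_limit : exists F : R -> R,
  [/\ {homo F : x y / x <= y}, (forall x, x < 0 -> F x = 0),
      (forall x, 1 <= x -> F x = 1) &
      forall p N, (0 < N)%N ->
        `|1 - c p - \sum_(j < N) pow_step p N j * F (j%:R / N%:R)| <= p%:R / N%:R].
Proof.
have [U [uU sU]] := @ultraFilterLemma nat \oo _.
have /choice[F FE] x : exists l : R, bern_cdf n x @[n --> U] --> l.
  by apply: (bounded_ultra_cvg uU) => n; exact: bern_cdf01.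
have pU : ProperFilter U := @ultra_proper _ _ uU.
exists F; split.
- move=> x y xy; apply: (ler_cvg_to (FE x) (FE y)).
  by apply: nearW => n; exact: bern_cdf_nd.
- move=> x x0; apply: (cvg_unique _ (FE x)) => //.
  by apply: cvg_near_cst; apply: nearW => n; exact: bern_cdf0.
- move=> x x0; apply: (cvg_unique _ (FE x)) => //.
  by apply: cvg_near_cst; apply: nearW => n; exact: bern_cdf1.
move=> p N N0.
have h1 : bern_mean c n (fun t => t ^+ p) @[n --> U] --> c p.
  by move=> A /(bern_mean_cvg cm); exact: sU.
have h2 : \sum_(j < N) pow_step p N j * bern_cdf n (j%:R / N%:R) @[n --> U] -->
          \sum_(j < N) pow_step p N j * F (j%:R / N%:R).
  by apply: cvg_big => [|j _]; [exact: add_continuous|]; apply: cvgM; [exact: cvg_cst|exact: FE].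
have h3 : (fun n => `|1 - bern_mean c n (fun t => t ^+ p) -
    \sum_(j < N) pow_step p N j * bern_cdf n (j%:R / N%:R)|) @ U -->
    `|1 - c p - \sum_(j < N) pow_step p N j * F (j%:R / N%:R)|.
  apply: (@cvg_norm _ R^o); apply: cvgB => //; apply: cvgB => //; exact: cvg_cst.
apply: (ler_cvg_to h3 (@cvg_cst _ _ _ _ _)).
by apply: nearW => n; exact: bern_cdf_riemann.
Qed.

Lemma riemann_integral_pow (P : probability (measurableTypeR R) R) (G : R -> R) p N :
  (0 < N)%N -> P (~` `[0, 1]%classic) = 0%E ->
  (forall x, 0 <= x -> P `[0, x]%classic = (G x)%:E) ->
  `|1 - (\int[P]_(t in `[0, 1]%classic) t ^+ p)%R -
    \sum_(j < N) pow_step p N j * G (j%:R / N%:R)| <= p%:R / N%:R.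
Proof.
move=> N0 P01 PG; pose D : set (measurableTypeR R) := `[0, 1]%classic.
have P01D : P (~` D) = 0%E := P01.
have mI (i : interval R) : measurable ([set` i] : set (measurableTypeR R)).
  exact: measurable_itv.
have PD : P D = 1%E.
  have h : P setT = (P D + P (~` D))%E.
    by rewrite -(setUv D); apply: measureU (setICr D); [|apply: measurableC]; exact: mI.
  by rewrite -(@probability_setT _ _ _ P) h P01D adde0.
have PDoo : (P D < +oo)%E by rewrite PD ltry.
have bnd_int (f : R -> R) : measurable_fun D f -> (forall t, D t -> `|f t| <= 1) ->
    P.-integrable D (EFin \o f).
  move=> mf fb; apply: measurable_bounded_integrable => //; first exact: mI.
  by exists 1; split => // M M1 t /fb /le_trans; apply; exact: ltW.
have D01 t : D t -> 0 <= t <= 1 by rewrite /D/= in_itv.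
have i1 : P.-integrable D (EFin \o (fun=> 1 : R)).
  by apply: bnd_int => [|t _]; [exact: measurable_cst|rewrite normr1].
have ipow : P.-integrable D (EFin \o (fun t : R => t ^+ p)).
  apply: bnd_int => [|t /D01/andP[t0 t1]]; first exact: measurable_funX.
  by rewrite normrX exprn_ile1// ger0_norm.
have stepE (x : R) : (fun t : R => (t <= x)%R%:R : R) = \1_(`]-oo, x]%classic).
  by apply/funext => t; rewrite indicE mem_setE in_itv.
have istep (x : R) : P.-integrable D (EFin \o (fun t : R => (t <= x)%R%:R)).
  apply: bnd_int => [|t _]; last by case: (t <= x); rewrite ?normr1 ?normr0.
  by rewrite stepE; apply: measurable_indic; exact: mI.
have Istep x : 0 <= x <= 1 -> (\int[P]_(t in D) (t <= x)%R%:R)%R = G x.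
  move=> /andP[x0 x1].
  transitivity (\int[P]_(t in D) (\1_(`]-oo, x]%classic) t : R))%R; first by rewrite -stepE.
  rewrite /Rintegral integral_indic; try exact: mI.
  have -> : `]-oo, x]%classic `&` D = `[0, x]%classic.
    apply/seteqP; split => t; rewrite /D/= !in_itv/=.
      by move=> [tx /andP[-> _]].
    by move=> /andP[-> tx]; rewrite tx (le_trans tx).
  exact: (congr1 fine (PG x x0)).
have mD : measurable D by exact: mI.
have i12 : P.-integrable D (EFin \o (fun t : R => 1 - t ^+ p)) := integrableB mD i1 ipow.
have [isum Isum] := Rintegral_lin_comb mD N (fun j => pow_step p N j) (fun j : nat => istep (j%:R / N%:R)).
have -> : 1 - (\int[P]_(t in D) t ^+ p)%R - \sum_(j < N) pow_step p N j * G (j%:R / N%:R) =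
    (\int[P]_(t in D) (1 - t ^+ p - pow_sum p N t))%R.
  have e1 := RintegralB mD i1 ipow; have e2 := RintegralB mD i12 isum.
  apply/esym; apply: eq_trans e2 _; congr (_ - _).
    by apply: eq_trans e1 _; rewrite Rintegral_cst// [X in fine X]PD mulr1.
  apply: eq_trans Isum _; apply: eq_bigr => j _; rewrite Istep// divr_ge0//=.
  by rewrite ler_pdivrMr ?ltr0n// mul1r ler_nat ltnW.
have iall : P.-integrable D (EFin \o (fun t : R => 1 - t ^+ p - pow_sum p N t)) :=
  integrableB mD i12 isum.
apply: le_trans (le_normr_Rintegral mD iall) _.
have icst : P.-integrable D (EFin \o (fun=> p%:R / N%:R : R)).
  exact: finite_measure_integrable_cst.
have -> : p%:R / N%:R = (\int[P]_(t in D) (fun=> p%:R / N%:R : R) t)%R.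
  by rewrite Rintegral_cst// [X in fine X]PD mulr1.
apply: le_Rintegral => //; first exact: integrable_norm.
by move=> t /D01 t01; exact: pow_sum_approx.
Qed.

(** On a grid of step [1 / N] both the limit function [F] and its right limit
    [G], which is the distribution function of the measure, integrate
    [1 - t ^ p] up to [p / N], the former to [1 - c p] and the latter to one
    minus the moment. Their values interlace, [F x_j <= G x_j <= F x_(j+1)],
    so the two sums differ by a telescoping quantity of the same order. *)
Theorem hausdorff_moment : exists P : probability (measurableTypeR R) R,
  P (~` `[0, 1]%classic) = 0%E /\
  forall p, (\int[P]_(t in `[0, 1]%classic) t ^+ p)%R = c p.
Proof.
have [F [ndF F0 F1 FR]] := bern_cdf_limit.
have [P [P01 PE]] := stieltjes_right_lim ndF F0 F1.
exists P; split => // p; set I := Rintegral _ _ _.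
suff h N : (0 < N)%N -> `|I - c p| <= (3 * p%:R) / N%:R.
  apply/eqP; rewrite -subr_eq0 -normr_eq0 eq_le normr_ge0 andbT.
  apply/ler_addgt0Pl => e e0; rewrite addr0.
  have := h (Num.trunc (3 * p%:R / e)).+1 isT.
  have := truncnS_gt (3 * p%:R / e); rewrite ltr_pdivrMr// => hN.
  move=> /le_trans; apply; rewrite ler_pdivrMr ?ltr0n//.
  by apply: le_trans (ltW hN) _; rewrite mulrC.
move=> N0.
have h1 := FR p N N0.
have h2 := riemann_integral_pow p N0 P01 PE; rewrite -/I in h2.
set SF := \sum_(_ < _) _ in h1; set SG := \sum_(_ < _) _ in h2.
have h3 : `|SG - SF| <= p%:R / N%:R.
  rewrite /SG /SF -sumrB; under eq_bigr do rewrite -mulrBr.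
  have Np : 0 < N%:R :> R by rewrite ltr0n.
  have d0 (j : nat) : 0 <= right_lim F (j%:R / N%:R) - F (j%:R / N%:R).
    by rewrite subr_ge0 right_lim_ge.
  rewrite ger0_norm; last by apply: sumr_ge0 => j _; rewrite mulr_ge0// pow_step_ge0.
  apply: (@le_trans _ _ (\sum_(j < N) p%:R / N%:R * (F (j.+1%:R / N%:R) - F (j%:R / N%:R)))).
    apply: ler_sum => j _; apply: ler_pM => //; first exact: pow_step_ge0.
      exact: pow_step_le.
    rewrite lerB// right_lim_le// ltr_pM2r ?invr_gt0// ltr_nat//.
  rewrite -mulr_sumr -(big_mkord xpredT (fun j => F (j.+1%:R / N%:R) - F (j%:R / N%:R))).
  rewrite (telescope_sumr (fun j => F (j%:R / N%:R)))// divff ?gt_eqF// F1//.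
  by rewrite ler_piMr ?divr_ge0// gerBl (monotone_ge0 ndF F0).
have -> : I - c p = (1 - c p - SF) - (1 - I - SG) - (SG - SF) by ring.
apply: le_trans (ler_normB _ _) _; have := ler_normB (1 - c p - SF) (1 - I - SG).
rewrite -mulrA; lra.
Qed.

End Moments.
End HausdorffMoment.

(** * Moments attached to the kernel measure *)

Section KernelMoments.
Context {R : realType}.

Lemma bounded_integrable d (T : measurableType d) (mu : {finite_measure set T -> \bar R})
    (D : set T) (f : T -> R) (K : R) :
  measurable D -> measurable_fun D f -> (forall t, D t -> `|f t| <= K) ->
  mu.-integrable D (EFin \o f).
Proof.
move=> mD mf fb; apply: measurable_bounded_integrable => //.
  by rewrite ltey_eq fin_num_measure.
by exists K; split; rewrite ?num_real// => M M1 t /fb /le_trans; apply; exact: ltW.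
Qed.

(** A drop of the sequence multiplies the weight [g] by [1 - s], which
    preserves its bounds. *)
Lemma cm_power_moments d (T : measurableType d) (mu : {finite_measure set T -> \bar R})
    (D : set T) (s g : T -> R) :
  measurable D -> measurable_fun D s -> measurable_fun D g ->
  (forall t, D t -> 0 <= s t <= 1) -> (forall t, D t -> 0 <= g t <= 1) ->
  completely_monotone (fun k => (\int[mu]_(t in D) (s t ^+ k * g t))%R).
Proof.
move=> mD ms mg s01 g01 n.
elim: n g mg g01 => [|n IH] g mg g01.
  split => // k; apply: Rintegral_ge0 => t Dt.
  by have /andP[? _] := s01 t Dt; have /andP[? _] := g01 t Dt; rewrite mulr_ge0 ?exprn_ge0.
split => [k|].
  apply: Rintegral_ge0 => t Dt.
  by have /andP[? _] := s01 t Dt; have /andP[? _] := g01 t Dt; rewrite mulr_ge0 ?exprn_ge0.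
have h01 t : D t -> 0 <= (1 - s t) * g t <= 1.
  move=> Dt; have /andP[? ?] := s01 t Dt; have /andP[? ?] := g01 t Dt.
  by rewrite mulr_ge0 ?subr_ge0//= mulr_ile1 ?subr_ge0// gerBl.
have mh : measurable_fun D (fun t => (1 - s t) * g t).
  by apply: measurable_funM => //; apply: measurable_funB => //; exact: measurable_cst.
apply: cm_upto_eq (IH _ mh h01) => k; rewrite /drop1 -RintegralB//.
- by congr Rintegral; apply/funext => t; rewrite exprS; ring.
- apply: (@bounded_integrable _ _ _ _ _ 1) => // [|t Dt].
    by apply: measurable_funM => //; exact: measurable_funX.
  have /andP[? ?] := s01 t Dt; have /andP[? ?] := g01 t Dt.
  by rewrite ger0_norm ?mulr_ge0 ?exprn_ge0// mulr_ile1 ?exprn_ge0// exprn_ile1.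
- apply: (@bounded_integrable _ _ _ _ _ 1) => // [|t Dt].
    by apply: measurable_funM => //; exact: measurable_funX.
  have /andP[? ?] := s01 t Dt; have /andP[? ?] := g01 t Dt.
  by rewrite ger0_norm ?mulr_ge0 ?exprn_ge0// mulr_ile1 ?exprn_ge0// exprn_ile1.
Qed.

Section Nu.
Variable nu : {finite_measure set (measurableTypeR R) -> \bar R}.
Hypothesis nu_div : (\int[nu]_(r in `[0%R, 1%R]%classic) ((1 - r)%:E^-1) = +oo)%E.

Let D : set (measurableTypeR R) := `[0, 1]%classic.
Let mD : measurable D. Proof. exact: measurable_itv. Qed.
Let D01 t : D t -> 0 <= t <= 1. Proof. by rewrite /D/= in_itv. Qed.

(** In the variable [s = sqrt r] these are the moments of [d nu / (1 + s)].
    The weight makes the terms of index [2 k] and [2 k + 1] add up to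
    [r ^ k]. *)
Definition half_moment j : R :=
  (\int[nu]_(r in D) (Num.sqrt r ^+ j * (1 + Num.sqrt r)^-1))%R.

Definition kernel_coef n : R := \sum_(k < n.+1) (\int[nu]_(r in D) r ^+ k)%R.

Let sqrt01 t : D t -> 0 <= Num.sqrt t <= 1.
Proof.
by move=> /D01/andP[t0 t1]; rewrite sqrtr_ge0/= -(@sqrtr1 R) ler_wsqrtr.
Qed.

Let msqrt : measurable_fun D (fun t : R => Num.sqrt t).
Proof.
by apply: measurable_funTS; apply: continuous_measurable_fun; exact: sqrt_continuous.
Qed.

Let minv : measurable_fun D (fun t : R => (1 + Num.sqrt t)^-1).
Proof.
apply: measurable_funTS; apply: continuous_measurable_fun => x.
apply: cvgV; first by rewrite gt_eqF// ltr_wpDr// sqrtr_ge0.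
by apply: cvgD; [exact: cvg_cst|exact: sqrt_continuous].
Qed.

Let inv01 t : D t -> 0 <= (1 + Num.sqrt t)^-1 <= 1.
Proof.
move=> _; have h := sqrtr_ge0 t.
by rewrite invr_ge0 addr_ge0//= invf_le1 ?ltr_wpDr// lerDl.
Qed.

Lemma cm_half_moment : completely_monotone half_moment.
Proof. exact: cm_power_moments. Qed.

Let ihalf j : nu.-integrable D (EFin \o (fun r : R => Num.sqrt r ^+ j * (1 + Num.sqrt r)^-1)).
Proof.
apply: (@bounded_integrable _ _ _ _ _ 1) => // [|t Dt].
  by apply: measurable_funM => //; exact: measurable_funX.
have /andP[? ?] := sqrt01 Dt; have /andP[? ?] := inv01 Dt.
by rewrite ger0_norm ?mulr_ge0 ?exprn_ge0// mulr_ile1 ?exprn_ge0// exprn_ile1.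
Qed.

Lemma half_moment_sum n : \sum_(j < (2 * n.+1)%N) half_moment j = kernel_coef n.
Proof.
rewrite /kernel_coef; elim: n => [|n IH].
  rewrite big_ord_recr/= big_ord1 big_ord1 -RintegralD//; congr Rintegral.
  apply/funext => t; rewrite expr0 mul1r expr1.
  by field; rewrite gt_eqF// ltr_wpDr// sqrtr_ge0.
rewrite [RHS]big_ord_recr/= -IH mulnS add2n big_ord_recr big_ord_recr/= -addrA; congr (_ + _).
rewrite -RintegralD//.
apply: eq_Rintegral => t; rewrite inE => /D01/andP[t0 _].
rewrite -[X in _ = X ^+ _](sqr_sqrtr t0) -exprM mul2n -mul2n exprS.
by field; rewrite gt_eqF// ltr_wpDr// sqrtr_ge0.
Qed.

Let ipow k : nu.-integrable D (EFin \o (fun r : R => r ^+ k)).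
Proof.
apply: (@bounded_integrable _ _ _ _ _ 1) => // t /D01/andP[? ?].
by rewrite ger0_norm ?exprn_ge0// exprn_ile1.
Qed.

Lemma pow_moment_ge0 k : 0 <= (\int[nu]_(r in D) r ^+ k)%R.
Proof. by apply: Rintegral_ge0 => t /D01/andP[? _]; rewrite exprn_ge0. Qed.

(** Monotone convergence: the partial geometric sums increase to
    [1 / (1 - r)]. *)
Lemma kernel_coef_unbounded K : exists n, K < kernel_coef n.
Proof.
apply: contrapT => /forallNP h.
have hK n : kernel_coef n <= K by rewrite leNgt; apply/negP; exact: h.
pose g n (r : measurableTypeR R) : \bar R := (\sum_(k < n.+1) r ^+ k)%:E.
have Ig n : (\int[nu]_(r in D) g n r)%E = (kernel_coef n)%:E.
  have [i1 i2] := Rintegral_lin_comb mD n.+1 (fun=> 1) ipow.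
  have e : kernel_coef n = (\int[nu]_(r in D) \sum_(k < n.+1) r ^+ k)%R.
    rewrite (_ : (fun r => _) = (fun t : R => \sum_(j < n.+1) 1 * t ^+ j)); last first.
      by apply/funext => t; apply: eq_bigr => k _; rewrite mul1r.
    by rewrite i2; apply: eq_bigr => k _; rewrite mul1r.
  rewrite e /Rintegral fineK//; apply: integrable_fin_num => //.
  move: i1; rewrite (_ : (fun r => _) = (fun t : R => \sum_(j < n.+1) t ^+ j))//.
  by apply/funext => t; apply: eq_bigr => k _; rewrite mul1r.
have g0 n r : D r -> (0 <= g n r)%E.
  by move=> /D01/andP[r0 _]; rewrite lee_fin; apply: sumr_ge0 => k _; rewrite exprn_ge0.
have mg n : measurable_fun D (g n).
  by apply/measurable_EFinP; apply: measurable_sum => k; exact: measurable_funX.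
have ndg r : D r -> {homo (g^~ r) : n m / (n <= m)%N >-> (n <= m)%E}.
  move=> /D01/andP[r0 _] n m nm; rewrite lee_fin.
  rewrite -(big_mkord xpredT (fun k => r ^+ k)) -(big_mkord xpredT (fun k => r ^+ k)).
  rewrite [leRHS](@big_cat_nat _ _ _ n.+1 0 m.+1 xpredT)//=.
  by rewrite lerDl sumr_ge0// => k _; exact: exprn_ge0.
have := cvg_monotone_convergence (mu := nu) mD mg g0 ndg.
have -> : (\int[nu]_(x in D) limn (g^~ x) = +oo)%E.
  rewrite -nu_div; apply: eq_integral => r; rewrite inE => /D01/andP[r0 r1].
  apply/cvg_lim => //; rewrite inver subr_eq0 eq_sym; case: eqP => [->|/eqP r1'].
    rewrite (_ : g^~ _ = fun n => n.+1%:R%:E); last first.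
      by apply/funext => n; rewrite /g; under eq_bigr do rewrite expr1n; rewrite sumr_const card_ord.
    apply/cvgeryP; apply/cvgryPge => A; near=> n.
    apply: (@le_trans _ _ n%:R); last by rewrite ler_nat.
    by near: n; exact: nbhs_infty_ger.
  apply/cvg_EFin; first by near=> n.
  have rr : `|r| < 1 by rewrite ger0_norm// lt_neqAle r1' r1.
  have := @cvg_geometric_series _ 1 _ rr; rewrite mul1r => hc.
  rewrite (_ : _ \o _ = fun n => series (geometric 1 r) (n + 1)%N); first by rewrite cvg_shiftn.
  apply/funext => n; rewrite addn1 /series/= big_mkord; apply: eq_bigr => k _.
  by rewrite mul1r.
move=> /cvgeyPgt/(_ K)[N _ /(_ N (leqnn N))]/=.
by rewrite Ig lte_fin ltNge hK.
Unshelve. all: by end_near. Qed.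

Lemma half_moment0_gt0 : 0 < half_moment 0.
Proof.
have a0 j := cm_upto_ge0 j (cm_half_moment 0%N).
rewrite lt_neqAle a0 andbT; apply/eqP => e0.
have aj j : half_moment j = 0.
  elim: j => [//|j IH]; apply/eqP; rewrite eq_le a0 andbT -IH.
  have [_ [h _]] := cm_half_moment 1%N.
  by have := h j; rewrite subr_ge0.
have [n] := kernel_coef_unbounded 0.
by rewrite -half_moment_sum big1 ?ltxx.
Qed.

(** The moments required of [omega], up to the factor [2 * pi]; only the odd
    ones are imposed by the kernel. *)
Definition radial_moment k : R := (\sum_(j < k.+1) half_moment j)^-1.

Lemma cm_radial_moment : completely_monotone radial_moment.
Proof. exact: cm_inv_partial_sums cm_half_moment half_moment0_gt0. Qed.

Lemma half_moment_sum_gt0 k : 0 < \sum_(j < k.+1) half_moment j.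
Proof.
rewrite big_ord_recl ltr_pwDl ?half_moment0_gt0// sumr_ge0// => i _.
exact: (cm_upto_ge0 _ (cm_half_moment 0%N)).
Qed.

Lemma radial_moment_gt0 k : 0 < radial_moment k.
Proof. by rewrite invr_gt0 half_moment_sum_gt0. Qed.

Lemma radial_moment_odd n : radial_moment (2 * n).+1 = (kernel_coef n)^-1.
Proof. by rewrite /radial_moment -half_moment_sum mulnS. Qed.

Lemma radial_moment_to0 e : 0 < e -> exists k, radial_moment k < e.
Proof.
move=> e0; have [n hn] := kernel_coef_unbounded e^-1.
have ei : 0 < e^-1 by rewrite invr_gt0.
by exists (2 * n).+1; rewrite radial_moment_odd invf_plt ?posrE ?(lt_trans ei hn).
Qed.

Lemma half_moment_nonincr i j : (i <= j)%N -> half_moment j <= half_moment i.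
Proof.
elim: j => [|j IH]; first by rewrite leqn0 => /eqP ->.
rewrite leq_eqVlt => /predU1P[->//|/IH]; apply: le_trans.
have [_ [h _]] := cm_half_moment 1%N.
by have := h j; rewrite subr_ge0.
Qed.

(** Partial sums of a nonincreasing sequence are subadditive. *)
Lemma half_moment_sumM m k :
  \sum_(j < (m * k)%N) half_moment j <= m%:R * \sum_(j < k) half_moment j.
Proof.
elim: m => [|m IH]; first by rewrite mul0n big_ord0 mul0r.
rewrite mulSn big_split_ord/= -natr1 mulrDl mul1r addrC; apply: lerD => //.
apply: le_trans IH; apply: ler_sum => j _; apply: half_moment_nonincr.
exact: leq_addl.
Qed.

End Nu.
End KernelMoments.

(** * Doubling of the tails from the moments *)

Section Doubling.
Context {R : realType}.

Lemma bernoulli_le (x : R) n : 0 <= x <= 1 -> 1 - n%:R * x <= (1 - x) ^+ n.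
Proof.
move=> /andP[x0 x1]; elim: n => [|n IH]; first by rewrite mul0r subr0 expr0.
rewrite exprS -natr1; apply: le_trans (_ : (1 - x) * (1 - n%:R * x) <= _).
  have : 0 <= n%:R * x * x by rewrite !mulr_ge0.
  by move=> h; lra.
by rewrite ler_wpM2l ?subr_ge0.
Qed.

(** Equivalent to the bound of [(1 - y) ^ n] by [1 / (1 + n y)]. *)
Lemma expr_le_inv (y : R) n : 0 <= y <= 1 -> (1 - y) ^+ n * (1 + n%:R * y) <= 1.
Proof.
move=> /andP[y0 y1]; elim: n => [|n IH]; first by rewrite expr0 mul0r addr0 mulr1.
have h : (1 - y) * (1 + n.+1%:R * y) <= 1 + n%:R * y.
  have : 0 <= n%:R * y * y by rewrite !mulr_ge0.
  by move=> h; rewrite -natr1; nra.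
apply: le_trans IH; rewrite exprSr -mulrA ler_wpM2l// exprn_ge0// subr_ge0//.
Qed.

Variable omega : {finite_measure set (measurableTypeR R) -> \bar R}.
Let D : set (measurableTypeR R) := `[0, 1[%classic.
Let mD : measurable D. Proof. exact: measurable_itv. Qed.
Let M k : R := (\int[omega]_(t in D) t ^+ k)%R.
Let W (r : R) : R := (\int[omega]_(t in D) (r <= t)%R%:R)%R.

Let D01 t : D t -> 0 <= t < 1. Proof. by rewrite /D/= in_itv. Qed.

Let ipow k : omega.-integrable D (EFin \o (fun r : R => r ^+ k)).
Proof.
apply: (@bounded_integrable _ _ _ _ _ _ 1) => // t /D01/andP[? ?].
by rewrite ger0_norm ?exprn_ge0// exprn_ile1// ltW.
Qed.

Let stepE (x : R) : (fun t : R => (x <= t)%R%:R : R) = \1_(`[x, +oo[%classic).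
Proof. by apply/funext => t; rewrite indicE mem_setE in_itv/= andbT. Qed.

Let istep (x : R) : omega.-integrable D (EFin \o (fun t : R => (x <= t)%R%:R)).
Proof.
apply: (@bounded_integrable _ _ _ _ _ _ 1) => // [|t _]; last first.
  by case: (x <= t); rewrite ?normr1 ?normr0.
by rewrite stepE; apply: measurable_indic; exact: measurable_itv.
Qed.

Lemma omega_hatE r : 0 <= r -> omega_hat omega r = (W r)%:E.
Proof.
move=> r0.
have e : `[r, +oo[%classic `&` D = `[r, 1[%classic.
  apply/seteqP; split => t; rewrite /D/= !in_itv/=.
    by move=> [/andP[-> _] /andP[_ ->]].
  by move=> /andP[rt ->]; rewrite rt (le_trans r0).
have -> : W r = (\int[omega]_(t in D) (\1_(`[r, +oo[%classic) t : R))%R by rewrite -stepE.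
rewrite /Rintegral integral_indic; try exact: measurable_itv.
by rewrite fineK ?e// fin_num_measure//; exact: measurable_itv.
Qed.

Lemma tail_upper r k : 0 <= r -> r ^+ k * W r <= M k.
Proof.
move=> r0; rewrite /W -RintegralZl//; apply: le_Rintegral => //.
  exact: (integrableZl mD (r ^+ k) (istep r)).
move=> t /D01/andP[t0 t1]; have [rt|rt] := leP r t; rewrite ?mulr1 ?mulr0 ?exprn_ge0//.
by rewrite lerXn2r.
Qed.

(** Split at [s]: beyond it the integrand is at most [1], below it the first
    [l] factors are at most [s]. *)
Lemma tail_lower s k l : 0 <= s -> M (l + k) <= W s + s ^+ l * M k.
Proof.
move=> s0; rewrite /W /M -RintegralZl// -RintegralD//; last first.
  exact: (integrableZl mD (s ^+ l) (ipow k)).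
apply: le_Rintegral => //.
  exact: (integrableD mD (istep s) (integrableZl mD (s ^+ l) (ipow k))).
move=> t /D01/andP[t0 t1]; have [st|st] := leP s t.
  by apply: ler_wpDr; rewrite ?mulr_ge0 ?exprn_ge0// exprn_ile1// ltW.
by rewrite add0r exprD ler_wpM2r ?exprn_ge0// lerXn2r// ?nnegrE ltW.
Qed.

Lemma tail_nonincr r s : r <= s -> W s <= W r.
Proof.
move=> rs; apply: le_Rintegral => // t _.
by have [st|st] := leP s t; rewrite ?(le_trans rs st).
Qed.

Hypothesis Mgt0 : forall k, 0 < M k.
Hypothesis Mdbl : forall k, M k <= 65 * M (64 * k + k).

(** Work at the scale [k ~ 1 / (2 (1 - r))]. There [r ^ k] is at least [1/2]
    by Bernoulli's inequality, so the tail beyond [r] is at most [2 M k].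
    Raising the exponent to [65 k] costs at most the factor [65] in the moment,
    but it multiplies the share of the points below [(1 + r) / 2] by at most
    [((1 + r) / 2) ^ (64 k) <= 2 ^ (- 8)]; as [1/256 < 1/65], a fixed proportion
    of [M k] has to come from the points beyond [(1 + r) / 2]. *)
Lemma tail_scale r : 1 / 2 <= r < 1 ->
  exists k, W r <= 2 * M k /\ M k <= 130 * W ((1 + r) / 2).
Proof.
move=> /andP[r2 r1]; pose x := 1 - r.
have x0 : 0 < x by rewrite /x; lra.
have x2 : x <= 1 / 2 by rewrite /x; lra.
pose k := Num.trunc ((2 * x)^-1).
have /andP[k1 k2] : k%:R <= (2 * x)^-1 < k.+1%:R by apply: truncn_itv; rewrite invr_ge0; lra.
have kx : k%:R * (2 * x) <= 1 by rewrite -ler_pdivlMr ?mul1r//; lra.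
have kx1 : 1 < (k%:R + 1) * (2 * x).
  by rewrite natr1 -ltr_pdivrMr ?mul1r// ?div1r//; lra.
have kpos : 1 <= k%:R :> R.
  by rewrite ler1n lt0n; apply/eqP => k0; move: kx1; rewrite k0; lra.
have kx4 : 1 / 4 <= k%:R * x by nra.
exists k; split.
  have h : 1 / 2 <= r ^+ k.
    have -> : r = 1 - x by rewrite /x; lra.
    by apply: le_trans (bernoulli_le k _); [lra|apply/andP; lra].
  have W0 : 0 <= W r by apply: Rintegral_ge0 => t _; case: (r <= t).
  have r0 : 0 <= r by lra.
  have := tail_upper k r0; nra.
set s := (1 + r) / 2.
have s0 : 0 <= s by rewrite /s; lra.
have hs := tail_lower k (64 * k) s0.
have h8 : s ^+ (8 * k) <= 1 / 2.
  have sE : s = 1 - x / 2 by rewrite /s /x; lra.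
  have x01 : 0 <= x / 2 <= 1 by apply/andP; lra.
  have := expr_le_inv (8 * k) x01; rewrite -sE natrM.
  have := exprn_ge0 (8 * k) s0; nra.
have h64 : s ^+ (64 * k) <= 1 / 256.
  have -> : (64 * k = (8 * k) * 8)%N by rewrite mulnAC.
  rewrite exprM; apply: le_trans (_ : (1 / 2) ^+ 8 <= _).
    by apply: lerXn2r => //; rewrite nnegrE ?exprn_ge0//; lra.
  by rewrite !exprS expr0; lra.
have := ler_wpM2r (ltW (Mgt0 k)) h64; have hM := Mdbl k; have M0 := Mgt0 k; lra.
Qed.

(** The scale argument needs [r >= 1 / 2]; for smaller [r] the tail is at most
    the total mass, and the tail beyond [(1 + r) / 2] is at least the one
    beyond [3 / 4], which is positive. *)
Lemma Dhat_of_moments : omega (~` `[0, 1[%classic) = 0%E -> Dhat omega.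
Proof.
move=> om0.
have W34 : 0 < W (3 / 4).
  have [k [_ hk]] := @tail_scale (1 / 2) ltac:(apply/andP; lra).
  have -> : 3 / 4 = (1 + 1 / 2) / 2 :> R by lra.
  have := Mgt0 k; nra.
split => //.
  apply/eqP => omT; suff : M 0 = 0 by apply/eqP; rewrite gt_eqF.
  have omD : omega D = 0%E.
    by apply/eqP; rewrite eq_le measure_ge0 andbT -omT le_measure// inE.
  transitivity (\int[omega]_(t in D) (fun=> 1) t)%R.
    by congr Rintegral; apply/funext => t; rewrite expr0.
  by rewrite Rintegral_cst// [X in fine X]omD mulr0.
exists (260 + W 0 / W (3 / 4)); split.
  have W0 : 0 <= W 0 by apply: Rintegral_ge0 => t _; case: (0 <= t).
  have := divr_ge0 W0 (ltW W34); lra.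
move=> r /andP[r0 r1]; rewrite !omega_hatE ?divr_ge0 ?addr_ge0// -EFinM lee_fin.
have W0 : 0 <= W 0 by apply: Rintegral_ge0 => t _; case: (0 <= t).
have Wq0 : 0 <= W 0 / W (3 / 4) by rewrite divr_ge0// ltW.
have Ws0 : 0 <= W ((1 + r) / 2) by apply: Rintegral_ge0 => t _; case: ((1 + r) / 2 <= t).
have [r2|r2] := leP (1 / 2) r.
  have [k [h1 h2]] := @tail_scale r ltac:(apply/andP; lra).
  nra.
have h1 : W r <= W 0 by exact: tail_nonincr.
have h2 : W (3 / 4) <= W ((1 + r) / 2) by apply: tail_nonincr; lra.
apply: le_trans h1 _; apply: le_trans (_ : W 0 / W (3 / 4) * W (3 / 4) <= _).
  by rewrite divfK// gt_eqF.
nra.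
Qed.

End Doubling.

(** * The radial measure *)

Section RadialMeasure.
Context {R : realType}.

Lemma Rintegral_mscale d (T : measurableType d) (mu : {finite_measure set T -> \bar R})
    (a : {nonneg R}) (D : set T) (f : T -> R) : measurable D -> measurable_fun D f ->
  (forall t, D t -> 0 <= f t) ->
  (\int[mscale a mu]_(t in D) f t)%R = a%:num * (\int[mu]_(t in D) f t)%R.
Proof.
move=> mD mf f0; rewrite /Rintegral ge0_integral_mscale//; last first.
  exact/measurable_EFinP.
have i0 : (0 <= \int[mu]_(x in D) (f x)%:E)%E by apply: integral_ge0 => x /f0; rewrite lee_fin.
case: (\int[mu]_(x in D) (f x)%:E)%E i0 => [r _||//]; first by rewrite -EFinM.
have [->|a0] := eqVneq (a%:num) 0; first by rewrite mul0e/= mul0r.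
by move=> _; rewrite gt0_muley ?lte_fin ?lt_neqAle 1?eq_sym ?a0/= ?mulr0.
Qed.

Variable nu : {finite_measure set (measurableTypeR R) -> \bar R}.
Hypothesis nu_div : (\int[nu]_(r in `[0%R, 1%R]%classic) ((1 - r)%:E^-1) = +oo)%E.

(** Every moment is at least the mass of the point [1]. *)
Lemma no_atom_at1 (P : probability (measurableTypeR R) R) :
  (forall e, 0 < e -> exists k, (\int[P]_(t in `[0, 1]%classic) t ^+ k)%R < e) ->
  P [set 1] = 0%E /\
  forall k, (\int[P]_(t in `[0, 1[%classic) t ^+ k)%R = (\int[P]_(t in `[0, 1]%classic) t ^+ k)%R.
Proof.
move=> hP; set D : set (measurableTypeR R) := `[0, 1]%classic.
pose D' : set (measurableTypeR R) := `[0, 1[%classic.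
have mD : measurable D by exact: measurable_itv.
have mD' : measurable D' by exact: measurable_itv.
have m1 : measurable ([set 1] : set (measurableTypeR R)) by exact: measurable_set1.
have DE : D = D' `|` [set 1].
  apply/seteqP; split => t; rewrite /D /D'/= !in_itv/= (le_eqVlt t).
    by move=> /andP[-> /predU1P[->|->]]; [right|left].
  by move=> [/andP[-> ->]|->]; rewrite ?orbT// ler01 eqxx.
have D01 t : D t -> 0 <= t <= 1 by rewrite /D/= in_itv.
have ipow k : P.-integrable D (EFin \o (fun t : R => t ^+ k)).
  apply: (@bounded_integrable _ _ _ _ _ _ 1) => // t /D01/andP[? ?].
  by rewrite ger0_norm ?exprn_ge0// exprn_ile1.
have split1 k : (\int[P]_(t in D) t ^+ k)%R = (\int[P]_(t in D') t ^+ k)%R + fine (P [set 1]).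
  have dj : [disjoint D' & [set 1]].
    by apply/disj_set2P; rewrite -subset0 => t [] /[swap] ->; rewrite /D'/= in_itv/= ltxx andbF.
  have ik : P.-integrable (D' `|` [set 1]) (EFin \o (fun t : R => t ^+ k)) by rewrite -DE.
  rewrite [in LHS]DE (Rintegral_setU mD' m1 ik dj); congr (_ + _).
  rewrite -[RHS]mul1r -Rintegral_cst//.
  by apply: eq_Rintegral => t; rewrite inE /= => ->; rewrite expr1n.
suff P1 : P [set 1] = 0%E by split => // k; rewrite split1 P1/= addr0.
have fP : P [set 1] \is a fin_num by exact: fin_num_measure.
rewrite -(fineK fP); congr EFin; apply/eqP; rewrite eq_le fine_ge0// andbT.
apply/ler_addgt0Pl => e /hP[k]; rewrite addr0 split1 => /ltW; apply: le_trans.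
rewrite lerDr; apply: Rintegral_ge0 => t; rewrite /D'/= in_itv/= => /andP[t0 _].
by rewrite exprn_ge0.
Qed.

Theorem exists_radial_measure :
  exists omega : {finite_measure set (measurableTypeR R) -> \bar R},
    Dhat omega /\
    forall k, (\int[omega]_(t in `[0, 1[%classic) t ^+ k)%R = radial_moment nu k / (2 * pi).
Proof.
have M0 := radial_moment_gt0 nu_div.
pose c k := (radial_moment nu 0)^-1 * radial_moment nu k.
have cmc : completely_monotone c.
  by move=> n; apply: cm_uptoZ (cm_radial_moment nu_div n); rewrite invr_ge0 ltW.
have c1 : c 0%N = 1 by rewrite /c mulVf// gt_eqF.
have [P [P01 PM]] := hausdorff_moment cmc c1.
have [P1 PM'] : P [set 1] = 0%E /\ forall k,
    (\int[P]_(t in `[0, 1[%classic) t ^+ k)%R = (\int[P]_(t in `[0, 1]%classic) t ^+ k)%R.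
  apply: no_atom_at1 => e e0.
  have [|k hk] := @radial_moment_to0 _ _ nu_div (e * radial_moment nu 0).
    by rewrite mulr_gt0.
  by exists k; rewrite PM /c mulrC ltr_pdivrMr.
have p0 : 0 < 2 * pi :> R by rewrite mulr_gt0// pi_gt0.
have a0 : 0 <= radial_moment nu 0 / (2 * pi) by rewrite divr_ge0// ltW.
pose a : {nonneg R} := NngNum a0.
pose omega : {finite_measure set (measurableTypeR R) -> \bar R} := mscale a P.
have omM k : (\int[omega]_(t in `[0, 1[%classic) t ^+ k)%R = radial_moment nu k / (2 * pi).
  have mD : measurable (`[0, 1[%classic : set (measurableTypeR R)) by exact: measurable_itv.
  have mf : measurable_fun (`[0, 1[%classic : set (measurableTypeR R)) (fun t : R => t ^+ k).
    exact: measurable_funX.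
  apply: eq_trans (Rintegral_mscale P a mD mf _) _.
    by move=> t; rewrite /= in_itv/= => /andP[t0 _]; rewrite exprn_ge0.
  rewrite PM' PM /c/=; move: (gt_eqF p0) (gt_eqF (M0 0%N)); move: (2 * pi) => q q0 m0.
  by field; rewrite q0 m0.
exists omega; split => //.
apply: Dhat_of_moments.
- by move=> k; rewrite omM divr_gt0.
- move=> k; rewrite !omM mulrA ler_wpM2r ?invr_ge0 ?(ltW p0)//.
  have S0 := half_moment_sum_gt0 nu_div.
  have c0 : 0 < 65 :> R by rewrite ltr0n.
  rewrite /radial_moment -ler_pdivrMl// -invfM lef_pV2 ?posrE ?(mulr_gt0 c0)//.
  (* The [65 k]-th moment is the reciprocal of a partial sum of length
     [65 k + 1], which is at most [65 (k + 1)]. *)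
  apply: le_trans (half_moment_sumM nu 65 k.+1).
  rewrite -(big_mkord xpredT) -(big_mkord xpredT).
  rewrite [leRHS](@big_cat_nat _ _ _ (64 * k + k).+1)//=; last by lia.
  rewrite lerDl; apply: sumr_ge0 => j _; exact: (cm_upto_ge0 _ (cm_half_moment nu 0%N)).
suff h : P (~` `[0, 1[%classic) = 0%E by rewrite /omega/= /mscale [X in (_ * X)%E]h mule0.
have mI (i : interval R) : measurable ([set` i] : set (measurableTypeR R)).
  exact: measurable_itv.
have n1 : P.-negligible [set (1 : R)]
  by apply/negligibleP => //; exact: measurable_set1.
have n01 : P.-negligible (~` `[0, 1]%classic).
  by apply/negligibleP => //; apply: measurableC; exact: mI.
apply/negligibleP; first by apply: measurableC; exact: mI.
apply: negligibleS (negligibleU n01 n1) => t /=; rewrite !in_itv/= (le_eqVlt t).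
by case: (t =P 1) => [->|_]; [right|left].
Qed.

End RadialMeasure.

Local Open Scope complex_scope.

(** * Complex norm and limits *)

Section ComplexNorm.
Local Notation "z ^*" := (conjc z) : ring_scope.
Context {R : realType}.
Implicit Types (x y z w : R[i]).

Lemma normrC z : `|z| = (normc z)%:C.
Proof. by case: z. Qed.

Lemma normc_ge0 z : 0 <= normc z.
Proof. by case: z => a b; exact: sqrtr_ge0. Qed.

Lemma normcD_le x y : normc (x + y) <= normc x + normc y.
Proof. exact: le_normcD. Qed.

Lemma normcNE z : normc (- z) = normc z.
Proof. exact: normcN. Qed.

Lemma normcB_le x y : normc (x - y) <= normc x + normc y.
Proof. by rewrite -(normcNE y) normcD_le. Qed.

Lemma normc_distC x y : normc (x - y) = normc (y - x).
Proof. by rewrite -normcNE opprB. Qed.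

Lemma normcX z n : normc (z ^+ n) = normc z ^+ n.
Proof. by elim: n => [|n IH]; rewrite ?expr0 ?normc1// !exprS normcM IH. Qed.

Lemma normc_real (a : R) : normc a%:C = `|a|.
Proof. by rewrite /= expr0n/= addr0 sqrtr_sqr. Qed.

Lemma normc_conj z : normc z^* = normc z.
Proof. by case: z => a b /=; rewrite sqrrN. Qed.

Lemma conjcM x y : (x * y)^* = x^* * y^*.
Proof. exact: rmorphM. Qed.

Lemma conjcB x y : (x - y)^* = x^* - y^*.
Proof. exact: rmorphB. Qed.

Lemma conjcV x : (x^-1)^* = (x^*)^-1.
Proof. exact: fmorphV. Qed.

Lemma conjcX x n : (x ^+ n)^* = x^* ^+ n.
Proof. exact: rmorphXn. Qed.

Lemma normc_sum_le (I : Type) (r : seq I) (P : pred I) (F : I -> R[i]) :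
  normc (\sum_(i <- r | P i) F i) <= \sum_(i <- r | P i) normc (F i).
Proof.
elim/big_ind2 : _ => [|x1 x2 y1 y2 h1 h2|//]; first by rewrite normc0.
by apply: le_trans (normcD_le _ _) _; exact: lerD.
Qed.

Lemma normc_gt0 z : z != 0 -> 0 < normc z.
Proof.
move=> z0; rewrite lt_neqAle normc_ge0 andbT eq_sym.
by apply: contra z0 => /eqP /eq0_normc ->.
Qed.

Lemma normc_eq0 z : normc z <= 0 -> z = 0.
Proof. by move=> h; apply: eq0_normc; apply/eqP; rewrite eq_le h normc_ge0. Qed.

Lemma Re_le_normc z : `|complex.Re z| <= normc z.
Proof. by case: z => a b /=; rewrite -sqrtr_sqr ler_wsqrtr// lerDl sqr_ge0. Qed.

Lemma Im_le_normc z : `|complex.Im z| <= normc z.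
Proof. by case: z => a b /=; rewrite -sqrtr_sqr ler_wsqrtr// lerDr sqr_ge0. Qed.

Lemma normc_le_ReIm z : normc z <= `|complex.Re z| + `|complex.Im z|.
Proof.
case: z => a b /=; rewrite -[leRHS]ger0_norm ?addr_ge0// -sqrtr_sqr ler_wsqrtr//.
rewrite sqrrD !real_normK ?num_real// addrAC lerDl.
by rewrite mulrn_wge0// mulr_ge0.
Qed.

Lemma unit_discE z : unit_disc z <-> normc z < 1.
Proof. by rewrite /unit_disc/= normrC ltcR. Qed.

End ComplexNorm.

Section ComplexLimits.
Local Notation "z ^*" := (conjc z) : ring_scope.
Context {R : realType}.
Implicit Types (u v : nat -> R[i]) (l : R[i]).

(** Convergence is stated through the real-valued norm, which avoids choosing
    a topology on the complex numbers, and along an arbitrary filter, since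
    ultrafilters are used as well as the filter at infinity. *)
Definition climit (F : set_system nat) u l : Prop :=
  (fun n => normc (u n - l)) @ F --> (0 : R).

Lemma climit_le (F : set_system nat) {FF : Filter F} u l (e : nat -> R) :
  (forall n, normc (u n - l) <= e n) -> e @ F --> (0 : R) -> climit F u l.
Proof.
move=> ue e0; apply: (@squeeze_cvgr _ _ _ _ (fun=> 0) e) => //; last exact: cvg_cst.
by apply: nearW => n; rewrite normc_ge0 ue.
Qed.

Lemma climit_near (F : set_system nat) {FF : Filter F} u l (e : nat -> R) :
  (\forall n \near F, normc (u n - l) <= e n) -> e @ F --> (0 : R) -> climit F u l.
Proof.
move=> ue e0; apply: (@squeeze_cvgr _ _ _ _ (fun=> 0) e) => //; last exact: cvg_cst.
by apply: filterS ue => n ->; rewrite normc_ge0.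
Qed.

Lemma climit_cst (F : set_system nat) {FF : Filter F} l : climit F (fun=> l) l.
Proof. by apply: (@climit_le _ _ _ _ (fun=> 0)); [move=> n; rewrite subrr normc0|exact: cvg_cst]. Qed.

Lemma climitD (F : set_system nat) {FF : Filter F} u v l m :
  climit F u l -> climit F v m -> climit F (fun n => u n + v n) (l + m).
Proof.
move=> ul vm; apply: (climit_le (e := fun n => normc (u n - l) + normc (v n - m))).
  by move=> n; rewrite opprD addrACA normcD_le.
by rewrite -[X in _ --> X](addr0 (0 : R)); apply: cvgD.
Qed.

Lemma climitZ (F : set_system nat) {FF : Filter F} a u l :
  climit F u l -> climit F (fun n => a * u n) (a * l).
Proof.
move=> ul; apply: (climit_le (e := fun n => normc a * normc (u n - l))).
  by move=> n; rewrite -mulrBr normcM.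
by rewrite -[X in _ --> X](mulr0 (normc a)); apply: cvgM => //; exact: cvg_cst.
Qed.

Lemma climitB (F : set_system nat) {FF : Filter F} u v l m :
  climit F u l -> climit F v m -> climit F (fun n => u n - v n) (l - m).
Proof.
move=> ul vm; have := climitD ul (climitZ (-1) vm); rewrite mulN1r.
have -> : (fun n => u n + -1 * v n) = fun n => u n - v n by apply/funext => n; rewrite mulN1r.
exact.
Qed.

Lemma climit_sum (F : set_system nat) {FF : Filter F} K (u : nat -> nat -> R[i]) (l : nat -> R[i]) :
  (forall k, climit F (u k) (l k)) ->
  climit F (fun n => \sum_(k < K) u k n) (\sum_(k < K) l k).
Proof.
move=> ul; elim: K => [|K IH].
  rewrite big_ord0 (_ : (fun n => _) = fun=> 0); first exact: climit_cst.
  by apply/funext => n; rewrite big_ord0.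
rewrite big_ord_recr (_ : (fun n => _) = fun n => \sum_(k < K) u k n + u K n).
  exact: climitD.
by apply/funext => n; rewrite big_ord_recr.
Qed.

Lemma climit_conj (F : set_system nat) u l : climit F u l -> climit F (fun n => (u n)^*) l^*.
Proof.
rewrite /climit (_ : (fun n => normc ((u n)^* - _)) = fun n => normc (u n - l))//.
by apply/funext => n; rewrite -rmorphB normc_conj.
Qed.

Lemma climit_norm_le (F : set_system nat) {FF : ProperFilter F} u l w M :
  climit F u l -> (forall n, normc (u n - w) <= M) -> normc (l - w) <= M.
Proof.
move=> ul um; rewrite -subr_le0.
have hc : (fun _ : nat => normc (l - w) - M) @ F --> normc (l - w) - M by exact: cvg_cst.
apply: (ler_cvg_to hc ul).
apply: nearW => n; rewrite lerBlDr.
have -> : l - w = (u n - w) - (u n - l) by ring.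
by apply: le_trans (normcB_le _ _) _; rewrite addrC lerD2l.
Qed.

Lemma climit_norm_le0 (F : set_system nat) {FF : ProperFilter F} u l M :
  climit F u l -> (forall n, normc (u n) <= M) -> normc l <= M.
Proof.
move=> ul um; rewrite -[l]subr0; apply: (climit_norm_le ul) => n.
by rewrite subr0.
Qed.

Lemma climit_unique (F : set_system nat) {FF : ProperFilter F} u l m :
  climit F u l -> climit F u m -> l = m.
Proof.
move=> ul um; apply/eqP; rewrite -subr_eq0; apply/eqP; apply: normc_eq0.
have h : (fun n => normc (u n - l) + normc (u n - m)) @ F --> (0 + 0 : R) by exact: cvgD.
rewrite addr0 in h.
have hc : (fun _ : nat => normc (l - m)) @ F --> normc (l - m) by exact: cvg_cst.
apply: (ler_cvg_to hc h).
apply: nearW => n; have -> : l - m = (u n - m) - (u n - l) by ring.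
by apply: le_trans (normcB_le _ _) _; rewrite addrC.
Qed.

Lemma climitP u l : climit \oo u l <-> (u @ \oo --> (l : R[i]^o)).
Proof.
split => [ul|ul].
  apply/(@cvgrPdist_lt _ R[i]^o) => e e0.
  have eR : e = (complex.Re e)%:C by rewrite RRe_real// gtr0_real.
  have e0' : 0 < complex.Re e by rewrite -ltcR -eR.
  move: ul; rewrite /climit => /cvgrPdist_lt/(_ _ e0'); apply: filterS => n.
  rewrite sub0r normrN ger0_norm ?normc_ge0// => h.
  by rewrite eR distrC normrC ltcR.
rewrite /climit; apply/cvgrPdist_lt => e e0.
move/(@cvgrPdist_lt _ R[i]^o) : ul => /(_ e%:C); rewrite ltcR => /(_ e0); apply: filterS => n.
by rewrite distrC normrC ltcR sub0r normrN ger0_norm ?normc_ge0.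
Qed.

Lemma climit_shift u l : climit \oo (fun n => u n.+1) l -> climit \oo u l.
Proof. by rewrite /climit => h; rewrite -cvg_shiftS. Qed.

End ComplexLimits.

(** * Power series with geometrically bounded coefficients *)

Section PowerSeries.
Context {R : realType}.
Implicit Types (f g : R[i] -> R[i]) (c d e : nat -> R[i]) (a h k x z : R[i]) (s M q : R).

Definition psum c h N : R[i] := \sum_(n < N) c n * h ^+ n.

(** The number [s] is the inverse of a radius. The coefficient bound is part
    of the definition so that every estimate reduces to a geometric series. *)
Definition local_series f a c s : Prop :=
  [/\ 0 < s, exists M, forall n, normc (c n) <= M * s ^+ n &
      forall h, normc h * s < 1 -> climit \oo (psum c h) (f (a + h))].

Definition analytic_at f a : Prop := exists c s, local_series f a c s.

Lemma psumS c h N : psum c h N.+1 = psum c h N + c N * h ^+ N.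
Proof. by rewrite /psum big_ord_recr. Qed.

Lemma geometric_sum_le q N : 0 <= q < 1 -> \sum_(n < N) q ^+ n <= (1 - q)^-1.
Proof.
move=> /andP[q0 q1].
have -> : \sum_(n < N) q ^+ n = (1 - q ^+ N) / (1 - q).
  elim: N => [|N IH]; first by rewrite big_ord0 expr0 subrr mul0r.
  rewrite big_ord_recr/= IH exprS; field; lra.
rewrite ler_pdivrMr ?subr_gt0// mulVf; last by lra.
by rewrite gerBl exprn_ge0.
Qed.

Lemma cvg_exprM0 (M q : R) : 0 <= q < 1 -> (fun n => M * q ^+ n) @ \oo --> (0 : R).
Proof.
by move=> /andP[q0 q1]; apply: cvg_geometric; rewrite ger0_norm.
Qed.

Lemma series_tail e M q l N : 0 <= q < 1 -> (forall n, normc (e n) <= M * q ^+ n) ->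
  climit \oo (fun N => \sum_(n < N) e n) l ->
  normc (l - \sum_(n < N) e n) <= M * q ^+ N / (1 - q).
Proof.
move=> q01 eM; rewrite /climit -(cvg_shiftn N) => el.
apply: (@climit_norm_le _ \oo _ _ _ _ _ el) => n.
rewrite addnC big_split_ord/= [X in X - _]addrC addrK.
apply: le_trans (normc_sum_le _ _ _) _.
have M0 : 0 <= M by have := eM 0%N; rewrite expr0 mulr1; apply: le_trans; exact: normc_ge0.
have /andP[q0 q1] := q01.
apply: (@le_trans _ _ (\sum_(i < n) M * q ^+ N * q ^+ i)).
  by apply: ler_sum => i _; rewrite -mulrA -exprD.
by rewrite -mulr_sumr ler_wpM2l ?mulr_ge0 ?exprn_ge0 ?geometric_sum_le.
Qed.

Lemma climit_bounded (u : nat -> R[i]) l : climit \oo u l ->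
  exists B, forall n, normc (u n - l) <= B.
Proof.
move=> ul; have [B [Br HB]] : bounded_fun (fun n => normc (u n - l)).
  by apply: cvg_seq_bounded; apply/cvg_ex; exists 0.
exists (`|B| + 1) => n; apply: le_trans (HB (`|B| + 1) _ n I); first exact: ler_norm.
by rewrite (le_lt_trans (ler_norm _)) ?ltrDl.
Qed.

(** Convergence at the point [a + rho / 2] bounds the terms there, hence the
    coefficients. *)
Lemma analytic_at_on_disc f a : analytic_on_disc f -> unit_disc a -> analytic_at f a.
Proof.
move=> fa /fa[c [rho [rho0 H]]].
exists c, (2 / rho); split; first by rewrite divr_gt0.
- have hr : normc (rho / 2)%:C = rho / 2 by rewrite normc_real ger0_norm// divr_ge0// ltW.
  have := H (a + (rho / 2)%:C); rewrite addrC addKr normrC ltcR hr.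
  move=> /(_ ltac:(lra)) /climitP H1.
  have [B HB] := climit_bounded H1; exists (2 * B) => n.
  have B1 := HB n; have B2 := HB n.+1.
  set r := (rho / 2)%:C in hr B1 B2.
  have e : normc (c n) * (rho / 2) ^+ n <= 2 * B.
    rewrite -hr -normcX -normcM.
    have -> : c n * r ^+ n = series (fun n => c n * r ^+ n) n.+1 - f (a + r) -
        (series (fun n => c n * r ^+ n) n - f (a + r)).
      by rewrite /series/= big_nat_recr//=; ring.
    by apply: le_trans (normcB_le _ _) _; lra.
  rewrite -ler_pdivrMr ?exprn_gt0 ?divr_gt0// -exprVn invf_div//.
- move=> h hs; have := H (a + h); rewrite addrC addKr normrC ltcR.
  have -> : normc h < rho by move: hs; rewrite mulrA ltr_pdivrMr// mul1r; have := normc_ge0 h; lra.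
  move=> /(_ isT) /climitP; rewrite /climit /psum /series/=.
  by under eq_fun do rewrite big_mkord.
Qed.

Lemma analytic_on_discP f : (forall a, normc a < 1 -> analytic_at f a) -> analytic_on_disc f.
Proof.
move=> fa a /unit_discE /fa[c [s [s0 _ H]]].
exists c, s^-1; rewrite invr_gt0; split => // z; rewrite normrC ltcR => hz.
apply/climitP; have := H (z - a); rewrite -ltr_pdivlMr// div1r => /(_ hz).
have -> : a + (z - a) = z by ring.
rewrite /climit /psum /series/=.
by under [in X in _ -> X]eq_fun do rewrite big_mkord.
Qed.

Lemma expr_sub_le x y r n : normc x <= r -> normc y <= r ->
  r * normc (x ^+ n - y ^+ n) <= n%:R * r ^+ n * normc (x - y).
Proof.
move=> xr yr; have r0 : 0 <= r := le_trans (normc_ge0 _) xr.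
elim: n => [|n IH]; first by rewrite !expr0 subrr normc0 mulr0 !mul0r.
rewrite !exprS (_ : _ - _ = x * (x ^+ n - y ^+ n) + (x - y) * y ^+ n); last by ring.
have h1 := normcD_le (x * (x ^+ n - y ^+ n)) ((x - y) * y ^+ n).
rewrite !normcM normcX in h1.
have h2 : normc y ^+ n <= r ^+ n by rewrite lerXn2r ?nnegrE ?normc_ge0.
have h3 : normc x * normc (x ^+ n - y ^+ n) <= r * normc (x ^+ n - y ^+ n).
  by rewrite ler_wpM2r ?normc_ge0.
have h4 : normc (x - y) * normc y ^+ n <= normc (x - y) * r ^+ n by rewrite ler_wpM2l ?normc_ge0.
apply: le_trans (_ : r * (r * normc (x ^+ n - y ^+ n) + normc (x - y) * r ^+ n) <= _).
  by rewrite ler_wpM2l//; lra.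
have -> : n.+1%:R * (r * r ^+ n) * normc (x - y) =
  r * (n%:R * r ^+ n * normc (x - y) + normc (x - y) * r ^+ n) by rewrite -natr1; ring.
by rewrite ler_wpM2l// lerD2r.
Qed.

(** Comparing two secant slopes at [x] after clearing the denominators [h] and
    [k] plays the role of a bound on the second derivative, with no derivative
    in sight; it passes from monomials to power series term by term. *)
Lemma expr_slope_le x h k r n : normc x <= r -> normc (x + h) <= r -> normc (x + k) <= r ->
  r ^+ 2 * normc (k * ((x + h) ^+ n - x ^+ n) - h * ((x + k) ^+ n - x ^+ n)) <=
  n%:R ^+ 2 * r ^+ n * (normc h * normc k * (normc h + normc k)).
Proof.
move=> xr hr kr; have r0 : 0 <= r := le_trans (normc_ge0 _) xr.
set B := normc h * normc k * _.
have B0 : 0 <= B by rewrite !mulr_ge0 ?addr_ge0 ?normc_ge0.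
elim: n => [|n IH]; first by rewrite !expr0 !subrr !mulr0 subrr normc0 mulr0 expr2 !mul0r.
set A := (k * _ - _) in IH.
have -> : k * ((x + h) ^+ n.+1 - x ^+ n.+1) - h * ((x + k) ^+ n.+1 - x ^+ n.+1) =
  x * A + k * h * ((x + h) ^+ n - (x + k) ^+ n) by rewrite /A !exprS; ring.
have h1 := normcD_le (x * A) (k * h * ((x + h) ^+ n - (x + k) ^+ n)).
rewrite !normcM in h1.
have h2 := expr_sub_le n hr kr.
have h3 : normc (x + h - (x + k)) <= normc h + normc k.
  by rewrite opprD addrACA subrr add0r normcB_le.
set E := normc ((x + h) ^+ n - _) in h1 h2.
have h4 : r * E <= n%:R * r ^+ n * (normc h + normc k).
  by apply: le_trans h2 _; rewrite ler_wpM2l// mulr_ge0 ?exprn_ge0.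
have h5 : normc x * normc A <= r * normc A by rewrite ler_wpM2r ?normc_ge0.
have h6 : r * (normc k * normc h * E) <= n%:R * r ^+ n * B.
  have : normc k * normc h * (r * E) <= normc k * normc h * (n%:R * r ^+ n * (normc h + normc k)).
    by rewrite ler_wpM2l// mulr_ge0 ?normc_ge0.
  rewrite mulrCA [X in _ -> _ <= X](_ : _ = normc k * normc h * (n%:R * r ^+ n * (normc h + normc k)))//.
  by rewrite /B; ring.
apply: le_trans (_ : r * (r ^+ 2 * normc A) + r * (r * (normc k * normc h * E)) <= _).
  have : r ^+ 2 * normc (x * A + k * h * ((x + h) ^+ n - (x + k) ^+ n)) <=
    r ^+ 2 * (r * normc A + normc k * normc h * E).
    by rewrite ler_wpM2l ?exprn_ge0//; lra.
  by rewrite expr2; lra.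
apply: le_trans (_ : r * (n%:R ^+ 2 * r ^+ n * B) + r * (n%:R * r ^+ n * B) <= _).
  by apply: lerD; rewrite ler_wpM2l.
have nz : 0 <= n.+1%:R :> R by [].
have := mulr_ge0 nz (mulr_ge0 (mulr_ge0 r0 (exprn_ge0 n r0)) B0).
have -> : n.+1%:R ^+ 2 * r ^+ n.+1 * B = r * (n%:R ^+ 2 * r ^+ n * B) + r * (n%:R * r ^+ n * B) +
    n.+1%:R * (r * r ^+ n * B).
  have -> : n.+1%:R = n%:R + 1 :> R by rewrite natr1.
  by rewrite [r ^+ n.+1]exprS; ring.
by lra.
Qed.

End PowerSeries.

(** * Uniform smoothness near a point *)

Section LocalSeries.
Context {R : realType}.
Implicit Types (f g : R[i] -> R[i]) (c d e : nat -> R[i]) (a h k x z : R[i]) (s M q : R).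

(** One constant controls size, Lipschitz bound, slope comparison and (through
    its inverse) the admissible step, so that the property is monotone enough to
    be made uniform by compactness. The last inequality says that the secant
    slopes along [h] and [k] differ by at most [K] times [|h| + |k|]. *)
Definition regular_at f (K : R) z : Prop :=
  normc (f z) <= K /\
  forall h k, normc h <= K^-1 -> normc k <= K^-1 ->
    normc (f (z + h) - f z) <= K * normc h /\
    normc (k * (f (z + h) - f z) - h * (f (z + k) - f z)) <=
      K * (normc h * normc k * (normc h + normc k)).

Lemma sqr_le_expn4 n : (n ^ 2 <= 4 ^ n)%N.
Proof.
elim: n => [//|n IH]; rewrite expnS; case: n IH => [//|n IH].
by apply: leq_trans (leq_mul (leqnn 4) IH); lia.
Qed.

(** On the disc of radius [1 / (8 s)] the monomial estimates, whose factors
    [n] and [n ^ 2] are absorbed by [4 ^ n], sum to a geometric series of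
    ratio [1 / 2]. *)
Lemma local_series_regular f a : analytic_at f a ->
  exists K0 delta : R, 0 < delta /\
    forall z K, normc (z - a) <= delta -> K0 <= K -> regular_at f K z.
Proof.
move=> [c [s [s0 [M cM] fH]]].
have M0 : 0 <= M by have := cM 0%N; rewrite expr0 mulr1; apply: le_trans; exact: normc_ge0.
pose r := (8 * s)^-1.
have r0 : 0 < r by rewrite invr_gt0 mulr_gt0.
have rs : r * s = 1 / 8 by rewrite /r; field; lra.
have fE x : normc x <= r -> climit \oo (psum c x) (f (a + x)).
  move=> xr; apply: fH; apply: le_lt_trans (_ : r * s < 1); last by rewrite rs; lra.
  by rewrite ler_wpM2r// ltW.
have term n : M * s ^+ n * r ^+ n = M * (1 / 8) ^+ n by rewrite -mulrA -exprMn mulrC [s * r]mulrC rs mulrC.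
have n4 n : n%:R ^+ 2 <= 4 ^+ n :> R by rewrite -!natrX ler_nat sqr_le_expn4.
have geo N : \sum_(n < N) (1 / 2) ^+ n <= 2 :> R.
  apply: le_trans (geometric_sum_le N _) _; first by apply/andP; lra.
  by rewrite (_ : (1 - 1 / 2)^-1 = 2) //; field.
have sum_le (t : nat -> R) (B : R) N : 0 <= B -> (forall n, t n <= B * (1 / 2) ^+ n) ->
    \sum_(n < N) t n <= 2 * B.
  move=> B0 tB; apply: (@le_trans _ _ (\sum_(n < N) B * (1 / 2) ^+ n)).
    by apply: ler_sum.
  by rewrite -mulr_sumr mulrC ler_wpM2r.
have h82 n : (1 / 8) ^+ n <= (1 / 2) ^+ n :> R.
  by apply: lerXn2r; rewrite ?nnegrE; lra.
have h842 n : 4 ^+ n * (1 / 8) ^+ n = (1 / 2) ^+ n :> R.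
  by rewrite -exprMn; congr (_ ^+ _); field.
have n82 n : n%:R ^+ 2 * (1 / 8) ^+ n <= (1 / 2) ^+ n :> R.
  by rewrite -h842 ler_wpM2r// exprn_ge0.
have n81 n : n%:R * (1 / 8) ^+ n <= (1 / 2) ^+ n :> R.
  apply: le_trans (n82 n); rewrite ler_wpM2r ?exprn_ge0//.
  by rewrite -natrX ler_nat -{1}[n]expn1; case: n => // n; rewrite leq_pexp2l.
have termr n B C u : 0 <= B -> 0 <= C -> u <= M * s ^+ n -> B <= C * r ^+ n -> u * B <= C * (M * (1 / 8) ^+ n).
  move=> B0 C0 uM BC; apply: le_trans (_ : M * s ^+ n * (C * r ^+ n) <= _).
    apply: le_trans (_ : M * s ^+ n * B <= _); first by rewrite ler_wpM2r.
    by rewrite ler_wpM2l// mulr_ge0// exprn_ge0// ltW.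
  by rewrite -term; apply: le_of_eq; ring.
have bnd0 x : normc x <= r -> normc (f (a + x)) <= 2 * M.
  move=> xr; apply: (climit_norm_le0 (fE _ xr)) => N.
  apply: le_trans (normc_sum_le _ _ _) _; apply: (sum_le (fun n => normc (c n * x ^+ n)) M N) => // n.
  rewrite normcM normcX; apply: le_trans (_ : M * s ^+ n * r ^+ n <= _).
    by apply: ler_pM; rewrite ?exprn_ge0 ?normc_ge0// lerXn2r// ?nnegrE ?normc_ge0// ltW.
  by rewrite term ler_wpM2l.
pose K1 := 2 * M / r; pose K2 := 2 * M / r ^+ 2.
have bnd1 x h : normc x <= r -> normc (x + h) <= r ->
    normc (f (a + (x + h)) - f (a + x)) <= K1 * normc h.
  move=> xr hr.
  pose proof (climitB (fE _ hr) (fE _ xr)) as H.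
  apply: (climit_norm_le0 H) => N; rewrite /psum -sumrB.
  apply: le_trans (normc_sum_le _ _ _) _.
  apply: le_trans (sum_le (fun n => normc (c n * (x + h) ^+ n - c n * x ^+ n))
    (M / r * normc h) N _ _) _.
  - by rewrite mulr_ge0 ?normc_ge0// divr_ge0// ltW.
  - move=> n; rewrite -mulrBr normcM.
    have E := expr_sub_le n hr xr; rewrite [x + h - x]addrC addKr in E.
    rewrite (_ : M / r * _ * _ = (normc h * M * (1 / 2) ^+ n) / r); last by ring.
    rewrite ler_pdivlMr// [leLHS](_ : _ = normc (c n) * (r * normc ((x + h) ^+ n - x ^+ n))); last by ring.
    apply: le_trans (termr n _ (n%:R * normc h) _ _ _ (cM n) _) _.
    - by rewrite mulr_ge0 ?normc_ge0// ltW.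
    - by rewrite mulr_ge0 ?normc_ge0.
    - by apply: le_trans E _; apply: le_of_eq; ring.
    have := ler_wpM2l (mulr_ge0 (normc_ge0 h) M0) (n81 n); apply: le_trans.
    by apply: le_of_eq; ring.
  - by rewrite /K1; apply: le_of_eq; ring.
have bnd2 x h k : normc x <= r -> normc (x + h) <= r -> normc (x + k) <= r ->
    normc (k * (f (a + (x + h)) - f (a + x)) - h * (f (a + (x + k)) - f (a + x))) <=
    K2 * (normc h * normc k * (normc h + normc k)).
  move=> xr hr kr; set B := normc h * normc k * _.
  have B0 : 0 <= B by rewrite !mulr_ge0 ?addr_ge0 ?normc_ge0.
  pose proof (climitB (climitZ k (climitB (fE _ hr) (fE _ xr))) (climitZ h (climitB (fE _ kr) (fE _ xr)))) as H.
  apply: (climit_norm_le0 H) => N; rewrite /psum -!sumrB !mulr_sumr -sumrB.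
  apply: le_trans (normc_sum_le _ _ _) _.
  apply: le_trans (sum_le (fun n => normc (k * (c n * (x + h) ^+ n - c n * x ^+ n) -
    h * (c n * (x + k) ^+ n - c n * x ^+ n))) (M / r ^+ 2 * B) N _ _) _.
  - by rewrite mulr_ge0// divr_ge0// exprn_ge0// ltW.
  - move=> n.
    have -> : k * (c n * (x + h) ^+ n - c n * x ^+ n) - h * (c n * (x + k) ^+ n - c n * x ^+ n) =
      c n * (k * ((x + h) ^+ n - x ^+ n) - h * ((x + k) ^+ n - x ^+ n)) by ring.
    rewrite normcM; have E := expr_slope_le n xr hr kr; rewrite -/B in E.
    rewrite (_ : M / r ^+ 2 * _ * _ = (B * M * (1 / 2) ^+ n) / r ^+ 2); last by ring.
    rewrite ler_pdivlMr ?exprn_gt0// [leLHS](_ : _ = normc (c n) *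
      (r ^+ 2 * normc (k * ((x + h) ^+ n - x ^+ n) - h * ((x + k) ^+ n - x ^+ n)))); last by ring.
    apply: le_trans (termr n _ (n%:R ^+ 2 * B) _ _ _ (cM n) _) _.
    - by rewrite mulr_ge0 ?normc_ge0 ?exprn_ge0// ltW.
    - by rewrite mulr_ge0 ?exprn_ge0.
    - by apply: le_trans E _; apply: le_of_eq; ring.
    have := ler_wpM2l (mulr_ge0 B0 M0) (n82 n); apply: le_trans.
    by apply: le_of_eq; ring.
  - by rewrite /K2; apply: le_of_eq; ring.
have K10 : 0 <= K1 by rewrite /K1 !divr_ge0 ?mulr_ge0// ltW.
have K20 : 0 <= K2 by rewrite /K2 !divr_ge0 ?mulr_ge0// ?exprn_ge0// ltW.
have r20 : 0 < 2 / r by rewrite divr_gt0.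
exists (2 * M + K1 + K2 + 2 / r), (r / 2); split; first by rewrite divr_gt0.
move=> z K za KK.
have zE : z = a + (z - a) by ring.
have zr : normc (z - a) <= r by lra.
have Kr : K^-1 <= r / 2.
  rewrite -[r / 2]invrK lef_pV2 ?posrE ?invf_div//; lra.
split; first by rewrite zE; apply: le_trans (bnd0 _ zr) _; lra.
move=> h k hK kK.
have hr : normc (z - a + h) <= r by apply: le_trans (normcD_le _ _) _; lra.
have kr : normc (z - a + k) <= r by apply: le_trans (normcD_le _ _) _; lra.
have := bnd1 _ _ zr hr; have := bnd2 _ _ _ zr hr kr.
rewrite !addrA ![a + z]addrC !addrK => b2 b1.
split; [apply: le_trans b1 _|apply: le_trans b2 _]; rewrite ler_wpM2r ?normc_ge0//; try lra.
by rewrite !mulr_ge0 ?addr_ge0 ?normc_ge0.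
Qed.

End LocalSeries.

(** * Division of power series *)

Section SeriesOperations.
Context {R : realType}.
Implicit Types (f g : R[i] -> R[i]) (c d e : nat -> R[i]) (a h k x z p u : R[i]) (s M q : R).

(** The Taylor coefficients of the quotient of [\sum_n c n * h ^+ n] by
    [p - u * h]. *)
Fixpoint div_coef c p u n : R[i] :=
  if n is m.+1 then (c m.+1 + u * div_coef c p u m) / p else c 0%N / p.

Lemma psum_div c p u h N : p != 0 ->
  (p - u * h) * psum (div_coef c p u) h N.+1 =
  psum c h N.+1 - u * div_coef c p u N * h ^+ N.+1.
Proof.
move=> p0; elim: N => [|N IH].
  by rewrite !psumS /psum !big_ord0 /= !add0r expr0 expr1; field.
rewrite psumS mulrDr IH [psum c h N.+2]psumS /= !exprS.
by field.
Qed.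

Lemma climit_psum_div c p u h l s M : p != 0 -> p - u * h != 0 ->
  (forall n, normc (div_coef c p u n) <= M * s ^+ n) -> 0 <= s -> normc h * s < 1 ->
  climit \oo (psum c h) l -> climit \oo (psum (div_coef c p u) h) (l / (p - u * h)).
Proof.
move=> p0 ph eM s0 hs cl; apply: climit_shift.
have sh : 0 <= normc h * s < 1 by rewrite mulr_ge0 ?normc_ge0.
have h1 : climit \oo (fun n => psum c h n.+1) l by rewrite /climit (cvg_shiftS (fun n => normc (psum c h n - l))).
have h2 : climit \oo (fun n => u * div_coef c p u n * h ^+ n.+1) 0.
  apply: (climit_le (e := fun n => (normc u * M * normc h) * (normc h * s) ^+ n)); last exact: cvg_exprM0.
  move=> n; rewrite subr0 !normcM normcX exprS exprMn.
  have := ler_wpM2l (normc_ge0 u) (eM n) => E.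
  have hh : 0 <= normc h * normc h ^+ n by rewrite mulr_ge0 ?exprn_ge0 ?normc_ge0.
  by apply: le_trans (ler_wpM2r hh E) _; apply: le_of_eq; ring.
pose proof (climitZ (p - u * h)^-1 (climitB h1 h2)) as H.
rewrite [l / _]mulrC; move: H; rewrite subr0 /climit.
by under eq_fun do rewrite -psum_div// mulKf//.
Qed.

Lemma div_coef_bound c p u s M t : p != 0 -> 0 <= M -> 0 <= s -> s <= t -> 2 * normc u <= t * normc p ->
  (forall n, normc (c n) <= M * s ^+ n) ->
  forall n, normc (div_coef c p u n) <= (2 * M / normc p) * t ^+ n.
Proof.
move=> p0 M0 s0 st ut cM n; have np := normc_gt0 p0; have t0 := le_trans s0 st.
have stn m : M * s ^+ m <= M * t ^+ m by rewrite ler_wpM2l// lerXn2r// nnegrE.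
elim: n => [|n IH] /=.
  rewrite normcM normcV expr0 mulr1 ler_wpM2r ?invr_ge0 ?normc_ge0//.
  by have := cM 0%N; rewrite expr0 mulr1; lra.
rewrite normcM normcV mulrAC ler_wpM2r ?invr_ge0 ?normc_ge0//.
apply: le_trans (normcD_le _ _) _; rewrite normcM.
have h1 := le_trans (cM n.+1) (stn n.+1).
have h2 := ler_wpM2l (normc_ge0 u) IH.
have h3 : normc u * (2 * M / normc p * t ^+ n) <= M * t ^+ n.+1.
  rewrite (_ : _ * _ = (2 * normc u) * (M * t ^+ n) / normc p); last by ring.
  rewrite ler_pdivrMr//.
  have := ler_wpM2r (mulr_ge0 M0 (exprn_ge0 n t0)) ut.
  rewrite exprS; lra.
rewrite [leRHS](_ : _ = 2 * (M * t ^+ n.+1)); last by ring.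
lra.
Qed.

Lemma local_bound_ge0 (c : nat -> R[i]) s M : (forall n, normc (c n) <= M * s ^+ n) -> 0 <= M.
Proof.
by move=> cM; have := cM 0%N; rewrite expr0 mulr1; apply: le_trans; exact: normc_ge0.
Qed.

(** The recursion for the quotient keeps a geometric bound as soon as the
    ratio exceeds [2 |u| / |p|], and in the corresponding disc the denominator
    does not vanish. *)
Lemma analytic_at_div f g a p u : analytic_at f a -> p != 0 ->
  (forall h, p - u * h != 0 -> g (a + h) = f (a + h) / (p - u * h)) -> analytic_at g a.
Proof.
move=> [c [s [s0 [M cM] fc]]] p0 gE.
have np := normc_gt0 p0; have M0 := local_bound_ge0 cM.
pose t := s + 2 * normc u / normc p.
have un : 0 <= 2 * normc u / normc p by rewrite !mulr_ge0 ?invr_ge0 ?normc_ge0.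
have st : s <= t by rewrite lerDl.
have t0 : 0 < t by exact: lt_le_trans st.
have ut : 2 * normc u <= t * normc p.
  by rewrite /t [(s + _) * _]mulrDl divfK ?gt_eqF// lerDr mulr_ge0 ?normc_ge0// ltW.
have eM := div_coef_bound p0 M0 (ltW s0) st ut cM.
exists (div_coef c p u), t; split => //; first by eexists; exact: eM.
move=> h ht.
have ph : p - u * h != 0.
  apply/eqP => /eqP; rewrite subr_eq0 => /eqP pE.
  have E : normc p = normc u * normc h by rewrite pE normcM.
  have := ler_wpM2r (normc_ge0 h) ut; have := normc_ge0 h; nra.
rewrite gE//; apply: (climit_psum_div p0 ph eM (ltW t0) ht).
by apply: fc; apply: le_lt_trans ht; rewrite ler_wpM2l ?normc_ge0.
Qed.

Lemma analytic_at_subc f a b : analytic_at f a -> analytic_at (fun z => f z - b) a.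
Proof.
move=> [c [s [s0 [M cM] fc]]].
exists (fun n => if n is 0%N then c 0%N - b else c n), s; split => //.
  exists (M + normc b) => -[|n].
    by rewrite expr0 mulr1; apply: le_trans (normcB_le _ _) _; rewrite lerD2r; have := cM 0%N; rewrite expr0 mulr1.
  by apply: le_trans (cM n.+1) _; rewrite ler_wpM2r ?exprn_ge0 ?(ltW s0)// lerDl normc_ge0.
move=> h /fc H; apply: climit_shift.
have h1 : climit \oo (fun n => psum c h n.+1) (f (a + h)).
  by rewrite /climit (cvg_shiftS (fun n => normc (psum c h n - f (a + h)))).
pose proof (climitB h1 (climit_cst (F := \oo) b)) as H2.
rewrite (_ : (fun n => _) = (fun n => psum c h n.+1 - b))//.
apply/funext => n; rewrite /psum !big_ord_recl !expr0 !mulr1/=.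
by rewrite addrAC.
Qed.

Lemma analytic_at_cst b a : analytic_at (fun=> b) a.
Proof.
exists (fun n => if n is 0%N then b else 0), 1; split => //.
  exists (normc b) => -[|n]; rewrite expr1n mulr1// normc0 normc_ge0//.
move=> h _; apply: climit_shift.
rewrite (_ : (fun n => _) = (fun=> b)); first exact: climit_cst.
apply/funext => n; rewrite /psum big_ord_recl expr0 mulr1 big1 ?addr0// => i _.
by rewrite mul0r.
Qed.

Lemma psum_shift c h n : psum c h n.+1 = c 0%N + h * psum (fun i => c i.+1) h n.
Proof.
rewrite /psum big_ord_recl expr0 mulr1; congr (_ + _); rewrite mulr_sumr.
by apply: eq_bigr => i _; rewrite /= exprS; ring.
Qed.

(** At the base point the Taylor coefficients are shifted by one; elsewhere
    the quotient rule applies. *)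
Lemma divided_difference (U : set R[i]) f z : U z -> (forall a, U a -> analytic_at f a) ->
  exists g, (forall a, U a -> analytic_at g a) /\
    forall w, f w - f z = (w - z) * g w.
Proof.
move=> Uz fa; have [c [s [s0 [M cM] fc]]] := fa _ Uz.
pose g w := if w == z then c 1%N else (f w - f z) / (w - z).
exists g; split; last first.
  move=> w; rewrite /g; case: eqP => [->|/eqP wz]; first by rewrite !subrr mul0r.
  by rewrite mulrC divfK// subr_eq0.
move=> a Ua; have [az|az] := eqVneq a z; last first.
  apply: (@analytic_at_div (fun w => f w - f z) g a (a - z) (-1)).
  - exact/analytic_at_subc/fa.
  - by rewrite subr_eq0.
  - move=> h; have -> : a - z - -1 * h = a + h - z by ring.
    by rewrite /g subr_eq0 => /negbTE ->.
have c0 : c 0%N = f z.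
  have h0 : normc 0 * s < 1 by rewrite normc0 mul0r.
  have := fc _ h0; rewrite addr0 => H.
  apply: (@climit_unique _ \oo _ _ _ _ _ H).
  apply: climit_shift; rewrite (_ : (fun n => _) = fun=> c 0%N); first exact: climit_cst.
  apply/funext => n; rewrite /psum big_ord_recl expr0 mulr1 big1 ?addr0// => i _.
  by rewrite expr0n/= mulr0.
rewrite az; exists (fun n => c n.+1), s; split => //.
  by exists (M * s) => n; rewrite -mulrA -exprS.
move=> h hs; rewrite /g; case: eqP => [zh|/eqP].
  have -> : h = 0 by apply: (addrI z); rewrite zh addr0.
  apply: climit_shift; rewrite (_ : (fun n => _) = fun=> c 1%N); first exact: climit_cst.
  apply/funext => n; rewrite /psum big_ord_recl expr0 mulr1 big1 ?addr0// => i _.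
  by rewrite expr0n/= mulr0.
move=> zh; have zhz : z + h - z = h by ring.
have h0 : h != 0 by rewrite -zhz subr_eq0.
have h1 : climit \oo (fun n => psum c h n.+1) (f (z + h)).
  by rewrite /climit (cvg_shiftS (fun n => normc (psum c h n - f (z + h)))); exact: fc.
pose proof (climitZ h^-1 (climitB h1 (climit_cst (F := \oo) (f z)))) as H2.
rewrite zhz [_ / h]mulrC; move: H2; rewrite /climit.
have -> // : (fun n => normc (h^-1 * (psum c h n.+1 - f z) - h^-1 * (f (z + h) - f z))) =
  (fun n => normc (psum (fun n => c n.+1) h n - h^-1 * (f (z + h) - f z))).
apply/funext => n; rewrite psum_shift c0 [f z + _]addrC addrK mulKf//.
Qed.

(** At the first index where the coefficients differ, the corresponding term
    dominates the tail near the origin. *)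
Lemma psum_unique c d s M F : 0 < s -> (forall n, normc (c n) <= M * s ^+ n) ->
  (forall n, normc (d n) <= M * s ^+ n) ->
  (forall h, normc h * s < 1 -> climit \oo (psum c h) (F h)) ->
  (forall h, normc h * s < 1 -> climit \oo (psum d h) (F h)) -> c =1 d.
Proof.
move=> s0 cM dM cF dF; have M0 := local_bound_ge0 cM.
pose e n := c n - d n.
have eM n : normc (e n) <= 2 * M * s ^+ n.
  by apply: le_trans (normcB_le _ _) _; have := cM n; have := dM n; lra.
have e0 h : normc h * s < 1 -> climit \oo (psum e h) 0.
  move=> hs; pose proof (climitB (cF _ hs) (dF _ hs)) as H; move: H; rewrite subrr /climit.
  have -> // : (fun n => normc (psum c h n - psum d h n - 0)) = (fun n => normc (psum e h n - 0)).
  by apply/funext => n; rewrite /psum -sumrB; under eq_bigr do rewrite -mulrBl.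
suff e_eq0 n : e n = 0 by move=> n; apply/eqP; rewrite -subr_eq0 -/(e n) e_eq0.
elim/ltn_ind: n => n IH; apply: normc_eq0; apply/ler_addgt0Pl => eps eps0; rewrite addr0.
pose C := 4 * M * s ^+ n.+1.
have C0 : 0 <= C by rewrite !mulr_ge0// exprn_ge0// ltW.
(* The first bound keeps the geometric ratio below [1 / 2]; the second makes
   the tail after the leading term at most [eps] times [t ^ n]. *)
pose t := Num.min (1 / (2 * s)) (eps / (C + 1)).
have t0 : 0 < t by rewrite lt_min !divr_gt0 ?mulr_gt0// ltr_wpDl.
have ts : t * s <= 1 / 2.
  apply: le_trans (_ : 1 / (2 * s) * s <= _); first by rewrite ler_wpM2r ?(ltW s0)// ge_min lexx.
  by apply: le_of_eq; field; lra.
have tn : normc t%:C = t by rewrite normc_real gtr0_norm.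
have q01 : 0 <= t * s < 1 by rewrite mulr_ge0 ?(ltW t0) ?(ltW s0)//=; lra.
have term i : normc (e i * t%:C ^+ i) <= 2 * M * (t * s) ^+ i.
  rewrite normcM normcX tn exprMn; have := ler_wpM2r (exprn_ge0 i (ltW t0)) (eM i).
  by move=> h; apply: le_trans h _; apply: le_of_eq; ring.
have := series_tail n.+1 q01 term (e0 t%:C _); rewrite tn => /(_ (proj2 (andP q01))).
rewrite big_ord_recr big1/= => [|i _]; last by rewrite IH ?mul0r.
rewrite !add0r normcNE normcM normcX tn => h1.
have h2 : 2 * M * (t * s) ^+ n.+1 / (1 - t * s) <= 4 * M * (t * s) ^+ n.+1.
  rewrite ler_pdivrMr; last by lra.
  have : 0 <= M * (t * s) ^+ n.+1 by rewrite mulr_ge0// exprn_ge0//; case/andP: q01.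
  nra.
have tn0 : 0 < t ^+ n by rewrite exprn_gt0.
rewrite -(ler_pM2r tn0); apply: le_trans h1 _; apply: le_trans h2 _.
have -> : 4 * M * (t * s) ^+ n.+1 = C * t * t ^+ n by rewrite /C exprMn [t ^+ n.+1]exprS; ring.
rewrite ler_pM2r//; apply: le_trans (_ : C * (eps / (C + 1)) <= _).
  by rewrite ler_wpM2l// /t ge_min lexx orbT.
by rewrite mulrCA ler_piMr ?(ltW eps0)// ler_pdivrMr ?mul1r; lra.
Qed.

End SeriesOperations.

(** * Polar coordinates *)

Section Polar.
Local Notation "z ^*" := (conjc z) : ring_scope.
Context {R : realType}.
Implicit Types (r t : R).

Lemma polarE r t : polar r t = r%:C * polar 1 t.
Proof. by rewrite /polar; simpc. Qed.

Lemma polarM r t r' t' : polar r t * polar r' t' = polar (r * r') (t + t').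
Proof. by rewrite /polar cosD sinD; simpc; congr (_ +i* _); ring. Qed.

Lemma normc_polar r t : normc (polar r t) = `|r|.
Proof. by rewrite /= !exprMn -mulrDr cos2Dsin2 mulr1 sqrtr_sqr. Qed.

Lemma polar_conj r t : (polar r t)^* = polar r (- t).
Proof. by rewrite /polar cosN sinN mulrN. Qed.

Lemma polarX r t n : polar r t ^+ n = polar (r ^+ n) (n%:R * t).
Proof.
elim: n => [|n IH]; first by rewrite !expr0 mul0r /polar cos0 sin0 mulr0 mulr1.
by rewrite exprS IH polarM -exprS -natr1 mulrDl mul1r addrC.
Qed.

Lemma polar0 t : polar 0 t = 0.
Proof. by rewrite /polar !mul0r. Qed.

Lemma polar_2pi r : polar r (2 * pi) = polar r 0.
Proof. by rewrite /polar mulr_natl cos2pi sin2pi cos0 sin0. Qed.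

Lemma sin_le_id t : 0 <= t -> `|sin t| <= t.
Proof.
move=> t0.
have [c _] := @MVT_segment R sin cos 0 t t0 (fun x _ => is_derive_sin x)
  (continuous_subspaceT (@continuous_sin R)).
by rewrite sin0 !subr0 => ->; rewrite normrM (ger0_norm t0) ler_piMl// cos_max.
Qed.

Lemma cosB1_le_id t : 0 <= t -> `|cos t - 1| <= t.
Proof.
move=> t0.
have [c _] := @MVT_segment R cos (fun x => - sin x) 0 t t0 (fun x _ => is_derive_cos x)
  (continuous_subspaceT (@continuous_cos R)).
by rewrite cos0 subr0 => ->; rewrite normrM normrN (ger0_norm t0) ler_piMl// sin_max.
Qed.

Lemma polarB1_le t : 0 <= t -> normc (polar 1 t - 1) <= 2 * t.
Proof.
move=> t0; apply: le_trans (normc_le_ReIm _) _.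
rewrite /polar/= !mul1r subr0; have := sin_le_id t0; have := cosB1_le_id t0; lra.
Qed.

Lemma polar_continuous (p : R * R) delta : 0 < delta ->
  \forall q \near p, normc (polar q.1 q.2 - polar p.1 p.2) <= delta.
Proof.
move=> d0; have d2 : 0 < delta / 2 by rewrite divr_gt0.
have cc : (fun q : R * R => q.1 * cos q.2) @ p --> p.1 * cos p.2.
  apply: cvgM; first exact: cvg_fst.
  by apply: continuous_cvg; [exact: continuous_cos|exact: cvg_snd].
have cs : (fun q : R * R => q.1 * sin q.2) @ p --> p.1 * sin p.2.
  apply: cvgM; first exact: cvg_fst.
  by apply: continuous_cvg; [exact: continuous_sin|exact: cvg_snd].
move/cvgrPdist_lt : cc => /(_ _ d2) Hc; move/cvgrPdist_lt : cs => /(_ _ d2) Hs.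
apply: filterS2 Hc Hs => q hc hs.
apply: le_trans (normc_le_ReIm _) _ => /=.
by rewrite distrC in hc; rewrite distrC in hs; lra.
Qed.

(** The local constants are valid near each point and for every larger
    constant, so compactness of the polar rectangle yields a common one. *)
Lemma uniform_regular (f : R[i] -> R[i]) r :
  (forall s t, 0 <= s <= r -> analytic_at f (polar s t)) ->
  exists K, 0 < K /\ forall s t, 0 <= s <= r -> 0 <= t <= 2 * pi ->
    regular_at f K (polar s t).
Proof.
move=> fa.
have cK : compact (`[0, r]%classic `*` `[0, 2 * pi]%classic : set (R * R)).
  exact: (compact_setX (@segment_compact R 0 r) (@segment_compact R 0 (2 * pi))).
move/compact_near_coveringP : cK => /(_ R (pinfty_nbhs R)
  (fun K p => regular_at f K (polar p.1 p.2)) _).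
case.
  move=> p [/= p1 _]; rewrite in_itv/= in p1.
  have [K0 [delta [d0 H]]] := local_series_regular (fa _ p.2 p1).
  exists ([set q | normc (polar q.1 q.2 - polar p.1 p.2) <= delta], [set K | K0 <= K]) => /=.
    by split; [exact: polar_continuous|by exists K0; split; [exact: num_real|move=> x /ltW]].
  by move=> [q K] [/= h1 h2]; exact: H.
move=> K0 [_ H]; exists (`|K0| + 1); split; first by rewrite ltr_wpDl.
move=> s t sr t2; apply: (H (`|K0| + 1) _ (s, t)) => /=.
  by apply: le_lt_trans (ler_norm _) _; rewrite ltrDl.
by split => /=; rewrite in_itv.
Qed.

End Polar.

(** * Means over equidistant points of a circle *)

Section CircleMean.
Local Notation "z ^*" := (conjc z) : ring_scope.
Context {R : realType}.
Implicit Types (f F G : R[i] -> R[i]) (r s t : R) (z w a : R[i]).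

Definition node r N j : R[i] := polar r (j%:R * (2 * pi / N%:R)).

Definition circle_mean N r F : R[i] := N%:R^-1 * \sum_(j < N) F (node r N j).

Lemma normc_natV (N : nat) : normc (N%:R^-1 : R[i]) = N%:R^-1.
Proof.
by rewrite normcV -(rmorph_nat (real_complex R)) normc_real ger0_norm.
Qed.

Lemma normc_node r N j : 0 <= r -> normc (node r N j) = r.
Proof. by move=> r0; rewrite normc_polar ger0_norm. Qed.

Lemma circle_meanD N r F G : circle_mean N r (fun z => F z + G z) = circle_mean N r F + circle_mean N r G.
Proof. by rewrite /circle_mean big_split/= mulrDr. Qed.

Lemma circle_meanB N r F G : circle_mean N r (fun z => F z - G z) = circle_mean N r F - circle_mean N r G.
Proof. by rewrite /circle_mean sumrB mulrBr. Qed.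

Lemma circle_meanZ N r a F : circle_mean N r (fun z => a * F z) = a * circle_mean N r F.
Proof. by rewrite /circle_mean -mulr_sumr mulrCA. Qed.

Lemma circle_mean_cst N r a : (0 < N)%N -> circle_mean N r (fun=> a) = a.
Proof.
move=> N0; rewrite /circle_mean sumr_const card_ord -[a *+ N]mulr_natl mulKf//.
by rewrite pnatr_eq0 -lt0n.
Qed.

Lemma circle_mean_conj N r F : circle_mean N r (fun z => (F z)^*) = (circle_mean N r F)^*.
Proof. by rewrite /circle_mean rmorphM rmorph_sum fmorphV rmorph_nat. Qed.

Lemma eq_circle_mean N r F G : 0 <= r -> (forall z, normc z = r -> F z = G z) ->
  circle_mean N r F = circle_mean N r G.
Proof.
by move=> r0 FG; congr (_ * _); apply: eq_bigr => j _; rewrite FG// normc_node.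
Qed.

Lemma circle_mean_le N r F M : 0 <= r -> 0 <= M -> (forall j, (j < N)%N -> normc (F (node r N j)) <= M) ->
  normc (circle_mean N r F) <= M.
Proof.
move=> r0 M0 FM; rewrite normcM normc_natV.
case: N FM => [|N] FM; first by rewrite invr0 mul0r.
rewrite mulrC ler_pdivrMr ?ltr0n//; apply: le_trans (normc_sum_le _ _ _) _.
apply: (@le_trans _ _ (\sum_(j < N.+1) M)); first by apply: ler_sum => j _; exact: FM.
by rewrite sumr_const card_ord mulr_natr.
Qed.

Lemma node_scale r N j b : node (b * r) N j = b%:C * node r N j.
Proof. by rewrite /node (polarE (b * r)) (polarE r) rmorphM [RHS]mulrA. Qed.

Lemma nodeS r N j : node r N j.+1 = polar 1 (2 * pi / N%:R) * node r N j.
Proof. by rewrite /node polarM mul1r -natr1 mulrDl mul1r addrC. Qed.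

Lemma node_cycle r N : (0 < N)%N -> node r N N = node r N 0.
Proof.
move=> N0; rewrite /node mul0r mulrC divfK ?polar_2pi// pnatr_eq0 -lt0n//.
Qed.

Lemma node_angle N j : (j < N)%N -> 0 <= (j%:R * (2 * pi / N%:R) : R) <= 2 * pi.
Proof.
move=> jN; have N0 : 0 < N%:R :> R by rewrite ltr0n (leq_ltn_trans _ jN).
have p0 : 0 <= 2 * pi :> R by rewrite mulr_ge0// pi_ge0.
apply/andP; split; first by rewrite mulr_ge0// divr_ge0// ltW.
by rewrite mulrA ler_pdivrMr// mulrC ler_wpM2l// ler_nat ltnW.
Qed.

(** A discrete form of the Cauchy-Riemann equation. With [om] the [N]-th root of
    unity, the radial step [al * z] and the step [(om - 1) * z] to the next node
    have nearly equal secant slopes, so [(om - 1)] times a radial increment is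
    nearly [al] times an increment along the circle; the latter telescope to
    zero around the circle. *)
Lemma circle_mean_step N F K s al : (2 < N)%N -> 0 < s -> 0 <= al -> 0 < K ->
  (forall t, 0 <= t <= 2 * pi -> regular_at F K (polar s t)) ->
  al * s <= K^-1 -> s * normc (polar 1 (2 * pi / N%:R) - 1) <= K^-1 ->
  normc (circle_mean N ((1 + al) * s) F - circle_mean N s F) <=
  K * (al * s) * (al * s + s * normc (polar 1 (2 * pi / N%:R) - 1)).
Proof.
move=> N2 s0 al0 K0 reg als; set om := polar 1 _; set d := normc (om - 1) => ds.
have N0 : 0 < N%:R :> R by rewrite ltr0n; lia.
have d0 : 0 < d.
  apply: lt_le_trans (Im_le_normc _); rewrite /om /polar/= mul1r subr0.
  rewrite normr_gt0 gt_eqF// sin_gt0_pi// divr_gt0 ?mulr_gt0 ?pi_gt0//=.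
  rewrite ltr_pdivrMr// mulrC ltr_pM2l ?pi_gt0//.
  by rewrite ltr_nat.
pose D j := F (node s N j + al%:C * node s N j) - F (node s N j).
pose T j := F (node s N j.+1) - F (node s N j).
have T0 : \sum_(j < N) T j = 0.
  rewrite -(big_mkord xpredT T) telescope_sumr; last by lia.
  by rewrite node_cycle ?subrr//; lia.
have main j : (j < N)%N -> normc ((om - 1) * D j - al%:C * T j) <=
    K * (al * s * d * (al * s + s * d)).
  move=> jN; have [_ H] := reg _ (node_angle jN).
  have zs : normc (node s N j) = s by rewrite normc_node// ltW.
  have nh : normc (al%:C * node s N j) = al * s by rewrite normcM normc_real ger0_norm// zs.
  have nk : normc ((om - 1) * node s N j) = s * d by rewrite normcM zs mulrC.
  have := H (al%:C * node s N j) ((om - 1) * node s N j).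
  rewrite nh nk => /(_ als ds)[_].
  rewrite -/(node s N j) (_ : node s N j + (om - 1) * node s N j = node s N j.+1); last first.
    by rewrite nodeS -/om; ring.
  rewrite -/(D j) -/(T j) (_ : (om - 1) * node s N j * D j - al%:C * node s N j * T j =
    node s N j * ((om - 1) * D j - al%:C * T j)); last by ring.
  have -> : K * (al * s * (s * d) * (al * s + s * d)) = s * (K * (al * s * d * (al * s + s * d))).
    by clear; move: d => d; ring.
  rewrite normcM zs.
  by rewrite ler_pM2l.
have -> : circle_mean N ((1 + al) * s) F - circle_mean N s F = N%:R^-1 * \sum_(j < N) D j.
  rewrite -mulrBr -sumrB; congr (_ * _); apply: eq_bigr => j _; rewrite /D node_scale.
  by rewrite rmorphD rmorph1 mulrDl mul1r.
rewrite normcM normc_natV mulrC ler_pdivrMr//.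
rewrite -(ler_pM2l d0) -normcM mulr_sumr.
have -> : \sum_(j < N) (om - 1) * D j = \sum_(j < N) ((om - 1) * D j - al%:C * T j).
  by rewrite sumrB [X in _ = _ - X](_ : _ = 0) ?subr0// -mulr_sumr T0 mulr0.
apply: le_trans (normc_sum_le _ _ _) _.
apply: (@le_trans _ _ (\sum_(j < N) K * (al * s * d * (al * s + s * d)))).
  by apply: ler_sum => j _; exact: main.
rewrite sumr_const card_ord -[_ *+ N]mulr_natl; apply: le_of_eq; ring.
Qed.

(** The radius grows from [0] to [r] in [N] steps of length [r / N], each
    changing the mean by [O(1 / N ^ 2)], except the first: the circle
    degenerates at the centre, and the Lipschitz bound gives [O(1 / N)]. *)
Lemma circle_mean_cvg F r : 0 <= r ->
  (forall s t, 0 <= s <= r -> analytic_at F (polar s t)) ->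
  climit \oo (fun N => circle_mean N r F) (F 0).
Proof.
move=> r0 Fa; have [K [K0 reg]] := uniform_regular Fa.
have K10 : 0 < K^-1 by rewrite invr_gt0.
pose C : R := 4 * pi.
have C0 : 0 < C by rewrite mulr_gt0// pi_gt0.
pose E := K * (r + r * (r + r * C)).
apply: (@climit_near _ \oo _ _ _ (fun N => E / N%:R)); last first.
  by have := @cvg_harmonicM R E; rewrite -(cvg_shiftS (fun N => E / N%:R)).
near=> N.
have N2 : (2 < N)%N by near: N; exact: nbhs_infty_gt.
have Nn : (0 < N)%N by exact: ltn_trans N2.
have N0 : 0 < N%:R :> R by rewrite ltr0n.
have NK : K * (r + r * C) <= N%:R by near: N; exact: nbhs_infty_ger.
pose eta := r / N%:R.
have eta0 : 0 <= eta by rewrite divr_ge0// ltW.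
have om : normc (polar 1 (2 * pi / N%:R) - 1 : R[i]) <= C / N%:R.
  apply: le_trans (polarB1_le _) _; first by rewrite divr_ge0 ?mulr_ge0 ?pi_ge0// ltW.
  by rewrite /C; apply: le_of_eq; move: pi => p; field; lra.
have etaC : eta + r * (C / N%:R) <= K^-1.
  by rewrite /eta mulrA -mulrDl ler_pdivrMr// -(ler_pM2l K0) mulVKf ?gt_eqF//.
have rC0 : 0 <= r * (C / N%:R) by rewrite mulr_ge0// divr_ge0// ltW.
have etaN : N%:R * eta = r by rewrite /eta mulrC divfK// gt_eqF.
suff H m : (m <= N)%N -> normc (circle_mean N (m%:R * eta) F - F 0) <=
    K * eta + m%:R * (K * eta * (eta + r * (C / N%:R))).
  have := H N (leqnn N); rewrite etaN => h.
  apply: le_trans h _.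
  rewrite /E; apply: le_of_eq; rewrite /eta; field; lra.
have b0 : 0 <= K * eta * (eta + r * (C / N%:R)).
  by rewrite !mulr_ge0 ?addr_ge0// ltW.
elim: m => [_|m IH mN].
  have E0 : circle_mean N 0 F = F 0.
    rewrite (@eq_circle_mean N 0 F (fun=> F 0)) ?circle_mean_cst//.
    by move=> z /eq0_normc ->.
  by rewrite !mul0r addr0 E0 subrr normc0 mulr_ge0// ltW.
case: m IH mN => [_ _|m IH mN].
  rewrite mul1r; apply: le_trans (_ : K * eta <= _); last by rewrite lerDl mul1r.
  have FE : F 0 = circle_mean N eta (fun=> F 0) by rewrite circle_mean_cst.
  rewrite [X in _ - X]FE -circle_meanB; apply: circle_mean_le => //; first by rewrite mulr_ge0// ltW.
  move=> j _.
  have r00 : 0 <= (0 : R) <= r by rewrite lexx.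
  have p00 : 0 <= (0 : R) <= 2 * pi by rewrite lexx mulr_ge0// pi_ge0.
  have [_ H] := reg 0 0 r00 p00.
  have eK : eta <= K^-1 by lra.
  have [] := H (node eta N j) 0.
  - by rewrite normc_node.
  - by rewrite normc0 ltW.
  by rewrite polar0 add0r normc_node.
have IHm := IH (ltnW mN).
pose s := m.+1%:R * eta.
have s_gt0 : 0 < eta -> 0 < s by move=> e0; rewrite mulr_gt0.
have [e0|e0] := eqVneq eta 0.
  by move: IHm; rewrite e0 !mulr0 !mul0r !mulr0.
have {}e0 : 0 < eta by rewrite lt_neqAle eq_sym e0.
have sr : s <= r by rewrite -etaN ler_wpM2r// ler_nat ltnW.
have al0 : 0 <= m.+1%:R^-1 :> R by rewrite invr_ge0.
have als : m.+1%:R^-1 * s = eta by rewrite mulKf// pnatr_eq0.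
have sE : m.+2%:R * eta = (1 + m.+1%:R^-1) * s.
  by rewrite [RHS]mulrDl mul1r als /s -[m.+2%:R]natr1 mulrDl mul1r.
have sd : s * normc (polar 1 (2 * pi / N%:R) - 1) <= r * (C / N%:R).
  by apply: ler_pM => //; [rewrite ltW// s_gt0|exact: normc_ge0].
have step := @circle_mean_step N F K s m.+1%:R^-1 N2 (s_gt0 e0) al0 K0 _ _ _.
rewrite als -sE in step.
have {}step : normc (circle_mean N (m.+2%:R * eta) F - circle_mean N s F) <=
    K * eta * (eta + s * normc (polar 1 (2 * pi / N%:R) - 1)).
  apply: step; [|lra|lra].
  by move=> t t2; apply: reg => //; rewrite ltW ?s_gt0.
have -> : circle_mean N (m.+2%:R * eta) F - F 0 =
    (circle_mean N (m.+2%:R * eta) F - circle_mean N s F) + (circle_mean N s F - F 0) by ring.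
apply: le_trans (normcD_le _ _) _.
have h : K * eta * (eta + s * normc (polar 1 (2 * pi / N%:R) - 1)) <=
    K * eta * (eta + r * (C / N%:R)).
  by rewrite ler_wpM2l ?lerD2l// mulr_ge0// ltW.
have m2 : m.+2%:R = m.+1%:R + 1 :> R by rewrite natr1.
rewrite -/s in IHm; set X := K * eta * (eta + r * _) in h IHm *.
have -> : m.+2%:R * X = m.+1%:R * X + X by rewrite m2 mulrDl mul1r.
lra.
Unshelve. all: by end_near.
Qed.

End CircleMean.

(** * Cauchy formula and Taylor series on the disc *)

Section DiscTaylor.
Local Notation "z ^*" := (conjc z) : ring_scope.
Context {R : realType}.
Implicit Types (f F G : R[i] -> R[i]) (r s t : R) (z w a : R[i]).

Lemma ultra_climit (U : set_system nat) (u : nat -> R[i]) M :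
  UltraFilter U -> (forall n, normc (u n) <= M) -> exists l, climit U u l.
Proof.
move=> uU uM; have pU : ProperFilter U := @ultra_proper _ _ uU.
have [a ha] : exists a : R, (fun n => complex.Re (u n)) @ U --> a.
  apply: (@bounded_ultra_cvg _ _ _ (- M) M) => n.
  by rewrite -ler_norml (le_trans (Re_le_normc _)).
have [b hb] : exists b : R, (fun n => complex.Im (u n)) @ U --> b.
  apply: (@bounded_ultra_cvg _ _ _ (- M) M) => n.
  by rewrite -ler_norml (le_trans (Im_le_normc _)).
exists (a +i* b); apply: (climit_le (e := fun n => `|complex.Re (u n) - a| + `|complex.Im (u n) - b|)).
  by move=> n; apply: le_trans (normc_le_ReIm _) _; case: (u n).
have e1 : (fun n => `|complex.Re (u n) - a|) @ U --> (0 : R).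
  by rewrite -(normr0 R) -(subrr a); apply: (@cvg_norm _ R^o); apply: cvgB => //; exact: cvg_cst.
have e2 : (fun n => `|complex.Im (u n) - b|) @ U --> (0 : R).
  by rewrite -(normr0 R) -(subrr b); apply: (@cvg_norm _ R^o); apply: cvgB => //; exact: cvg_cst.
by rewrite -(addr0 (0 : R)); apply: cvgD.
Qed.

Lemma circle_mean_sum N r (K : nat) (F : nat -> R[i] -> R[i]) :
  circle_mean N r (fun z => \sum_(k < K) F k z) = \sum_(k < K) circle_mean N r (F k).
Proof. by rewrite /circle_mean exchange_big/= mulr_sumr. Qed.

Lemma neq_of_normc z w : normc z < normc w -> w - z != 0.
Proof. by move=> zw; rewrite subr_eq0; apply: contraTneq zw => ->; rewrite ltxx. Qed.

(** The kernel [w / (w - z)] has a pole inside the circle, but on the circle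
    it is the conjugate of [r ^ 2 / (r ^ 2 - z^* * w)], which is analytic on
    the closed disc and equals [1] at the centre. *)
Lemma cauchy_kernel_mean r z : normc z < r ->
  climit \oo (fun N => circle_mean N r (fun w => w / (w - z))) 1.
Proof.
move=> zr; have r0 : 0 < r by apply: le_lt_trans zr; exact: normc_ge0.
pose Q (w : R[i]) : R[i] := ((r ^+ 2)%:C : R[i]) / (((r ^+ 2)%:C : R[i]) - z^* * w).
have nr2 : normc ((r ^+ 2)%:C : R[i]) = r ^+ 2 by rewrite normc_real ger0_norm// exprn_ge0// ltW.
have den a : normc a <= r -> (r ^+ 2)%:C - z^* * a != 0.
  move=> ar; apply: neq_of_normc; rewrite nr2 normcM normc_conj expr2.
  have := normc_ge0 a; have := normc_ge0 z; nra.
have r2 : (r ^+ 2)%:C != 0 :> R[i] by have := den 0; rewrite mulr0 subr0 normc0; apply; exact: ltW.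
have QE w : normc w = r -> w / (w - z) = (Q w)^*.
  move=> wr; have ww : w * w^* = (r ^+ 2)%:C.
    by rewrite -wr; case: (w) => a b /=; simpc; rewrite sqr_sqrtr ?addr_ge0 ?sqr_ge0//;
      congr (_ +i* _); ring.
  have w0 : w^* != 0.
    by rewrite conjc_eq0; apply: contra_eq_neq wr => ->; rewrite normc0 lt_eqF.
  have wz : w - z != 0 by apply: neq_of_normc; rewrite wr.
  have QJ : (Q w)^* = (r ^+ 2)%:C / ((r ^+ 2)%:C - z * w^*).
    have aJ : ((r ^+ 2)%:C : R[i])^* = (r ^+ 2)%:C by rewrite conjc_real.
    rewrite /Q; set b : R[i] := (r ^+ 2)%:C in aJ *.
    by rewrite conjcM conjcV conjcB conjcM aJ conjcK.
  rewrite QJ -ww.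
  have -> : w * w^* - z * w^* = (w - z) * w^* by ring.
  by field; rewrite w0 wz.
have H : climit \oo (fun N => circle_mean N r Q) (Q 0).
  apply: circle_mean_cvg; first exact: ltW.
  move=> s t /andP[s0 sr].
  apply: (@analytic_at_div _ (fun=> (r ^+ 2)%:C) Q _ ((r ^+ 2)%:C - z^* * polar s t) z^*).
  - exact: analytic_at_cst.
  - by apply: den; rewrite normc_polar ger0_norm.
  - by move=> h _; rewrite /Q; congr (_ / _); ring.
have := climit_conj H; rewrite /Q mulr0 subr0 divff// conjc1.
rewrite (_ : (fun n => _) = fun N => circle_mean N r (fun w => w / (w - z)))//.
apply/funext => N; rewrite -circle_mean_conj; apply: eq_circle_mean; first exact: ltW.
by move=> w wr; rewrite QE.
Qed.

(** With [g] the divided difference of [f] at [z],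
    [f w * w / (w - z) = (f w - f z) + z * g w + f z * w / (w - z)]. The means
    tend to [f 0 - f z + z * g 0 + f z], which is [f z] since
    [f 0 - f z = - z * g 0]. *)
Lemma cauchy_formula f r z : r < 1 -> normc z < r -> analytic_on_disc f ->
  climit \oo (fun N => circle_mean N r (fun w => f w * (w / (w - z)))) (f z).
Proof.
move=> r1 zr fa; have r0 : 0 <= r by apply: le_trans (ltW zr); exact: normc_ge0.
have fa' a : [set a | normc a < 1] a -> analytic_at f a.
  by move=> /= a1; apply: analytic_at_on_disc => //; apply/unit_discE.
have z1 : [set a : R[i] | normc a < 1] z by rewrite /=; exact: lt_trans r1.
have [g [ga fg]] := divided_difference z1 fa'.
have in_disc s t : 0 <= s <= r -> normc (polar s t) < 1.
  by move=> /andP[s0 sr]; rewrite normc_polar ger0_norm// (le_lt_trans sr).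
have H1 := circle_mean_cvg r0 (fun s t sr => fa' _ (in_disc s t sr)).
have H2 := circle_mean_cvg r0 (fun s t sr => ga _ (in_disc s t sr)).
have H3 := cauchy_kernel_mean zr.
pose proof (climitD (climitD (climitB H1 (climit_cst (F := \oo) (f z))) (climitZ z H2)) (climitZ (f z) H3)) as H.
have E : f 0 - f z + z * g 0 + f z * 1 = f z by rewrite fg; ring.
rewrite E in H; move: H; rewrite /climit.
apply: cvg_trans; apply: near_eq_cvg; near=> N.
have N0 : (0 < N)%N by near: N; exact: nbhs_infty_gt.
congr normc; congr (_ - _).
rewrite -{1}(circle_mean_cst r (f z) N0) -circle_meanB -!circle_meanZ -!circle_meanD.
apply: eq_circle_mean => // w wr.
have wz : w - z != 0 by apply: neq_of_normc; rewrite wr.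
have -> : f w = f z + (w - z) * g w by rewrite -fg; ring.
by field.
Unshelve. all: by end_near. Qed.

(** The coefficients are limits of the means of [f w / w ^ k]; as these are
    bounded, an ultrafilter provides the limits. The remainder of the
    geometric expansion of the Cauchy kernel contributes the factor
    [(z / w) ^ n]. *)
Lemma cauchy_coefficients f r : 0 < r < 1 -> analytic_on_disc f ->
  exists (c : nat -> R[i]) M, 0 <= M /\ (forall k, normc (c k) <= M * r^-1 ^+ k) /\
    forall z, normc z < r -> climit \oo (psum c z) (f z).
Proof.
move=> /andP[r0 r1] fa.
have [K [K0 reg]] : exists K, 0 < K /\ forall s t, 0 <= s <= r -> 0 <= t <= 2 * pi ->
    regular_at f K (polar s t).
  apply: uniform_regular => s t /andP[s0 sr]; apply: analytic_at_on_disc => //; apply/unit_discE.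
  by rewrite normc_polar ger0_norm// (le_lt_trans sr).
have fK N j : (j < N)%N -> normc (f (node r N j)) <= K.
  by move=> jN; have [] := reg r _ _ (node_angle jN); rewrite ?lexx ?(ltW r0).
have nr N j : normc (node r N j) = r by rewrite normc_node// ltW.
pose m k N := circle_mean N r (fun w => f w * w^-1 ^+ k).
have mK k N : normc (m k N) <= K * r^-1 ^+ k.
  apply: circle_mean_le; rewrite ?(ltW r0)//.
    by rewrite mulr_ge0 ?exprn_ge0 ?invr_ge0 ?(ltW r0) ?(ltW K0).
  move=> j jN; rewrite normcM normcX normcV nr ler_wpM2r ?fK// exprn_ge0 ?invr_ge0 ?ltW//.
have [U [uU sU]] := @ultraFilterLemma nat \oo _.
have pU : ProperFilter U := @ultra_proper _ _ uU.
have /choice[c cE] k : exists l, climit U (m k) l by exact: (ultra_climit uU (mK k)).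
exists c, K; split; [exact: ltW|split].
  by move=> k; apply: (climit_norm_le0 (cE k)).
move=> z zr.
have q01 : 0 <= normc z / r < 1.
  by rewrite divr_ge0 ?normc_ge0 ?(ltW r0)//= ltr_pdivrMr// mul1r.
apply: (climit_le (e := fun n => (K * (r / (r - normc z))) * (normc z / r) ^+ n)); last exact: cvg_exprM0.
move=> n; rewrite normc_distC.
have H1 : climit U (fun N => circle_mean N r (fun w => f w * (w / (w - z)))) (f z).
  by move=> A HA; apply: sU; exact: (cauchy_formula r1 zr fa HA).
pose proof (climitB H1 (climit_sum n (fun k => climitZ (z ^+ k) (cE k)))) as H.
rewrite (_ : psum c z n = \sum_(k < n) z ^+ k * c k); last by apply: eq_bigr => i _; rewrite mulrC.
apply: (climit_norm_le0 H) => N.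
have -> : circle_mean N r (fun w => f w * (w / (w - z))) - \sum_(k < n) z ^+ k * m k N =
    circle_mean N r (fun w => f w * (w / (w - z)) * (z / w) ^+ n).
  have -> : \sum_(k < n) z ^+ k * m k N =
      circle_mean N r (fun w => \sum_(k < n) z ^+ k * (f w * w^-1 ^+ k)).
    rewrite (circle_mean_sum N r n (fun k w => z ^+ k * (f w * w^-1 ^+ k))).
    by apply: eq_bigr => k _; rewrite circle_meanZ.
  rewrite -circle_meanB; apply: eq_circle_mean; first exact: ltW.
  move=> w wr; have wz : w - z != 0 by apply: neq_of_normc; rewrite wr.
  have w0 : w != 0 by apply: contra_eq_neq wr => ->; rewrite normc0 lt_eqF.
  elim: n {H} => [|n IH]; first by rewrite big_ord0 subr0 expr0 mulr1.
  rewrite big_ord_recr/= opprD addrA IH !exprMn !exprS.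
  have -> : w^-1 ^+ n = (w ^+ n)^-1 by rewrite exprVn.
  by field; apply/and3P; split => //; exact: expf_neq0.
have rz : 0 < r - normc z by rewrite subr_gt0.
have A0 : 0 <= r / (r - normc z) := divr_ge0 (ltW r0) (ltW rz).
have Q0 : 0 <= (normc z / r) ^+ n by apply: exprn_ge0; case/andP: q01.
apply: circle_mean_le; [exact: ltW|exact: mulr_ge0 (mulr_ge0 (ltW K0) A0) Q0|].
move=> j jN; set w := node r N j.
have wr : normc w = r by exact: nr.
have wz : r - normc z <= normc (w - z).
  by rewrite lerBlDr -wr -{1}[w](subrK z) normcD_le.
have wz0 : 0 < normc (w - z) by exact: lt_le_trans wz.
rewrite !normcM normcX !normcM !normcV wr; apply: ler_wpM2r => //.
apply: ler_pM; rewrite ?normc_ge0 ?fK ?divr_ge0 ?(ltW r0) ?(ltW wz0)//.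
by rewrite ler_wpM2l ?(ltW r0)// lef_pV2.
Qed.

(** Each radius below [1] has its own coefficients, but near the origin all the
    series sum to [f], so they agree with the local expansion there. *)
Theorem disc_taylor f : analytic_on_disc f ->
  exists c : nat -> R[i],
    (forall r, 0 < r < 1 -> exists M, 0 <= M /\ forall k, normc (c k) <= M * r^-1 ^+ k) /\
    forall z, normc z < 1 -> climit \oo (psum c z) (f z).
Proof.
move=> fa; have [c [s [s0 [M1 cM1] fc]]] : analytic_at f 0.
  by apply: analytic_at_on_disc => //; apply/unit_discE; rewrite normc0.
have main r : 0 < r < 1 -> exists M, 0 <= M /\ (forall k, normc (c k) <= M * r^-1 ^+ k) /\
    forall z, normc z < r -> climit \oo (psum c z) (f z).
  move=> r01; have [d [M [M0 [dM dF]]]] := cauchy_coefficients r01 fa.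
  have /andP[r0 r1] := r01.
  suff cd : c =1 d by exists M; split => //; rewrite (funext cd).
  have ri : 0 <= r^-1 by rewrite invr_ge0 ltW.
  have M10 := local_bound_ge0 cM1.
  apply: (@psum_unique _ c d (s + r^-1) (M1 + M) f).
  - by rewrite ltr_wpDr.
  - move=> n; apply: le_trans (cM1 n) _; apply: ler_pM; rewrite ?exprn_ge0 ?(ltW s0)//.
      by rewrite lerDl.
    by rewrite lerXn2r ?nnegrE ?addr_ge0 ?(ltW s0)// lerDl.
  - move=> n; apply: le_trans (dM n) _; apply: ler_pM; rewrite ?exprn_ge0//.
      by rewrite lerDr.
    by rewrite lerXn2r ?nnegrE ?addr_ge0 ?(ltW s0)// lerDr ltW.
  - move=> h hs; rewrite -[h in f h]add0r; apply: fc; apply: le_lt_trans hs.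
    by rewrite ler_wpM2l ?normc_ge0// lerDl.
  - move=> h hs; apply: dF; rewrite -[ltRHS]mul1r -ltr_pdivrMr//; apply: le_lt_trans hs.
    by rewrite ler_wpM2l ?normc_ge0// lerDr ltW.
exists c; split; first by move=> r /main[M [M0 [cM _]]]; exists M.
move=> z z1; have [|M [_ [_ H]]] := main ((1 + normc z) / 2).
  by have := normc_ge0 z => z0; apply/andP; lra.
by apply: H; lra.
Qed.

End DiscTaylor.

(** * Integrals of complex-valued functions *)

Section ComplexIntegral.
Local Notation "z ^*" := (conjc z) : ring_scope.
Context {R : realType} {d : measure_display} {T : measurableType d}.
Implicit Types (D : set T) (h k : T -> R[i]) (a : R[i]).

Lemma ReD (x y : R[i]) : complex.Re (x + y) = complex.Re x + complex.Re y.
Proof. by case: x y => ? ? []. Qed.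

Lemma ImD (x y : R[i]) : complex.Im (x + y) = complex.Im x + complex.Im y.
Proof. by case: x y => ? ? []. Qed.

Lemma ReM (x y : R[i]) :
  complex.Re (x * y) = complex.Re x * complex.Re y - complex.Im x * complex.Im y.
Proof. by case: x y => ? ? []. Qed.

Lemma ImM (x y : R[i]) :
  complex.Im (x * y) = complex.Re x * complex.Im y + complex.Im x * complex.Re y.
Proof. by case: x y => ? ? []. Qed.

Definition cmeasurable D h : Prop :=
  measurable_fun D (fun x => complex.Re (h x)) /\ measurable_fun D (fun x => complex.Im (h x)).

Lemma cmeasurable_cst D a : cmeasurable D (fun=> a).
Proof. by split; exact: measurable_cst. Qed.

Lemma cmeasurable_real D (g : T -> R) : measurable_fun D g -> cmeasurable D (fun x => (g x)%:C).
Proof. by move=> mg; split => //=; exact: measurable_cst. Qed.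

Lemma cmeasurableD D h k : cmeasurable D h -> cmeasurable D k -> cmeasurable D (fun x => h x + k x).
Proof.
move=> [h1 h2] [k1 k2]; split.
  by under eq_fun do rewrite ReD; exact: measurable_funD.
by under eq_fun do rewrite ImD; exact: measurable_funD.
Qed.

Lemma cmeasurableM D h k : cmeasurable D h -> cmeasurable D k -> cmeasurable D (fun x => h x * k x).
Proof.
move=> [h1 h2] [k1 k2]; split.
  by under eq_fun do rewrite ReM; apply: measurable_funB; exact: measurable_funM.
by under eq_fun do rewrite ImM; apply: measurable_funD; exact: measurable_funM.
Qed.

Lemma cmeasurableB D h k : cmeasurable D h -> cmeasurable D k -> cmeasurable D (fun x => h x - k x).
Proof.
move=> mh mk; under eq_fun do rewrite -[_ - _]/(_ + _) -mulN1r.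
by apply: cmeasurableD => //; apply: cmeasurableM => //; exact: cmeasurable_cst.
Qed.

Lemma cmeasurableX D h n : cmeasurable D h -> cmeasurable D (fun x => h x ^+ n).
Proof.
move=> mh; elim: n => [|n IH]; first exact: cmeasurable_cst.
by under eq_fun do rewrite exprS; exact: cmeasurableM.
Qed.

Lemma cmeasurable_conj D h : cmeasurable D h -> cmeasurable D (fun x => (h x)^*).
Proof.
move=> [h1 h2]; split.
  by rewrite (_ : (fun x => _) = fun x => complex.Re (h x))//; apply/funext => x; case: (h x).
rewrite (_ : (fun x => _) = fun x => - complex.Im (h x)); last by apply/funext => x; case: (h x).
exact: measurableT_comp.
Qed.

Lemma cmeasurable_sum D (N : nat) (h : nat -> T -> R[i]) : (forall n, cmeasurable D (h n)) ->
  cmeasurable D (fun x => \sum_(n < N) h n x).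
Proof.
move=> mh; elim: N => [|N IH].
  by under eq_fun do rewrite big_ord0; exact: cmeasurable_cst.
by under eq_fun do rewrite big_ord_recr/=; exact: cmeasurableD.
Qed.

Lemma climit_ReIm (u : nat -> R[i]) l : climit \oo u l ->
  (fun n => complex.Re (u n)) @ \oo --> complex.Re l /\ (fun n => complex.Im (u n)) @ \oo --> complex.Im l.
Proof.
move=> ul; split; apply/cvgrPdist_lt => e e0.
  move: ul; rewrite /climit => /cvgrPdist_lt/(_ _ e0); apply: filterS => n.
  rewrite sub0r normrN ger0_norm ?normc_ge0// distrC; apply: le_lt_trans.
  by have := Re_le_normc (u n - l); case: (u n) (l) => ? ? [].
move: ul; rewrite /climit => /cvgrPdist_lt/(_ _ e0); apply: filterS => n.
rewrite sub0r normrN ger0_norm ?normc_ge0// distrC; apply: le_lt_trans.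
by have := Im_le_normc (u n - l); case: (u n) (l) => ? ? [].
Qed.

Lemma cmeasurable_lim D (h : nat -> T -> R[i]) k : (forall n, cmeasurable D (h n)) ->
  (forall x, D x -> climit \oo (fun n => h n x) (k x)) -> cmeasurable D k.
Proof.
move=> mh hk; split.
  apply: (measurable_fun_cvg (h := fun n x => complex.Re (h n x))) => [n|x Dx].
    by have [] := mh n.
  by have [] := climit_ReIm (hk x Dx).
apply: (measurable_fun_cvg (h := fun n x => complex.Im (h n x))) => [n|x Dx].
  by have [] := mh n.
by have [] := climit_ReIm (hk x Dx).
Qed.

Lemma climit_geometric (w : R[i]) : normc w < 1 -> climit \oo (fun N => \sum_(n < N) w ^+ n) (1 - w)^-1.
Proof.
move=> w1; have w0 : 1 - w != 0.
  by rewrite subr_eq0; apply: contraTneq w1 => <-; rewrite normc1 ltxx.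
have wn : 0 <= normc w < 1 by rewrite normc_ge0.
apply: (climit_le (e := fun n => normc (1 - w)^-1 * normc w ^+ n)); last exact: cvg_exprM0.
move=> N; have -> : \sum_(n < N) w ^+ n - (1 - w)^-1 = - ((1 - w)^-1 * w ^+ N).
  elim: N => [|N IH]; first by rewrite big_ord0 sub0r expr0 mulr1.
  rewrite big_ord_recr/= addrAC IH exprS; field; exact: w0.
by rewrite normcNE normcM normcX.
Qed.

(** Measurability is inherited from the partial sums of the geometric
    series. *)
Lemma cmeasurable_inv1B D h : cmeasurable D h -> (forall x, D x -> normc (h x) < 1) ->
  cmeasurable D (fun x => (1 - h x)^-1).
Proof.
move=> mh h1; apply: (cmeasurable_lim (h := fun N x => \sum_(n < N) h x ^+ n)).
  by move=> N; apply: (cmeasurable_sum N (h := fun n x => h x ^+ n)) => n; exact: cmeasurableX.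
by move=> x Dx; apply: climit_geometric; exact: h1.
Qed.

Variables (mu : {measure set T -> \bar R}) (D : set T).
Hypothesis mD : measurable D.

Definition cintegrable h : Prop :=
  mu.-integrable D (EFin \o (fun x => complex.Re (h x))) /\
  mu.-integrable D (EFin \o (fun x => complex.Im (h x))).

Lemma cintegrable_dom h (g : T -> R) : cmeasurable D h -> mu.-integrable D (EFin \o g) ->
  (forall x, D x -> normc (h x) <= g x) -> cintegrable h.
Proof.
move=> [h1 h2] ig hg; split.
  apply: (@le_integrable _ _ _ mu D mD _ (EFin \o g) _ _ ig); first by apply/measurable_EFinP.
  move=> x Dx; rewrite /= lee_fin; apply: le_trans (Re_le_normc _) _.
  by apply: le_trans (hg x Dx) (ler_norm _).
apply: (@le_integrable _ _ _ mu D mD _ (EFin \o g) _ _ ig); first by apply/measurable_EFinP.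
move=> x Dx; rewrite /= lee_fin; apply: le_trans (Im_le_normc _) _.
by apply: le_trans (hg x Dx) (ler_norm _).
Qed.

Lemma cintegrableD h k : cintegrable h -> cintegrable k -> cintegrable (fun x => h x + k x).
Proof.
move=> [h1 h2] [k1 k2]; split.
  by under eq_fun do rewrite ReD; exact: (integrableD mD h1 k1).
by under eq_fun do rewrite ImD; exact: (integrableD mD h2 k2).
Qed.

Lemma cintegrableZ a h : cintegrable h -> cintegrable (fun x => a * h x).
Proof.
move=> [h1 h2]; split.
  by under eq_fun do rewrite ReM;
    exact: (integrableB mD (integrableZl mD _ h1) (integrableZl mD _ h2)).
by under eq_fun do rewrite ImM;
  exact: (integrableD mD (integrableZl mD _ h2) (integrableZl mD _ h1)).
Qed.

Lemma eq_complex_integral h k : (forall x, D x -> h x = k x) ->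
  complex_integral mu D h = complex_integral mu D k.
Proof.
by move=> hk; congr (_ +i* _); apply: eq_Rintegral => x; rewrite inE => Dx; rewrite hk.
Qed.

Lemma complex_integralD h k : cintegrable h -> cintegrable k ->
  complex_integral mu D (fun x => h x + k x) = complex_integral mu D h + complex_integral mu D k.
Proof.
move=> [h1 h2] [k1 k2]; rewrite /complex_integral; simpc; congr (_ +i* _).
  by rewrite -RintegralD//; apply: eq_Rintegral => x _; rewrite ReD.
by rewrite -RintegralD//; apply: eq_Rintegral => x _; rewrite ImD.
Qed.

Lemma complex_integralZ a h : cintegrable h ->
  complex_integral mu D (fun x => a * h x) = a * complex_integral mu D h.
Proof.
move=> [h1 h2]; case: a => p q; rewrite /complex_integral; simpc; congr (_ +i* _).
  rewrite -!RintegralZl// -RintegralB//; try exact: (integrableZl mD _ h1); try exact: (integrableZl mD _ h2).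
  by apply: eq_Rintegral => x _; rewrite ReM.
rewrite -!RintegralZl// -RintegralD//; try exact: (integrableZl mD _ h1); try exact: (integrableZl mD _ h2).
by apply: eq_Rintegral => x _; rewrite ImM.
Qed.

Lemma complex_integralB h k : cintegrable h -> cintegrable k ->
  complex_integral mu D (fun x => h x - k x) = complex_integral mu D h - complex_integral mu D k.
Proof.
move=> ih ik; rewrite -[X in _ - X]mul1r -mulNr -complex_integralZ// -complex_integralD//.
  by apply: eq_complex_integral => x _; rewrite mulN1r.
exact: cintegrableZ.
Qed.

Lemma complex_integral_sum (N : nat) (h : nat -> T -> R[i]) : (forall n, cintegrable (h n)) ->
  cintegrable (fun x => \sum_(n < N) h n x) /\
  complex_integral mu D (fun x => \sum_(n < N) h n x) = \sum_(n < N) complex_integral mu D (h n).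
Proof.
move=> ih; elim: N => [|N [IH1 IH2]].
  have e0 : (fun x => \sum_(n < 0) h n x) = fun=> 0 by apply/funext => x; rewrite big_ord0.
  rewrite e0 big_ord0; split; first by split; exact: integrable0.
  by rewrite /complex_integral /= !Rintegral_cst// !mul0r.
have eS : (fun x => \sum_(n < N.+1) h n x) = fun x => \sum_(n < N) h n x + h N x.
  by apply/funext => x; rewrite big_ord_recr.
rewrite eS big_ord_recr/= -IH2; split; first exact: cintegrableD.
exact: complex_integralD.
Qed.

Lemma complex_integral_real (g : T -> R) :
  complex_integral mu D (fun x => (g x)%:C) = (\int[mu]_(x in D) g x)%R%:C.
Proof. by rewrite /complex_integral/= Rintegral_cst// mul0r. Qed.

(** The factor [2] comes from bounding the real and imaginary parts
    separately; it is harmless, as the bound is only used to show that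
    integrals tend to zero. *)
Lemma complex_integral_le h (g : T -> R) : cintegrable h -> mu.-integrable D (EFin \o g) ->
  (forall x, D x -> normc (h x) <= g x) ->
  normc (complex_integral mu D h) <= 2 * (\int[mu]_(x in D) g x)%R.
Proof.
move=> [h1 h2] ig hg; apply: le_trans (normc_le_ReIm _) _ => /=.
have H1 : `|(\int[mu]_(x in D) complex.Re (h x))%R| <= (\int[mu]_(x in D) g x)%R.
  apply: le_trans (le_normr_Rintegral mD h1) _; apply: le_Rintegral => //.
    exact: integrable_norm.
  by move=> x Dx; apply: le_trans (Re_le_normc _) (hg x Dx).
have H2 : `|(\int[mu]_(x in D) complex.Im (h x))%R| <= (\int[mu]_(x in D) g x)%R.
  apply: le_trans (le_normr_Rintegral mD h2) _; apply: le_Rintegral => //.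
    exact: integrable_norm.
  by move=> x Dx; apply: le_trans (Im_le_normc _) (hg x Dx).
lra.
Qed.

Hypothesis muD : (mu D < +oo)%E.

Lemma integrable_cst_lt (K : R) : mu.-integrable D (EFin \o (fun=> K)).
Proof.
apply: measurable_bounded_integrable => //.
by exists `|K|; split; rewrite ?num_real// => M M1 t _ /=; exact: ltW.
Qed.

Lemma cintegrable_bounded h K : cmeasurable D h -> (forall x, D x -> normc (h x) <= K) ->
  cintegrable h.
Proof. by move=> mh hK; apply: (cintegrable_dom mh (integrable_cst_lt K)). Qed.

Lemma complex_integral_le_cst h K : cmeasurable D h -> (forall x, D x -> normc (h x) <= K) ->
  normc (complex_integral mu D h) <= 2 * (K * fine (mu D)).
Proof.
move=> mh hK.
have := complex_integral_le (cintegrable_bounded mh hK) (integrable_cst_lt K) hK.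
by rewrite Rintegral_cst.
Qed.

End ComplexIntegral.

(** * Expansion of the kernel *)

Section Kernel.
Local Notation "z ^*" := (conjc z) : ring_scope.
Context {R : realType}.
Variable nu : {finite_measure set (measurableTypeR R) -> \bar R}.
(* The conjugate of the point [z] in the kernel. *)
Variable u : R[i].
Hypothesis u1 : normc u < 1.

Let D : set (measurableTypeR R) := `[0, 1]%classic.
Let mD : measurable D. Proof. exact: measurable_itv. Qed.
Let D01 t : D t -> 0 <= t <= 1. Proof. by rewrite /D/= in_itv. Qed.
Let nuD : (nu D < +oo)%E. Proof. by rewrite ltey_eq fin_num_measure. Qed.
Let V : R := fine (nu D).
Let V0 : 0 <= V. Proof. exact: fine_ge0. Qed.

Definition cauchy_transform (w : R[i]) : R[i] :=
  complex_integral nu `[0, 1]%classic (fun r : R => (1 - r%:C * u * w)^-1).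

(** The Taylor coefficients at [a] of [cauchy_transform]. *)
Definition cauchy_transform_coef (a : R[i]) n : R[i] :=
  complex_integral nu `[0, 1]%classic
    (fun r : R => (r%:C * u) ^+ n * (1 - r%:C * u * a)^-1 ^+ n.+1).

Lemma normc_scaled_le (r : R) (w : R[i]) : D r -> normc (r%:C * u * w) <= normc u * normc w.
Proof.
move=> /D01/andP[r0 r1]; rewrite !normcM normc_real ger0_norm// -mulrA.
by rewrite ler_piMl// mulr_ge0 ?normc_ge0.
Qed.

Lemma normc_1B_ge (w : R[i]) M : normc w <= M -> 1 - M <= normc (1 - w).
Proof.
move=> wM; have := normcD_le (1 - w) w; rewrite subrK normc1; lra.
Qed.

Let mscaled (w : R[i]) : cmeasurable D (fun r : R => r%:C * u * w).
Proof.
apply: cmeasurableM; last exact: cmeasurable_cst.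
apply: cmeasurableM; last exact: cmeasurable_cst.
by apply: cmeasurable_real; exact: measurable_id.
Qed.

Let mru : cmeasurable D (fun r : R => r%:C * u).
Proof.
apply: cmeasurableM; last exact: cmeasurable_cst.
by apply: cmeasurable_real; exact: measurable_id.
Qed.

Section AtPoint.
Variable a : R[i].
Hypothesis ua : normc u * normc a < 1.
Let p0 : R := 1 - normc u * normc a.
Let p0_gt0 : 0 < p0. Proof. by rewrite subr_gt0. Qed.

Let Qp r : D r -> p0 <= normc (1 - r%:C * u * a).
Proof. by move=> Dr; apply: normc_1B_ge; exact: normc_scaled_le. Qed.

Let mQ : cmeasurable D (fun r : R => (1 - r%:C * u * a)^-1).
Proof.
apply: cmeasurable_inv1B => // r Dr.
by apply: le_lt_trans ua; exact: normc_scaled_le.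
Qed.

Let Qi r : D r -> normc (1 - r%:C * u * a)^-1 <= p0^-1.
Proof. by move=> Dr; rewrite normcV lef_pV2 ?posrE ?Qp// (lt_le_trans p0_gt0) ?Qp. Qed.

Let coef_le n r : D r ->
  normc ((r%:C * u) ^+ n * (1 - r%:C * u * a)^-1 ^+ n.+1) <= p0^-1 * (normc u / p0) ^+ n.
Proof.
move=> Dr; rewrite normcM !normcX exprS mulrCA; apply: ler_pM => //.
- exact: normc_ge0.
- by rewrite mulr_ge0 ?exprn_ge0 ?normc_ge0.
- exact: Qi.
rewrite -exprMn lerXn2r ?nnegrE ?mulr_ge0 ?normc_ge0 ?invr_ge0 ?(ltW p0_gt0)//.
apply: ler_pM; rewrite ?normc_ge0 ?Qi//.
by have := normc_scaled_le 1 Dr; rewrite mulr1 normc1 mulr1.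
Qed.

Let mcoef n : cmeasurable D (fun r : R => (r%:C * u) ^+ n * (1 - r%:C * u * a)^-1 ^+ n.+1).
Proof. by apply: cmeasurableM; exact: cmeasurableX. Qed.

Let icoef n : cintegrable nu D (fun r : R => (r%:C * u) ^+ n * (1 - r%:C * u * a)^-1 ^+ n.+1).
Proof. exact: (cintegrable_bounded mD nuD (mcoef n) (@coef_le n)). Qed.

Lemma cauchy_transform_coef_bound n :
  normc (cauchy_transform_coef a n) <= (2 * (p0^-1 * V)) * (normc u / p0) ^+ n.
Proof.
apply: le_trans (complex_integral_le_cst mD nuD (mcoef n) (@coef_le n)) _.
by rewrite -/V; apply: le_of_eq; ring.
Qed.

(** The geometric expansion of the integrand around [a] has ratio at most [q],
    uniformly in [r], and may be integrated term by term. *)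
Lemma cauchy_transform_series h q : 0 <= q < 1 -> normc u * normc h <= q * p0 ->
  climit \oo (psum (cauchy_transform_coef a) h) (cauchy_transform (a + h)).
Proof.
move=> q01 uh; have /andP[q0 q1] := q01.
pose K : R := (p0 * (1 - q))^-1.
have K0 : 0 < p0 * (1 - q) by rewrite mulr_gt0// subr_gt0.
have dn r : D r -> p0 * (1 - q) <= normc (1 - r%:C * u * (a + h)).
  move=> Dr; have -> : 1 - r%:C * u * (a + h) = (1 - r%:C * u * a) - r%:C * u * h by ring.
  have := Qp Dr; have := normc_scaled_le h Dr.
  have := normcD_le (1 - r%:C * u * a - r%:C * u * h) (r%:C * u * h); rewrite subrK; lra.
have uah r : D r -> normc (r%:C * u * (a + h)) < 1.
  move=> Dr; apply: le_lt_trans (normc_scaled_le _ Dr) _.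
  have := ler_wpM2l (normc_ge0 u) (normcD_le a h); rewrite mulrDr => E.
  apply: le_lt_trans E _; apply: le_lt_trans (_ : normc u * normc a + q * p0 < 1); first lra.
  have hq : 0 < 1 - q by rewrite subr_gt0.
  by have := mulr_gt0 p0_gt0 hq; rewrite /p0; lra.
have mF : cmeasurable D (fun r : R => (1 - r%:C * u * (a + h))^-1).
  exact: cmeasurable_inv1B.
have Fb r : D r -> normc (1 - r%:C * u * (a + h))^-1 <= K.
  by move=> Dr; rewrite normcV lef_pV2 ?posrE ?dn// (lt_le_trans K0) ?dn.
have iF := cintegrable_bounded mD nuD mF Fb.
apply: (climit_le (e := fun N => (2 * (K * V)) * q ^+ N)); last exact: cvg_exprM0.
move=> N; rewrite normc_distC.
have [is1 Is1] := complex_integral_sum mD N (fun n => cintegrableZ mD (h ^+ n) (icoef n)).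
have -> : psum (cauchy_transform_coef a) h N = complex_integral nu D
    (fun r : R => \sum_(n < N) h ^+ n * ((r%:C * u) ^+ n * (1 - r%:C * u * a)^-1 ^+ n.+1)).
  by rewrite Is1; apply: eq_bigr => n _; rewrite complex_integralZ// mulrC.
rewrite -complex_integralB//.
have pw (r : R) : D r -> (1 - r%:C * u * (a + h))^-1 -
    \sum_(n < N) h ^+ n * ((r%:C * u) ^+ n * (1 - r%:C * u * a)^-1 ^+ n.+1) =
    (1 - r%:C * u * (a + h))^-1 * (r%:C * u * h * (1 - r%:C * u * a)^-1) ^+ N.
  move=> Dr.
  have d1 : 1 - r%:C * u * (a + h) != 0.
    by apply/eqP => e; have := dn r Dr; rewrite e normc0 leNgt K0.
  have d2 : 1 - r%:C * u * a != 0.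
    by apply/eqP => e; have := Qp Dr; rewrite e normc0 leNgt p0_gt0.
  move: d1 d2; move: (r%:C * u) => v d1 d2.
  elim: (N) => [|n IH]; first by rewrite big_ord0 subr0 expr0 mulr1.
  rewrite big_ord_recr/= opprD addrA IH !exprMn !exprS exprVn.
  by field; rewrite d1 d2 expf_neq0.
have gb r : D r -> normc ((1 - r%:C * u * (a + h))^-1 * (r%:C * u * h * (1 - r%:C * u * a)^-1) ^+ N)
    <= K * q ^+ N.
  move=> Dr; rewrite normcM normcX; apply: ler_pM; rewrite ?exprn_ge0 ?normc_ge0 ?Fb//.
  rewrite lerXn2r ?nnegrE ?normc_ge0// normcM normcV ler_pdivrMr; last exact: lt_le_trans (Qp Dr).
  apply: le_trans (normc_scaled_le h Dr) _; apply: le_trans uh _.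
  by rewrite ler_wpM2l// Qp.
rewrite (eq_complex_integral nu pw).
apply: le_trans (complex_integral_le_cst mD nuD _ gb) _.
  by apply: cmeasurableM => //; apply: cmeasurableX; exact: cmeasurableM.
by rewrite -/V; apply: le_of_eq; ring.
Qed.

Lemma cauchy_transform_analytic : analytic_at cauchy_transform a.
Proof.
pose s := 2 * normc u / p0 + 1.
have s1 : 0 <= normc u / p0 by rewrite divr_ge0 ?normc_ge0 ?ltW.
exists (cauchy_transform_coef a), s; split.
- by rewrite ltr_wpDl// -mulrA mulr_ge0.
- exists (2 * (p0^-1 * V)) => n; apply: le_trans (cauchy_transform_coef_bound n) _.
  rewrite ler_wpM2l ?mulr_ge0 ?invr_ge0 ?(ltW p0_gt0)//.
  by rewrite lerXn2r ?nnegrE//; rewrite /s -mulrA; lra.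
move=> h hs; apply: (@cauchy_transform_series h (1 / 2)); first by apply/andP; lra.
have h0 := normc_ge0 h.
have hp : normc h * (2 * normc u / p0) < 1 by move: hs; rewrite /s mulrDr mulr1; lra.
move: hp; rewrite mulrA ltr_pdivrMr// mul1r; lra.
Qed.

Lemma bergman_kernel_analytic :
  analytic_at (fun w => (1 - u * w)^-1 * cauchy_transform w) a.
Proof.
apply: (analytic_at_div (p := 1 - u * a) (u := u) cauchy_transform_analytic).
  apply/eqP => e; have := @normc_1B_ge (u * a) (normc u * normc a).
  by rewrite normcM => /(_ (lexx _)); rewrite e normc0 leNgt p0_gt0.
by move=> h _; rewrite mulrC; congr (_ / _); ring.
Qed.

End AtPoint.

Lemma cauchy_transform_coef0 n :
  cauchy_transform_coef 0 n = u ^+ n * (\int[nu]_(r in D) r ^+ n)%R%:C.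
Proof.
have i1 : cintegrable nu D (fun r : R => (r ^+ n)%:C).
  apply: (@cintegrable_bounded _ _ _ nu D mD nuD _ 1) => [|r /D01/andP[r0 r1]].
    by apply: cmeasurable_real; exact: measurable_funX.
  by rewrite normc_real ger0_norm ?exprn_ge0// exprn_ile1.
rewrite -complex_integral_real// -complex_integralZ//; apply: eq_complex_integral => r _.
by rewrite mulr0 subr0 invr1 expr1n mulr1 exprMn mulrC rmorphXn.
Qed.

(** Dividing a power series by [1 - u * w] turns its coefficients into partial
    sums. *)
Lemma kernel_div_coef n :
  div_coef (cauchy_transform_coef 0) 1 u n = u ^+ n * (kernel_coef nu n)%:C.
Proof.
elim: n => [|n IH] /=; rewrite cauchy_transform_coef0 divr1.
  by rewrite /kernel_coef big_ord1.
by rewrite IH [kernel_coef nu n.+1]/kernel_coef big_ord_recr/= rmorphD exprS /kernel_coef; ring.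
Qed.

Lemma kernel_coef_le n : kernel_coef nu n <= n.+1%:R * V.
Proof.
rewrite mulr_natl -[n.+1 in leRHS]card_ord -sumr_const; apply: ler_sum => k _.
have icst : nu.-integrable D (EFin \o (fun=> 1 : R)) := integrable_cst_lt mD nuD 1.
have -> : V = (\int[nu]_(r in D) (fun=> 1 : R) r)%R by rewrite Rintegral_cst// mul1r.
apply: le_Rintegral => //.
  apply: (@bounded_integrable _ _ _ _ _ _ 1) => // t /D01/andP[? ?].
  by rewrite ger0_norm ?exprn_ge0// exprn_ile1.
by move=> t /D01/andP[t0 t1]; rewrite exprn_ile1.
Qed.

Lemma kernel_coef_ge0 n : 0 <= kernel_coef nu n.
Proof. by apply: sumr_ge0 => k _; exact: pow_moment_ge0. Qed.

(** [(n + 1) (x / y) ^ n] is at most the geometric sum of ratio [x / y]. *)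
Lemma linear_geometric_le (x y : R) n : 0 <= x < y -> n.+1%:R * x ^+ n <= (1 - x / y)^-1 * y ^+ n.
Proof.
move=> /andP[x0 xy]; have y0 : 0 < y by exact: le_lt_trans xy.
have t01 : 0 <= x / y < 1 by rewrite divr_ge0 ?(ltW y0)//= ltr_pdivrMr// mul1r.
have -> : x ^+ n = (x / y) ^+ n * y ^+ n by rewrite -exprMn divfK// gt_eqF.
rewrite mulrA ler_wpM2r ?exprn_ge0 ?(ltW y0)//.
apply: le_trans (geometric_sum_le n.+1 t01).
rewrite mulr_natl -[n.+1 in leLHS]card_ord -sumr_const; apply: ler_sum => k _.
have /andP[t0 t1] := t01; rewrite ler_wiXn2l ?(ltW t1)//.
by rewrite -ltnS.
Qed.

(** The coefficients grow at most linearly, so any ratio above [|u|] absorbs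
    them; the choice of [sg] strictly between [|u|] and [1] makes the
    expansion uniform on the closed disc. *)
Lemma kernel_series : exists M sg : R, [/\ 0 <= sg < 1,
  forall n, normc (u ^+ n * (kernel_coef nu n)%:C) <= M * sg ^+ n &
  forall w, normc w <= 1 ->
    climit \oo (psum (fun n => u ^+ n * (kernel_coef nu n)%:C) w)
      ((1 - u * w)^-1 * cauchy_transform w)].
Proof.
pose sg := (1 + normc u) / 2; have u0 := normc_ge0 u.
have u1' : normc u < 1 := u1.
have sg01 : 0 <= sg < 1 by apply/andP; rewrite /sg; split; lra.
have usg : 0 <= normc u < sg by apply/andP; rewrite /sg; split; lra.
pose M := V * (1 - normc u / sg)^-1.
have eM n : normc (u ^+ n * (kernel_coef nu n)%:C) <= M * sg ^+ n.
  rewrite normcM normcX normc_real ger0_norm ?kernel_coef_ge0//.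
  apply: le_trans (_ : normc u ^+ n * (n.+1%:R * V) <= _).
    by rewrite ler_wpM2l ?exprn_ge0// kernel_coef_le.
  have := ler_wpM2l V0 (linear_geometric_le n usg).
  by rewrite /M; move: (1 - normc u / sg)^-1 (sg ^+ n) (normc u ^+ n) (n.+1%:R) => A B C E; lra.
exists M, sg; split => // w w1.
have ua0 : normc u * normc (0 : R[i]) < 1 by rewrite normc0 mulr0.
have uw : normc u * normc w <= normc u by rewrite ler_piMr.
have H : climit \oo (psum (cauchy_transform_coef 0) w) (cauchy_transform w).
  rewrite -[w in cauchy_transform w]add0r.
  apply: (cauchy_transform_series ua0 (q := normc u)); first by rewrite u0.
  by rewrite normc0 mulr0 subr0 mulr1.
have e1 : div_coef (cauchy_transform_coef 0) 1 u = fun n => u ^+ n * (kernel_coef nu n)%:C.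
  by apply/funext => n; exact: kernel_div_coef.
rewrite -e1 mulrC; apply: (climit_psum_div (M := M) (s := sg)) => //.
- apply/eqP => e; have := @normc_1B_ge (u * w) (normc u); rewrite normcM e normc0 => /(_ uw); lra.
- by move=> n; rewrite kernel_div_coef.
- by case/andP: sg01.
- by case/andP: sg01 => s0 s1; apply: le_lt_trans s1; rewrite ler_piMl.
Qed.

End Kernel.

(** * Fubini and angular integrals *)

Section Fubini.
Context d1 d2 (T1 : measurableType d1) (T2 : measurableType d2) {R : realType}.
Variables (m1 : {sigma_finite_measure set T1 -> \bar R}) (m2 : {sigma_finite_measure set T2 -> \bar R}).
Variables (A : set T1) (B : set T2).
Hypotheses (mA : measurable A) (mB : measurable B).

(** The real-valued inner integral is the finite part of the extended-valued
    one; the two agree on the slices where [h] is integrable. *)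
Lemma Rintegral_fubini (h : T1 * T2 -> R) :
  (m1 \x m2)%E.-integrable (A `*` B) (EFin \o h) ->
  (forall x, A x -> m2.-integrable B (EFin \o (fun y => h (x, y)))) ->
  (\int[(m1 \x m2)%E]_(z in A `*` B) h z)%R =
  (\int[m1]_(x in A) (\int[m2]_(y in B) h (x, y))%R)%R.
Proof.
move=> ih ihx; have mAB : measurable (A `*` B) by exact: measurableX.
rewrite /Rintegral; congr fine.
rewrite integral_mkcond -integral12_prod_meas1; last exact/(integrable_mkcond _ mAB).
rewrite [RHS]integral_mkcond; apply: eq_integral => x _.
rewrite /fubini_F patchE; case: ifPn => [|xA].
  rewrite inE => Ax; rewrite fineK; last exact: integrable_fin_num (ihx x Ax).
  rewrite [RHS]integral_mkcond; apply: eq_integral => y _.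
  rewrite !patchE; have [yB|yB] := boolP (y \in B).
    by rewrite ifT// inE; split => //; rewrite inE in yB.
  by rewrite ifF//; apply/negbTE; apply: contra yB; rewrite !inE => -[].
apply: etrans (integral0 m2 setT); apply: eq_integral => y _; rewrite patchE ifF//.
by apply/negbTE; apply: contra xA; rewrite !inE => -[].
Qed.

Lemma complex_integral_fubini (h : T1 * T2 -> R[i]) :
  cintegrable (m1 \x m2)%E (A `*` B) h ->
  (forall x, A x -> cintegrable m2 B (fun y => h (x, y))) ->
  complex_integral (m1 \x m2)%E (A `*` B) h =
  complex_integral m1 A (fun x => complex_integral m2 B (fun y => h (x, y))).
Proof.
move=> [h1 h2] hx; rewrite /complex_integral; congr (_ +i* _).
  by apply: Rintegral_fubini => // x /hx[].
by apply: Rintegral_fubini => // x /hx[].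
Qed.

End Fubini.

Section Angular.
Local Notation "z ^*" := (conjc z) : ring_scope.
Context {R : realType}.

Let twopi_gt0 : 0 < 2 * pi :> R. Proof. by rewrite mulr_gt0// pi_gt0. Qed.

Lemma polar_nat_2pi (k : nat) : polar 1 (k%:R * (2 * pi)) = 1 :> R[i].
Proof.
have := polarX (1 : R) (2 * pi) k; rewrite expr1n => <-.
have -> : polar 1 (2 * pi) = 1 :> R[i] by rewrite polar_2pi /polar cos0 sin0 mulr0 mulr1.
by rewrite expr1n.
Qed.

Lemma polar_diff_2pi (k n : nat) : polar 1 ((k%:R - n%:R) * (2 * pi)) = 1 :> R[i].
Proof.
have := polarM (1 : R) (k%:R * (2 * pi)) 1 (- (n%:R * (2 * pi))).
rewrite mulr1 -mulrBl => <-.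
by rewrite -polar_conj !polar_nat_2pi mul1r conjc1.
Qed.

Let B : set (measurableTypeR R) := `[0, 2 * pi[%classic.
Let mB : measurable B. Proof. exact: measurable_itv. Qed.
Let lamB : lebesgue_measure B = (2 * pi)%:E.
Proof. by rewrite lebesgue_measure_itv/= lte_fin twopi_gt0 -EFinB subr0. Qed.
Let lamBoo : (lebesgue_measure B < +oo)%E. Proof. by rewrite lamB ltry. Qed.

Lemma Rintegral_ftc (F f : R -> R) : continuous f -> (forall x : R, is_derive x 1 F (f x)) ->
  (\int[lebesgue_measure]_(t in B) f t)%R = F (2 * pi) - F 0.
Proof.
move=> cf dF.
have cF : continuous F by move=> x; apply: differentiable_continuous; exact/derivable1_diffP.
have mf : measurable_fun setT f by exact: continuous_measurable_fun.
rewrite /Rintegral /B integral_itv_bndo_bndc; last first.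
  by apply/measurable_EFinP; exact: measurable_funTS.
rewrite (@continuous_FTC2 R f F 0 (2 * pi))//.
- exact: continuous_subspaceT.
- split => [x _||].
  + by [].
  + by apply: cvg_at_right_filter; exact: cF.
  + by apply: cvg_at_left_filter; exact: cF.
- by move=> x _; rewrite derive1E; apply: derive_val.
Qed.

Lemma integral_polar (a : R) : a != 0 -> polar 1 (a * (2 * pi)) = 1 :> R[i] ->
  complex_integral lebesgue_measure B (fun t => polar 1 (a * t)) = 0.
Proof.
move=> a0 []; rewrite !mul1r => c1 s1.
rewrite /complex_integral /polar /=; under eq_Rintegral do rewrite mul1r.
under [X in _ +i* X]eq_Rintegral do rewrite mul1r.
have ca : continuous (fun t : R => a * t) by move=> x; apply: cvgM; [exact: cvg_cst|exact: cvg_id].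
have da (x : R) : is_derive x 1 (fun t : R => a * t) a.
  by have := @is_deriveZ _ _ _ id a x 1 1 (is_derive_id x 1); rewrite /GRing.scale/= mulr1.
have -> : (\int[lebesgue_measure]_(t in B) cos (a * t))%R =
    a^-1 * sin (a * (2 * pi)) - a^-1 * sin (a * 0).
  apply: (@Rintegral_ftc (fun t => a^-1 * sin (a * t)) (fun t => cos (a * t))).
- by move=> x; apply: continuous_comp; [exact: ca|exact: continuous_cos].
- move=> x; have h := @is_derive1_comp R _ _ _ _ _ (is_derive_sin (a * x)) (da x).
  have := is_deriveZ a^-1 h; rewrite /GRing.scale/=.
  by rewrite mulrCA mulVf// mulr1.
have -> : (\int[lebesgue_measure]_(t in B) sin (a * t))%R =
    - a^-1 * cos (a * (2 * pi)) - - a^-1 * cos (a * 0).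
  apply: (@Rintegral_ftc (fun t => - a^-1 * cos (a * t)) (fun t => sin (a * t))).
- by move=> x; apply: continuous_comp; [exact: ca|exact: continuous_sin].
- move=> x; have h := @is_derive1_comp R _ _ _ _ _ (is_derive_cos (a * x)) (da x).
  have := is_deriveZ (- a^-1) h; rewrite /GRing.scale/=.
  by rewrite mulrCA [- a^-1 * a]mulNr mulVf// mulrNN mulr1.
by rewrite s1 c1 !mulr0 sin0 cos0 mulr0 !subrr.
Qed.

End Angular.

Section AngularCoefficient.
Local Notation "z ^*" := (conjc z) : ring_scope.
Context {R : realType}.

Let twopi_gt0 : 0 < 2 * pi :> R. Proof. by rewrite mulr_gt0// pi_gt0. Qed.
Let B : set (measurableTypeR R) := `[0, 2 * pi[%classic.
Let mB : measurable B. Proof. exact: measurable_itv. Qed.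
Let lamB : lebesgue_measure B = (2 * pi)%:E.
Proof. by rewrite lebesgue_measure_itv/= lte_fin twopi_gt0 -EFinB subr0. Qed.
Let lamBoo : (lebesgue_measure B < +oo)%E. Proof. by rewrite lamB ltry. Qed.

Lemma cmeasurable_polar1 (D : set (measurableTypeR R)) (r : R) : cmeasurable D (fun t : R => polar r t).
Proof.
split; apply: measurable_funTS; apply: measurable_funM; try exact: measurable_cst.
  by apply: continuous_measurable_fun; exact: continuous_cos.
by apply: continuous_measurable_fun; exact: continuous_sin.
Qed.

Lemma integral_polar_monomials (r : R) (k n : nat) : 0 <= r ->
  complex_integral lebesgue_measure B (fun t => polar r t ^+ k * (polar r t ^+ n)^*) =
  if k == n then (2 * pi * r ^+ (2 * n))%:C else 0.
Proof.
move=> r0.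
have pE t : polar r t ^+ k * (polar r t ^+ n)^* = (r ^+ (k + n))%:C * polar 1 ((k%:R - n%:R) * t).
  by rewrite !polarX polar_conj polarM -exprD polarE -mulNr -mulrDl.
have m1 a : cmeasurable B (fun t : R => polar 1 (a * t)).
  split; apply: measurable_funTS; apply: measurable_funM; try exact: measurable_cst.
    apply: continuous_measurable_fun => x; apply: continuous_comp; last exact: continuous_cos.
    by apply: cvgM; [exact: cvg_cst|exact: cvg_id].
  apply: continuous_measurable_fun => x; apply: continuous_comp; last exact: continuous_sin.
  by apply: cvgM; [exact: cvg_cst|exact: cvg_id].
have i1 a : cintegrable lebesgue_measure B (fun t : R => polar 1 (a * t)).
  by apply: (cintegrable_bounded mB lamBoo (K := 1)) => // t _; rewrite normc_polar normr1.
rewrite (@eq_complex_integral _ _ _ lebesgue_measure B _ _ (fun t _ => pE t)) complex_integralZ//.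
case: eqP => [->|/eqP kn].
  rewrite subrr (_ : complex_integral _ _ _ = (2 * pi)%:C); last first.
    rewrite (_ : (fun t => _) = fun t => (1 : R)%:C); last first.
      by apply/funext => t; rewrite mul0r /polar cos0 sin0 mulr0 mulr1.
    apply: etrans (complex_integral_real lebesgue_measure mB (fun=> 1)) _.
    by congr (_%:C); apply: etrans (Rintegral_cst lebesgue_measure mB 1) _; rewrite [X in fine X]lamB mul1r.
  by rewrite -rmorphM mulrC addnn -mul2n.
rewrite integral_polar ?mulr0 ?polar_diff_2pi//.
by rewrite subr_eq0 eqr_nat.
Qed.

(** On a circle the Taylor series converges uniformly, so it can be integrated
    term by term, and orthogonality leaves one term. *)
Lemma angular_coefficient (f : R[i] -> R[i]) (c : nat -> R[i]) (r : R) n :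
  0 <= r < 1 ->
  (forall r, 0 < r < 1 -> exists M, 0 <= M /\ forall k, normc (c k) <= M * r^-1 ^+ k) ->
  (forall z, normc z < 1 -> climit \oo (psum c z) (f z)) ->
  cintegrable lebesgue_measure B (fun t => f (polar r t) * (polar r t ^+ n)^*) /\
  complex_integral lebesgue_measure B (fun t => f (polar r t) * (polar r t ^+ n)^*) =
  (2 * pi * r ^+ (2 * n))%:C * c n.
Proof.
move=> /andP[r0 r1] cM fc; pose r' := (1 + r) / 2.
have r'01 : 0 < r' < 1 by rewrite /r'; apply/andP; split; lra.
have /andP[r'0 r'1] := r'01.
have [M [M0 cr']] := cM _ r'01.
pose q := r / r'.
have q01 : 0 <= q < 1.
  by rewrite /q divr_ge0 ?(ltW r'0)//= ltr_pdivrMr// mul1r /r'; lra.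
have pr t : normc (polar r t) = r by rewrite normc_polar ger0_norm.
have term t k : normc (c k * polar r t ^+ k) <= M * q ^+ k.
  rewrite normcM normcX pr; apply: le_trans (ler_wpM2r (exprn_ge0 k r0) (cr' k)) _.
  by rewrite -mulrA -exprMn mulrC [r'^-1 * r]mulrC mulrC.
have tail t N : normc (f (polar r t) - psum c (polar r t) N) <= M * q ^+ N / (1 - q).
  by apply: (@series_tail _ (fun k => c k * polar r t ^+ k) M q) => //; apply: fc; rewrite pr.
have mp : cmeasurable B (fun t : R => polar r t) by exact: cmeasurable_polar1.
have mps N : cmeasurable B (fun t : R => psum c (polar r t) N).
  apply: (cmeasurable_sum N (h := fun k t => c k * polar r t ^+ k)) => k.
  by apply: cmeasurableM; [exact: cmeasurable_cst|exact: cmeasurableX].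
have mf : cmeasurable B (fun t : R => f (polar r t)).
  apply: (cmeasurable_lim (h := fun N t => psum c (polar r t) N)) => // t _.
  by apply: fc; rewrite pr.
have mc : cmeasurable B (fun t : R => (polar r t ^+ n)^*).
  by apply: cmeasurable_conj; exact: cmeasurableX.
have nc t : normc ((polar r t ^+ n)^*) <= 1 by rewrite normc_conj normcX pr exprn_ile1// ltW.
have fb t : normc (f (polar r t)) <= M / (1 - q).
  by have := tail t 0%N; rewrite /psum big_ord0 subr0 expr0 mulr1.
have ifc : cintegrable lebesgue_measure B (fun t => f (polar r t) * (polar r t ^+ n)^*).
  apply: (cintegrable_bounded mB lamBoo (K := M / (1 - q))); first exact: cmeasurableM.
  move=> t _; rewrite normcM -[leRHS]mulr1.
  by apply: ler_pM; rewrite ?normc_ge0 ?fb ?nc.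
split => //.
have imono k : cintegrable lebesgue_measure B (fun t : R => polar r t ^+ k * (polar r t ^+ n)^*).
  apply: (cintegrable_bounded mB lamBoo (K := 1)).
    by apply: cmeasurableM => //; exact: cmeasurableX.
  move=> t _; rewrite normcM -[leRHS]mulr1; apply: ler_pM; rewrite ?normc_ge0 ?nc//.
  by rewrite normcX pr exprn_ile1// ltW.
pose I := complex_integral lebesgue_measure B (fun t => f (polar r t) * (polar r t ^+ n)^*).
have close N : (n < N)%N -> normc (I - (2 * pi * r ^+ (2 * n))%:C * c n) <=
    (2 * (M / (1 - q) * (2 * pi))) * q ^+ N.
  move=> nN.
  have [iS IS] := complex_integral_sum mB N (fun k => cintegrableZ mB (c k) (imono k)).
  have -> : (2 * pi * r ^+ (2 * n))%:C * c n =
      complex_integral lebesgue_measure B (fun t => \sum_(k < N) c k * (polar r t ^+ k * (polar r t ^+ n)^*)).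
    rewrite IS (bigD1 (Ordinal nN))//= big1 ?addr0.
      by rewrite complex_integralZ// integral_polar_monomials// eqxx mulrC.
    move=> k kn; rewrite complex_integralZ// integral_polar_monomials//.
    by rewrite ifF ?mulr0//; apply/negbTE; apply: contra kn => /eqP e; apply/eqP/val_inj.
  rewrite /I -complex_integralB//.
  have e t : B t -> f (polar r t) * (polar r t ^+ n)^* -
      \sum_(k < N) c k * (polar r t ^+ k * (polar r t ^+ n)^*) =
      (f (polar r t) - psum c (polar r t) N) * (polar r t ^+ n)^*.
    by move=> _; rewrite mulrBl /psum mulr_suml; congr (_ - _); apply: eq_bigr => k _; rewrite mulrA.
  rewrite (eq_complex_integral _ e).
  have := @complex_integral_le_cst _ _ _ lebesgue_measure B mB lamBoo
    (fun t => (f (polar r t) - psum c (polar r t) N) * (polar r t ^+ n)^*) (M * q ^+ N / (1 - q)).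
  rewrite [X in fine X]lamB => H; apply: le_trans (H _ _) _.
  - by apply: cmeasurableM => //; exact: cmeasurableB.
  - move=> t _; rewrite normcM -[leRHS]mulr1.
    by apply: ler_pM; rewrite ?normc_ge0 ?tail ?nc.
  - by rewrite /=; apply: le_of_eq; ring.
apply/eqP; rewrite -subr_eq0; apply/eqP; apply: normc_eq0.
have H0 := @cvg_exprM0 R (2 * (M / (1 - q) * (2 * pi))) q q01.
have hc : (fun _ : nat => normc (I - (2 * pi * r ^+ (2 * n))%:C * c n)) @ \oo -->
  normc (I - (2 * pi * r ^+ (2 * n))%:C * c n) by exact: cvg_cst.
apply: (ler_cvg_to hc H0); near=> N; apply: close.
by near: N; exact: nbhs_infty_gt.
Unshelve. all: by end_near. Qed.

End AngularCoefficient.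

(** * Inner products in the Bergman space *)

Section Reproducing.
Local Notation "z ^*" := (conjc z) : ring_scope.
Context {R : realType}.
Variable omega : {finite_measure set (measurableTypeR R) -> \bar R}.

Let A : set (measurableTypeR R) := `[0, 1[%classic.
Let B : set (measurableTypeR R) := `[0, 2 * pi[%classic.
Let mA : measurable A. Proof. exact: measurable_itv. Qed.
Let mB : measurable B. Proof. exact: measurable_itv. Qed.
Local Notation mu := (omega \x (@lebesgue_measure R))%E.
Local Notation rect := (@polar_rect R).
Let mrect : measurable rect. Proof. exact: measurableX. Qed.
Let twopi_gt0 : 0 < 2 * pi :> R. Proof. by rewrite mulr_gt0// pi_gt0. Qed.

Let murect : (mu rect < +oo)%E.
Proof.
have lB : lebesgue_measure B = (2 * pi)%:E.
  by rewrite lebesgue_measure_itv/= lte_fin twopi_gt0 -EFinB subr0.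
rewrite /polar_rect product_measure1E// [X in (_ * X)%E]lB.
by rewrite ltey_eq fin_numM// fin_num_measure.
Qed.

Let A01 (r : R) : A r -> 0 <= r < 1. Proof. by rewrite /A/= in_itv. Qed.

Let rect_norm p : rect p -> normc (polar p.1 p.2) = p.1 /\ 0 <= p.1 < 1.
Proof.
by move=> [/A01 /andP[r0 r1] _]; rewrite normc_polar ger0_norm// r0 r1.
Qed.

Let mpolar : cmeasurable rect (fun p : measurableTypeR R * measurableTypeR R => polar p.1 p.2).
Proof.
split; apply: measurable_funTS; apply: measurable_funM; try exact: measurable_fst.
  apply: (measurableT_comp (f := cos)); last exact: measurable_snd.
  by apply: continuous_measurable_fun; exact: continuous_cos.
apply: (measurableT_comp (f := sin)); last exact: measurable_snd.
by apply: continuous_measurable_fun; exact: continuous_sin.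
Qed.

Let mseries (f : R[i] -> R[i]) (c : nat -> R[i]) :
  (forall z, normc z < 1 -> climit \oo (psum c z) (f z)) ->
  cmeasurable rect (fun p : measurableTypeR R * measurableTypeR R => f (polar p.1 p.2)).
Proof.
move=> fc; apply: (cmeasurable_lim (h := fun N p => psum c (polar p.1 p.2) N)).
  move=> N; apply: (cmeasurable_sum N (h := fun k p => c k * polar p.1 p.2 ^+ k)) => k.
  by apply: cmeasurableM; [exact: cmeasurable_cst|exact: cmeasurableX].
by move=> p /rect_norm[pn /andP[_ p1]]; apply: fc; rewrite pn.
Qed.

Let normc_sqr (z : R[i]) : normc z ^+ 2 = complex.Re z ^+ 2 + complex.Im z ^+ 2.
Proof. by case: z => a b /=; rewrite sqr_sqrtr// addr_ge0 ?sqr_ge0. Qed.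

Let mnormsq (f : R[i] -> R[i]) :
  cmeasurable rect (fun p : measurableTypeR R * measurableTypeR R => f (polar p.1 p.2)) ->
  measurable_fun rect (fun p : measurableTypeR R * measurableTypeR R =>
    p.1 * normc (f (polar p.1 p.2)) ^+ 2).
Proof.
move=> [m1 m2]; apply: measurable_funM; first by apply: measurable_funTS; exact: measurable_fst.
under eq_fun do rewrite normc_sqr.
by apply: measurable_funD; exact: measurable_funX.
Qed.

Lemma bergman_space_bounded (g : R[i] -> R[i]) (c : nat -> R[i]) G :
  analytic_on_disc g -> (forall z, normc z < 1 -> climit \oo (psum c z) (g z)) ->
  (forall z, normc z < 1 -> normc (g z) <= G) -> bergman_space omega g.
Proof.
move=> ag gc gG; split => //; rewrite /bergman_normsq.
apply: integrable_lty => //; have ms := mnormsq (mseries gc).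
apply: (le_integrable mrect _ _ (integrable_cst_lt mrect murect (G ^+ 2))).
  exact/measurable_EFinP.
move=> p /rect_norm[pn /andP[p0 p1]]; rewrite /= lee_fin.
have gp := gG (polar p.1 p.2); rewrite pn in gp; have {}gp := gp p1.
have G0 : 0 <= G := le_trans (normc_ge0 _) gp.
rewrite (ger0_norm (mulr_ge0 p0 (sqr_ge0 _))) (ger0_norm (sqr_ge0 G)).
apply: le_trans (_ : normc (g (polar p.1 p.2)) ^+ 2 <= _); first by rewrite ler_piMl ?sqr_ge0// ltW.
by apply: lerXn2r => //; rewrite nnegrE normc_ge0.
Qed.

Section Inner.
Variables (f : R[i] -> R[i]) (c : nat -> R[i]).
Hypothesis fA : (bergman_normsq omega f < +oo)%E.
Hypothesis cM : forall r, 0 < r < 1 -> exists M, 0 <= M /\ forall k, normc (c k) <= M * r^-1 ^+ k.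
Hypothesis fc : forall z, normc z < 1 -> climit \oo (psum c z) (f z).

(* Dominates [p.1 * |f|], because [x <= x ^ 2 + 1], and is integrable because [f]
   has finite norm. *)
Let phi (p : measurableTypeR R * measurableTypeR R) : R := p.1 * normc (f (polar p.1 p.2)) ^+ 2 + 1.

Let mf := mseries fc.

Let iphi : mu.-integrable rect (EFin \o phi).
Proof.
have i1 : mu.-integrable rect (EFin \o (fun p => p.1 * normc (f (polar p.1 p.2)) ^+ 2)).
  apply/integrableP; split; first by apply/measurable_EFinP; exact: mnormsq.
  apply: le_lt_trans fA; rewrite /bergman_normsq; apply: le_of_eq.
  apply: eq_integral => p; rewrite inE => /rect_norm[_ /andP[p0 _]].
  by rewrite /= ger0_norm// mulr_ge0 ?sqr_ge0.
exact: (integrableD mrect i1 (integrable_cst_lt mrect murect 1)).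
Qed.

Let le_phi p : rect p -> p.1 * normc (f (polar p.1 p.2)) <= phi p.
Proof.
move=> /rect_norm[_ /andP[p0 p1]]; rewrite /phi.
set x := normc _; have x0 : 0 <= x := normc_ge0 _.
have : 0 <= p.1 * ((x - 1) ^+ 2 + x) by rewrite mulr_ge0// addr_ge0 ?sqr_ge0.
rewrite expr2; nra.
Qed.

Let phi_int : R := (\int[mu]_(p in rect) phi p)%R.

Lemma inner_integrable (k : measurableTypeR R * measurableTypeR R -> R[i]) (K : R) : 0 <= K ->
  cmeasurable rect k -> (forall p, rect p -> normc (k p) <= K) ->
  cintegrable mu rect (fun p => (p.1 : R)%:C * (f (polar p.1 p.2) * (k p)^*)) /\
  normc (complex_integral mu rect (fun p => (p.1 : R)%:C * (f (polar p.1 p.2) * (k p)^*))) <=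
    2 * (K * phi_int).
Proof.
move=> K0 mk kK.
have ik : mu.-integrable rect (EFin \o (fun p => K * phi p)) := integrableZl mrect K iphi.
have mi : cmeasurable rect (fun p => (p.1 : R)%:C * (f (polar p.1 p.2) * (k p)^*)).
  apply: cmeasurableM; first by apply: cmeasurable_real; apply: measurable_funTS; exact: measurable_fst.
  by apply: cmeasurableM; [exact: mf|exact: cmeasurable_conj].
have le p : rect p -> normc ((p.1 : R)%:C * (f (polar p.1 p.2) * (k p)^*)) <= K * phi p.
  move=> rp; have [_ /andP[p0 p1]] := rect_norm rp.
  rewrite !normcM normc_real ger0_norm// normc_conj mulrA mulrC.
  by apply: ler_pM; rewrite ?mulr_ge0 ?normc_ge0 ?kK ?le_phi.
have ci := cintegrable_dom mrect mi ik le; split => //.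
apply: le_trans (complex_integral_le mrect ci ik le) _.
by rewrite RintegralZl.
Qed.

Let pow_int n : R := (\int[omega]_(r in A) r ^+ n)%R.

(** For fixed radius the angular integral isolates [c n]; the radial one is then
    a moment of [omega], of odd order because of the factor [r] in polar
    coordinates. *)
Lemma inner_monomial n :
  complex_integral mu rect (fun p => (p.1 : R)%:C * (f (polar p.1 p.2) * (polar p.1 p.2 ^+ n)^*)) =
  (2 * pi * pow_int (2 * n).+1)%:C * c n.
Proof.
have ang r : A r -> _ := fun Ar => angular_coefficient n (A01 Ar) cM fc.
have pn1 p : rect p -> normc (polar p.1 p.2 ^+ n) <= 1.
  by move=> /rect_norm[pn /andP[p0 p1]]; rewrite normcX pn exprn_ile1// ltW.
have [ci _] := inner_integrable ler01 (cmeasurableX n mpolar) pn1.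
have ci2 r : A r -> cintegrable lebesgue_measure B
    (fun t => (r : R)%:C * (f (polar r t) * (polar r t ^+ n)^*)).
  by move=> Ar; have [i1 _] := ang r Ar; exact: (cintegrableZ mB _ i1).
apply: etrans (complex_integral_fubini mA mB ci ci2) _ => /=.
have e r : A r -> complex_integral lebesgue_measure B
    (fun t => (r : R)%:C * (f (polar r t) * (polar r t ^+ n)^*)) = c n * (2 * pi * r ^+ (2 * n).+1)%:C.
  move=> Ar; have [i1 I1] := ang r Ar.
  rewrite complex_integralZ// I1 exprS mulrA -rmorphM mulrC; congr (_ * _%:C); ring.
rewrite (eq_complex_integral _ e) complex_integralZ//; last first.
  have : (omega A < +oo)%E by rewrite ltey_eq fin_num_measure.
  move=> oA; apply: (cintegrable_bounded mA oA (K := 2 * pi)).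
    by apply: cmeasurable_real; apply: measurable_funM; [exact: measurable_cst|exact: measurable_funX].
  move=> r /A01/andP[r0 r1]; rewrite normc_real (ger0_norm (mulr_ge0 (ltW twopi_gt0) (exprn_ge0 _ r0))).
  by rewrite ler_piMr ?(ltW twopi_gt0)// exprn_ile1// ltW.
rewrite mulrC; congr (_ * _).
apply: etrans (complex_integral_real omega mA (fun r : R => 2 * pi * r ^+ (2 * n).+1)) _.
congr (_%:C); apply: RintegralZl => //.
apply: (@bounded_integrable _ _ _ _ _ _ 1) => // r /A01/andP[r0 r1].
by rewrite ger0_norm ?exprn_ge0// exprn_ile1// ltW.
Qed.

(** The partial sums of the expansion of [g] converge uniformly on the disc,
    and the pairing with [f] is continuous for uniform convergence. *)
Lemma inner_series (g : R[i] -> R[i]) (e : nat -> R[i]) M sg :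
  0 <= sg < 1 -> (forall n, normc (e n) <= M * sg ^+ n) ->
  (forall z, normc z < 1 -> climit \oo (psum e z) (g z)) ->
  climit \oo (fun N => \sum_(n < N) (e n)^* * ((2 * pi * pow_int (2 * n).+1)%:C * c n))
    (bergman_inner omega f g).
Proof.
move=> sg01 eM ge; have /andP[s0 s1] := sg01.
have M0 : 0 <= M := local_bound_ge0 eM.
have mg := mseries ge.
have term z n : normc z < 1 -> normc (e n * z ^+ n) <= M * sg ^+ n.
  move=> z1; rewrite normcM normcX; apply: le_trans (eM n).
  by rewrite ler_piMr ?normc_ge0// exprn_ile1 ?normc_ge0// ltW.
have tail z N : normc z < 1 -> normc (g z - psum e z N) <= M * sg ^+ N / (1 - sg).
  by move=> z1; apply: (@series_tail _ (fun n => e n * z ^+ n) M sg) => //; [move=> n; exact: term|exact: ge].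
have mps N : cmeasurable rect (fun p : measurableTypeR R * measurableTypeR R => psum e (polar p.1 p.2) N).
  apply: (cmeasurable_sum N (h := fun k p => e k * polar p.1 p.2 ^+ k)) => k.
  by apply: cmeasurableM; [exact: cmeasurable_cst|exact: cmeasurableX].
have tail0 N : 0 <= M * sg ^+ N / (1 - sg).
  by rewrite !mulr_ge0 ?exprn_ge0 ?invr_ge0 ?subr_ge0 ?(ltW s1).
have gK p : rect p -> normc (g (polar p.1 p.2)) <= M * sg ^+ 0 / (1 - sg).
  move=> /rect_norm[pn /andP[_ p1]]; have := tail (polar p.1 p.2) 0%N.
  by rewrite pn /psum big_ord0 subr0 => /(_ p1).
have [ig _] := inner_integrable (tail0 0%N) mg gK.
have imono k : cintegrable mu rect (fun p => (p.1 : R)%:C * (f (polar p.1 p.2) * (polar p.1 p.2 ^+ k)^*)).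
  have pk1 p : rect p -> normc (polar p.1 p.2 ^+ k) <= 1.
    by move=> /rect_norm[pn /andP[p0 p1]]; rewrite normcX pn exprn_ile1// ltW.
  by have [] := inner_integrable ler01 (cmeasurableX k mpolar) pk1.
apply: (climit_le (e := fun N => (2 * (M / (1 - sg) * phi_int)) * sg ^+ N)); last exact: cvg_exprM0.
move=> N; rewrite normc_distC.
have [iS IS] := complex_integral_sum mrect N (fun k => cintegrableZ mrect (e k)^* (imono k)).
have -> : \sum_(n < N) (e n)^* * ((2 * pi * pow_int (2 * n).+1)%:C * c n) =
    complex_integral mu rect (fun p => \sum_(n < N) (e n)^* *
      ((p.1 : R)%:C * (f (polar p.1 p.2) * (polar p.1 p.2 ^+ n)^*))).
  by rewrite IS; apply: eq_bigr => k _; rewrite complex_integralZ// inner_monomial.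
rewrite [bergman_inner _ _ _](_ : _ = complex_integral mu rect (fun p => (p.1 : R)%:C *
  (f (polar p.1 p.2) * (g (polar p.1 p.2))^*)))// -complex_integralB//.
have pw p : rect p -> (p.1 : R)%:C * (f (polar p.1 p.2) * (g (polar p.1 p.2))^*) -
    \sum_(n < N) (e n)^* * ((p.1 : R)%:C * (f (polar p.1 p.2) * (polar p.1 p.2 ^+ n)^*)) =
    (p.1 : R)%:C * (f (polar p.1 p.2) * (g (polar p.1 p.2) - psum e (polar p.1 p.2) N)^*).
  move=> _; rewrite conjcB [in RHS]mulrBr [in RHS]mulrBr; congr (_ - _).
  have -> : (psum e (polar p.1 p.2) N)^* = \sum_(n < N) (e n)^* * (polar p.1 p.2 ^+ n)^*.
    by rewrite /psum (rmorph_sum (@conjc R)); apply: eq_bigr => k _; exact: conjcM.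
  by rewrite !mulr_sumr; apply: eq_bigr => k _; ring.
rewrite (eq_complex_integral _ pw).
have [|p rp|_] := @inner_integrable (fun p => g (polar p.1 p.2) - psum e (polar p.1 p.2) N) _ (tail0 N).
- exact: cmeasurableB.
- by apply: tail; have [-> /andP[]] := rect_norm rp.
move=> h; apply: le_trans h _.
by apply: le_of_eq; ring.
Qed.

End Inner.
End Reproducing.

(** * The reproducing property *)

Section Conclusion.
Local Notation "z ^*" := (conjc z) : ring_scope.
Context {R : realType}.
Variables nu omega : {finite_measure set (measurableTypeR R) -> \bar R}.
Hypothesis nu_div : (\int[nu]_(r in `[0%R, 1%R]%classic) ((1 - r)%:E^-1) = +oo)%E.
Hypothesis omM : forall k,
  (\int[omega]_(t in `[0, 1[%classic) t ^+ k)%R = radial_moment nu k / (2 * pi).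

Definition bergman_kernel (z w : R[i]) : R[i] :=
  (1 - z^* * w)^-1 * cauchy_transform nu z^* w.

Lemma kernel_coef_gt0 n : 0 < kernel_coef nu n.
Proof. by have := radial_moment_gt0 nu_div (2 * n).+1; rewrite radial_moment_odd invr_gt0. Qed.

(** The [n]-th coefficient of the kernel is [z^* ^+ n * b n], and the moment
    of [omega] cancels [b n]; what remains of the inner product is the Taylor
    series of [f] at [z]. *)
Lemma bergman_kernel_reproducing : reproducing_kernel omega bergman_kernel.
Proof.
move=> z /unit_discE z1.
have u1 : normc z^* < 1 by rewrite normc_conj.
have [M [sg [sg01 eM eser]]] := kernel_series nu u1.
have ser w : normc w < 1 ->
    climit \oo (psum (fun n => z^* ^+ n * (kernel_coef nu n)%:C) w) (bergman_kernel z w).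
  by move=> w1; apply: eser; exact: ltW.
split.
  apply: (@bergman_space_bounded _ omega _ (fun n => z^* ^+ n * (kernel_coef nu n)%:C) (M * sg ^+ 0 / (1 - sg))).
  - apply: analytic_on_discP => a a1; apply: bergman_kernel_analytic.
    by apply: le_lt_trans u1; rewrite ler_piMr ?normc_ge0// ltW.
  - exact: ser.
  - move=> w w1.
    have := @series_tail _ (fun n => z^* ^+ n * (kernel_coef nu n)%:C * w ^+ n) M sg _ 0 sg01 _ (ser w w1).
    rewrite big_ord0 subr0; apply=> n.
    rewrite normcM normcX; apply: le_trans (eM n).
    by rewrite ler_piMr ?normc_ge0// exprn_ile1 ?normc_ge0// ltW.
move=> f [fa fA]; have [c [cM fc]] := disc_taylor fa.
have H := inner_series fA cM fc sg01 eM ser.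
apply: (@climit_unique _ \oo _ _ _ _ (fc z z1)).
set v := (fun N => _) in H; suff <- : v = psum c z by [].
apply/funext => N; rewrite /v /psum; apply: eq_bigr => n _; rewrite conjcM conjcX conjcK conjc_real omM radial_moment_odd.
have b0 := kernel_coef_gt0 n.
have -> : 2 * pi * ((kernel_coef nu n)^-1 / (2 * pi)) = (kernel_coef nu n)^-1.
  by rewrite mulrC divfK// gt_eqF// mulr_gt0// pi_gt0.
have bb : (kernel_coef nu n)%:C * (kernel_coef nu n)^-1%:C = 1 :> R[i].
  have := rmorphM (real_complex R) (kernel_coef nu n) (kernel_coef nu n)^-1.
  by rewrite divff ?gt_eqF// rmorph1 => <-.
by rewrite mulrA -(mulrA (z ^+ n)) bb mulr1 mulrC.
Qed.

End Conclusion.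

Theorem theorem1 (R : realType)
  (nu : {finite_measure set (measurableTypeR R) -> \bar R})
  (nu_supp : nu (~` `[0, 1]%classic) = 0%E)
  (nu_div : (\int[nu]_(r in `[0%R, 1%R]%classic) ((1 - r)%:E^-1) = +oo)%E) :
  exists omega : {finite_measure set (measurableTypeR R) -> \bar R},
    Dhat omega /\
    exists B : R[i] -> R[i] -> R[i],
      reproducing_kernel omega B /\
      forall z zeta : R[i], unit_disc z -> unit_disc zeta ->
        B z zeta = (1 - z^* * zeta)^-1 *
          complex_integral nu `[0, 1]%classic (fun r : R => (1 - r%:C * z^* * zeta)^-1).
Proof.
have [omega [omD omM]] := exists_radial_measure nu_div.
exists omega; split => //; exists (bergman_kernel nu); split.
  exact: bergman_kernel_reproducing nu_div omM.
by [].
Qed.
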